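(* Let $d\geq 2$ and $n\geq 2$ be integers, and let $E\subseteq\mathbb{R}^d$ be a Lebesgue-measurable set whose upper Banach density satisfies $\rho(E)>\frac{n-2}{n-1}$. Let $0<S\leq D$ be real numbers. Then there exists a number $R=R(E,S,D,n)>0$ such that, for every set $P\subseteq\mathbb{R}^d$ of exactly $n$ points satisfying $S\leq \operatorname{sep}P\leq\operatorname{diam}P\leq D$ and every $r\geq R$, there exist $z_r\in\mathbb{R}^d$ and a rotation $Q_r\in SO(d)$ such that $rQ_r(P)+z_r\subseteq E$.
   Context: $\mathcal{L}^d$ is Lebesgue measure on $\mathbb{R}^d$, $\|\cdot\|$ is the Euclidean norm, and $B_r(x)$ is the closed ball of centre $x$ and radius $r$. The upper Banach density of a measurable set $E\subseteq\mathbb{R}^d$ is $$\rho(E)=\limsup_{r\to+\infty}\ \sup_{x\in\mathbb{R}^d}\frac{\mathcal{L}^d(E\cap B_r(x))}{\mathcal{L}^d(B_r(x))}.$$ For a finite set $P=\{x_0,\dots,x_{n-1}\}\subseteq\mathbb{R}^d$ of $n\ge 2$ distinct points, $\operatorname{sep}P=\min_{i\neq j}\|x_i-x_j\|$ and $\operatorname{diam}P=\max_{i\neq j}\|x_i-x_j\|$. $SO(d)$ is the group of rotations of $\mathbb{R}^d$ about the origin. *)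

(* Defs.v *)
From mathcomp Require Import all_boot all_order all_algebra finmap.
From mathcomp Require Import all_classical all_reals all_analysis.

Set Implicit Arguments.
Unset Strict Implicit.
Unset Printing Implicit Defensive.

Import Order.TTheory GRing.Theory Num.Theory.
Import numFieldNormedType.Exports.

Local Open Scope classical_set_scope.
Local Open Scope ring_scope.

(* R^d is the type 'rV[R]_d of row vectors. The norm and the balls that the
   library puts on it are those of the sup norm, so the Euclidean ones are
   defined here. *)

Definition enorm (R : realType) (d : nat) (x : 'rV[R]_d) : R :=
  Num.sqrt (\sum_(i < d) x 0 i ^+ 2).

Definition eball (R : realType) (d : nat) (x : 'rV[R]_d) (r : R)
    : set 'rV[R]_d :=
  [set y | enorm (y - x) <= r].

Definition box (R : realType) (d : nat) (a b : 'rV[R]_d) : set 'rV[R]_d :=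
  [set x | forall i, a 0 i <= x 0 i <= b 0 i].

Definition box_volume (R : realType) (d : nat) (a b : 'rV[R]_d) : R :=
  \prod_(i < d) (b 0 i - a 0 i).

(* Lebesgue outer measure: the infimum of the total volumes of the countable
   covers by closed boxes (possibly degenerate, so finite covers are allowed).
   The d-dimensional Lebesgue measure is its restriction to the sets that are
   measurable in the sense of Caratheodory. *)
Definition lebesgue_rV (R : realType) (d : nat) (A : set 'rV[R]_d) : \bar R :=
  ereal_inf [set v : \bar R | exists a b : nat -> 'rV[R]_d,
    [/\ forall k i, a k 0 i <= b k 0 i,
        A `<=` \bigcup_k box (a k) (b k)
      & v = (\sum_(0 <= k <oo) (box_volume (a k) (b k))%:E)%E]].

Definition lebesgue_measurable (R : realType) (d : nat) (E : set 'rV[R]_d)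
    : Prop :=
  caratheodory_measurable (@lebesgue_rV R d) E.

Definition upper_banach_density (R : realType) (d : nat) (E : set 'rV[R]_d)
    : \bar R :=
  limf_esup
    (fun r : R => ereal_sup [set
      (lebesgue_rV (E `&` eball x r) / lebesgue_rV (eball x r))%E
      | x in [set: 'rV[R]_d]])
    (+oo : set_system R).

(* For sets with at least two points; distances are nonnegative, so the index
   element 0 does not affect the maximum, and each of them is at most [diam P],
   so the index element [diam P] does not affect the minimum. *)
Definition diam (R : realType) (d : nat) (P : {fset 'rV[R]_d}) : R :=
  \big[Num.max/0]_(x <- P) \big[Num.max/0]_(y <- P | x != y) enorm (x - y).

Definition sep (R : realType) (d : nat) (P : {fset 'rV[R]_d}) : R :=
  \big[Num.min/diam P]_(x <- P)
    \big[Num.min/diam P]_(y <- P | x != y) enorm (x - y).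

(* Rotations act on row vectors by [x *m Q]. *)
Definition SO (R : realType) (d : nat) : set 'M[R]_d :=
  [set Q | Q *m Q^T = 1%:M /\ \det Q = 1].
Arguments SO : clear implicits.

(* Main.v *)
Require Import Defs.
From mathcomp Require Import all_boot all_order all_algebra finmap.
From mathcomp Require Import all_classical all_reals all_analysis.
From HB Require Import structures.
From mathcomp Require Import measurable_realfun perm ring lra zify.

Set Implicit Arguments.
Unset Strict Implicit.
Unset Printing Implicit Defensive.

Import Order.TTheory GRing.Theory Num.Theory.
Import numFieldNormedType.Exports.

Local Open Scope classical_set_scope.
Local Open Scope ring_scope.

(** Let [delta] be the upper density of [E], let [B] be a huge ball in which the
    density of [E] is nearly [delta], put [X = E `&` B] and consider the balanced
    indicator [g = 1_X - delta 1_B]. Fix a point of the pattern; the differences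
    of the other points with it are [n - 1] vectors [v]. Suppose that for each
    of them the average of [1_X (z + r v Q)] over [z] in [X] and over a finite
    set of rotations [Q], the same for all [v], is nearly [delta]. As
    [(n - 1) delta > n - 2], some [z] and [Q] then satisfy all [n - 1] conditions
    [z + r v Q \in X] at once ([pattern_exists]), which yields the copy of the
    pattern. The average is nearly [delta] as soon as the average over [Q] of the
    translates of [g] by [r v Q] has small norm in [L^2] ([correlation_ge]).

    The square of that norm is the mean over [Q] and [Q'] of [A (r v (Q - Q'))],
    where [A] is the normalised autocorrelation of [g]. For a finite sequence
    [s] of vectors, [energy A s] denotes the mean of [A] over the differences of
    entries of [s]; it is the square norm of the average of the translates of
    [g] by [s], and only three properties of [A] matter for its study: it is
    positive definite, at most [1] at the origin, and uniformly continuous. The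
    rotations are those by angles [j / N] in a fixed finite family of planes.
    - In one plane, [v Q - v Q'] is a chord: [2 sin h] times a direction, where
      [h] depends on the difference of the two angles and the direction on their
      sum. For a given direction, the numbers [2 r sin h] are so smoothly
      distributed that translating all of them by an amount much smaller than
      [r] hardly changes sums over them ([sine_sum_shift]). The energy of an arc
      is therefore bounded by the mean energy of segments of length [L] much
      smaller than [r] in the directions of the chords ([arc_energy_le]).
    - By Cauchy-Schwarz, the mean energy of the segments, raised to the power
      [2 ^ (d - 1)], is at most the mean energy of compositions of [d] segment
      averages in independent directions. The planes contain points of the
      moment curve, so that the directions of chords are in general position
      ([chords_generic]); most [d]-tuples of directions are bases with bounded
      coordinates, and composing the segment averages amounts to averaging over
      a parallelepiped of size [L]. If [L] is much larger than [R0], translation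
      by a vector of norm at most [R0] changes such an average very little, so
      its energy is dominated by that of averages at scale [R0]
      ([mean_segment_energy_exp_le]).
    Thus the energy of rotations is small for all [r >= C * R0] if the averages
    of [g] at the scale [R0] are small in the mean ([rotations_decorrelate]).

    They are, for an [R0] that depends on [E] and the required precision only:
    on balls of radius at least [R0] the density of [E] hardly exceeds [delta],
    so the averages of [g] are bounded above by a small number, while their
    integral, that of [g], is not much below zero ([small_energy_exists]). To
    have finite sequences of translations, the averages over balls are replaced
    by averages over lattice points, which are comparable once [X] is replaced by
    the grid cells that it nearly fills ([full_cells]). *)

(** * Averages over finite sequences *)

Section Mean.
Variable R : realType.
Implicit Types X Y : Type.

Definition mean X (s : seq X) (F : X -> R) : R :=
  (\sum_(x <- s) F x) / (size s)%:R.

Lemma eq_mean X (s : seq X) (F G : X -> R) : F =1 G -> mean s F = mean s G.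
Proof. by move=> FG; rewrite /mean; under eq_bigr do rewrite FG. Qed.

Lemma eq_mean_in (X : eqType) (s : seq X) (F G : X -> R) :
  {in s, F =1 G} -> mean s F = mean s G.
Proof. by move=> FG; rewrite /mean; congr (_ / _); exact: eq_big_seq. Qed.

Lemma meanD X (s : seq X) (F G : X -> R) :
  mean s (fun x => F x + G x) = mean s F + mean s G.
Proof. by rewrite /mean big_split/= mulrDl. Qed.

Lemma meanZ X (s : seq X) (k : R) (F : X -> R) :
  mean s (fun x => k * F x) = k * mean s F.
Proof. by rewrite /mean -mulr_sumr mulrA. Qed.

Lemma meanB X (s : seq X) (F G : X -> R) :
  mean s (fun x => F x - G x) = mean s F - mean s G.
Proof.
rewrite -[X in _ - X]mul1r -mulNr -meanZ -meanD.
by apply: eq_mean => x; rewrite mulN1r.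
Qed.

Lemma mean_cst X (s : seq X) (c : R) : (0 < size s)%N ->
  mean s (fun=> c) = c.
Proof.
move=> s0; rewrite /mean big_const_seq count_predT iter_addr_0.
rewrite -[c *+ _]mulr_natr.
by rewrite mulfK// pnatr_eq0 -lt0n.
Qed.

Lemma le_mean X (s : seq X) (F G : X -> R) : (forall x, F x <= G x) ->
  mean s F <= mean s G.
Proof.
by move=> FG; rewrite /mean ler_wpM2r ?invr_ge0// ler_sum.
Qed.

Lemma le_mean_in (X : eqType) (s : seq X) (F G : X -> R) :
  (forall x, x \in s -> F x <= G x) -> mean s F <= mean s G.
Proof.
move=> FG; rewrite /mean ler_wpM2r ?invr_ge0//.
by rewrite big_seq [leRHS]big_seq; exact: ler_sum.
Qed.

Lemma mean_le_cst X (s : seq X) (F : X -> R) (c : R) : 0 <= c ->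
  (forall x, F x <= c) -> mean s F <= c.
Proof.
move=> c0 Fc; case: (posnP (size s)) => s0.
  by rewrite /mean s0 invr0 mulr0.
by rewrite -[leRHS](mean_cst c s0); exact: le_mean.
Qed.

Lemma mean_ge0 X (s : seq X) (F : X -> R) : (forall x, 0 <= F x) ->
  0 <= mean s F.
Proof. by move=> F0; rewrite /mean mulr_ge0 ?invr_ge0// sumr_ge0. Qed.

Lemma exchange_mean X Y (s : seq X) (t : seq Y) (F : X -> Y -> R) :
  mean s (fun x => mean t (F x)) = mean t (fun y => mean s (fun x => F x y)).
Proof.
rewrite /mean -!mulr_suml exchange_big/= -!mulrA; congr (_ * _).
by rewrite mulrC.
Qed.

Lemma mean_map X Y (f : X -> Y) (s : seq X) (F : Y -> R) :
  mean (map f s) F = mean s (F \o f).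
Proof. by rewrite /mean big_map size_map. Qed.

Lemma mean_allpairs X Y Z (f : X -> Y -> Z) (s : seq X) (t : seq Y)
    (F : Z -> R) :
  mean (allpairs f s t) F = mean s (fun x => mean t (fun y => F (f x y))).
Proof.
rewrite /mean big_allpairs_dep/= size_allpairs -mulr_suml natrM invfM.
by rewrite -mulrA [X in _ * X]mulrC.
Qed.

Lemma mean_abs_le X (s : seq X) (F : X -> R) (c : R) : 0 <= c ->
  (forall x, `|F x| <= c) -> `|mean s F| <= c.
Proof.
move=> c0 Fc; rewrite ler_norml; apply/andP; split; last first.
  by apply: mean_le_cst => // x; exact: le_trans (ler_norm _) (Fc x).
have -> : mean s F = - mean s (fun x => - F x).
  by rewrite -mulN1r -meanZ; apply: eq_mean => x; rewrite mulN1r opprK.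
rewrite lerN2; apply: mean_le_cst => // x.
by apply: le_trans (Fc x); rewrite -normrN; exact: ler_norm.
Qed.

(** The variance [mean (F - mean F)^2] is nonnegative. *)
Lemma mean_sqr_le X (s : seq X) (F : X -> R) :
  mean s F ^+ 2 <= mean s (fun x => F x ^+ 2).
Proof.
case: (posnP (size s)) => s0.
  by rewrite /mean s0 !invr0 !mulr0 expr0n.
set m := mean s F.
have : 0 <= mean s (fun x => (F x - m) ^+ 2).
  by apply: mean_ge0 => x; exact: sqr_ge0.
have -> : mean s (fun x => (F x - m) ^+ 2) =
    mean s (fun x => F x ^+ 2) - (2 * m) * mean s F + mean s (fun=> m ^+ 2).
  by rewrite -meanZ -meanB -meanD; apply: eq_mean => x; ring.
rewrite mean_cst// -/m; lra.
Qed.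

(** This is how the few exceptional directions are discarded. *)
Lemma mean_le_except (X : eqType) (s : seq X) (F : X -> R) (P : pred X)
    (e c : R) :
  0 <= e -> 0 <= c -> (forall x, F x <= 1) ->
  (forall x, x \in s -> ~~ P x -> F x <= c) ->
  (count P s)%:R <= e * (size s)%:R -> mean s F <= e + c.
Proof.
move=> e0 c0 F1 Fc cP.
case: (posnP (size s)) => s0; first by rewrite /mean s0 invr0 mulr0 addr_ge0.
have s0' : 0 < (size s)%:R :> R by rewrite ltr0n.
have : mean s F <= mean s (fun x => (P x)%:R + c).
  apply: le_mean_in => x xs; case: (boolP (P x)) => Px.
    by apply: le_trans (F1 x) _; rewrite lerDl.
  by rewrite add0r; exact: Fc.
move=> /le_trans; apply; rewrite meanD mean_cst// lerD2r /mean.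
rewrite ler_pdivrMr//; apply: le_trans cP.
rewrite -sum1_count natr_sum [leRHS]big_mkcond/=.
by apply: ler_sum => x _; case: (P x).
Qed.

End Mean.
(** * Positive definite functions and energies *)

Section PositiveDefinite.
Variables (R : realType) (V : zmodType).
Implicit Types (A : V -> R) (s t : seq V).

Definition posdef A := forall l : seq (R * V),
  0 <= \sum_(p <- l) \sum_(q <- l) p.1 * q.1 * A (p.2 - q.2).

(** The functions [A] arising as normalised autocorrelations
    [u |-> <g, g(. + u)>] with [<g, g> <= 1]. *)
Definition autocorrelation A :=
  [/\ forall u, A (- u) = A u, posdef A & A 0 <= 1].

(** If [A u = <g, g(. + u)>], these are [<T_s g, T_t g>] and [<T_s g, T_s g>]
    for the operators [T_s], [T_t] averaging the translates by the entries of
    [s] and [t]. *)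
Definition cross A s t : R := mean s (fun x => mean t (fun y => A (x - y))).

Definition energy A s : R := cross A s s.

(** The composition of the averaging operators of [s] and [t] is that of
    [conv s t]. *)
Definition conv s t : seq V := [seq x + y | x <- s, y <- t].

Section Autocorrelation.
Variable A : V -> R.
Hypothesis hA : autocorrelation A.

Let Asym u : A (- u) = A u. Proof. by case: hA. Qed.
Let Apos : posdef A. Proof. by case: hA. Qed.
Let A0 : A 0 <= 1. Proof. by case: hA. Qed.

Lemma autocorrelation_norm_le1 u : `|A u| <= 1.
Proof.
have := A0; have := Apos [:: (1, u); (1, 0)]; have := Apos [:: (1, u); (- 1, 0)].
rewrite !big_cons !big_nil/= !subrr !subr0 sub0r Asym => h1 h2 h3.
by rewrite ler_norml; apply/andP; split; lra.
Qed.

Lemma crossC s t : cross A s t = cross A t s.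
Proof.
rewrite /cross exchange_mean; apply: eq_mean => y; apply: eq_mean => x.
by rewrite -Asym opprB.
Qed.

(** Positive definiteness tested on the signed sequence [a s - b t] says that
    [|a T_s g - b T_t g|^2] is nonnegative. *)
Lemma cross_young s t (a b : R) :
  2 * a * b * cross A s t <= a ^+ 2 * energy A s + b ^+ 2 * energy A t.
Proof.
pose l := [seq (a / (size s)%:R, x) | x <- s] ++
          [seq (- b / (size t)%:R, x) | x <- t].
have sumE (u v : seq V) (c e : R) :
    \sum_(p <- [seq (c / (size u)%:R, x) | x <- u])
      \sum_(q <- [seq (e / (size v)%:R, x) | x <- v])
        p.1 * q.1 * A (p.2 - q.2) = c * e * cross A u v.
  rewrite big_map /cross /mean mulr_suml mulr_sumr; apply: eq_bigr => x _.
  rewrite big_map /= !mulr_suml mulr_sumr; apply: eq_bigr => y _.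
  by rewrite -!mulrA; congr (_ * _); ring.
have := Apos l; rewrite /l big_cat/=.
under eq_bigr do rewrite big_cat/=.
under [X in _ <= _ + X]eq_bigr do rewrite big_cat/=.
rewrite !big_split/= !sumE (crossC t s) -/(energy A s) -/(energy A t).
lra.
Qed.

Lemma energy_ge0 s : 0 <= energy A s.
Proof. by have := cross_young s s 1 (- 1); rewrite -/(energy A s); lra. Qed.

Lemma energy_le1 s : energy A s <= 1.
Proof.
apply: mean_le_cst => // x; apply: mean_le_cst => // y.
by have := autocorrelation_norm_le1 (x - y); rewrite ler_norml => /andP[].
Qed.

Lemma cross_sqr_le s t : cross A s t ^+ 2 <= energy A s.
Proof.
have := cross_young s t 1 (cross A s t); have := energy_le1 t.
by have := sqr_ge0 (cross A s t); nra.
Qed.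

(** The form of Cauchy-Schwarz in which the energy enters linearly, so that it
    survives a further average over [s]. *)
Lemma cross_le_energy s t (k : R) : 0 < k -> cross A s t <= k + energy A s / k.
Proof.
move=> k0; have h := cross_sqr_le s t; set c := cross A s t in h *.
rewrite -subr_ge0 -(pmulr_rge0 _ k0).
have -> : k * (k + energy A s / k - c) = k ^+ 2 + energy A s - k * c.
  by field; rewrite gt_eqF.
by have := sqr_ge0 (k - c); have := sqr_ge0 (k + c); nra.
Qed.

(** The energy is a convex function of the averaging operator. *)
Lemma energy_family_le X Y (I : seq X) (J : seq Y) (f : X -> Y -> V) :
  energy A [seq f i j | i <- I, j <- J] <=
  mean I (fun i => energy A [seq f i j | j <- J]).
Proof.
rewrite /energy {1}/cross mean_allpairs.
under eq_mean do under eq_mean do rewrite mean_allpairs.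
under eq_mean do rewrite exchange_mean.
pose E i := energy A [seq f i j | j <- J].
apply: (@le_trans _ _ (mean I (fun i => mean I (fun i' =>
    2^-1 * (E i + E i'))))); last first.
  under eq_mean do rewrite meanZ meanD.
  rewrite meanZ meanD.
  case: (posnP (size I)) => I0; first by rewrite /mean I0 !invr0 !mulr0 addr0 mulr0.
  by under eq_mean do rewrite mean_cst//; rewrite mean_cst// -/E; lra.
apply: le_mean => i; apply: le_mean => i'.
have := cross_young [seq f i j | j <- J] [seq f i' j | j <- J] 1 1.
rewrite -/(E i) -/(E i') /cross mean_map /=.
under eq_mean do rewrite /= mean_map/=.
rewrite /= expr1n !mul1r mulr1 => ?; lra.
Qed.

(** Cauchy-Schwarz for the operator [U = mean_e (I e)^* (I e)]: the left side
    is [<U h, h>^2], the right side is [|U h|^2], for [h] the image of the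
    underlying function under the averaging operator of [nu]. *)
Lemma mean_energy_conv_sqr_le X Y (es : seq X) (J : seq Y) (f : X -> Y -> V)
    (nu : seq V) :
  mean es (fun e => energy A (conv nu [seq f e j | j <- J])) ^+ 2 <=
  mean es (fun e => mean es (fun e' => energy A
    (conv (conv nu [seq f e j | j <- J]) [seq f e' j | j <- J]))).
Proof.
pose mu := [seq z.1 + z.2 | z <- [seq (x, y) | x <- nu,
  y <- [seq f e j.1 - f e j.2 | e <- es, j <- [seq (i, j) | i <- J, j <- J]]]].
have meanmu F : mean mu F = mean es (fun e => mean nu (fun x =>
    mean J (fun i => mean J (fun i' => F (x + (f e i - f e i')))))).
  rewrite /mu mean_map mean_allpairs exchange_mean mean_allpairs.
  apply: eq_mean => e; rewrite mean_allpairs.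
  under eq_mean do rewrite exchange_mean.
  by rewrite exchange_mean.
have E1 : mean es (fun e => energy A (conv nu [seq f e j | j <- J])) =
    cross A mu nu.
  rewrite /cross meanmu; apply: eq_mean => e.
  rewrite /energy /cross /conv mean_allpairs; apply: eq_mean => x.
  rewrite mean_map; apply: eq_mean => i /=.
  rewrite mean_allpairs exchange_mean mean_map; apply: eq_mean => j /=.
  by apply: eq_mean => y; congr A; rewrite opprD !addrA addrAC.
have E2 : energy A mu = mean es (fun e => mean es (fun e' => energy A
    (conv (conv nu [seq f e j | j <- J]) [seq f e' j | j <- J]))).
  rewrite /energy /cross meanmu; apply: eq_mean => e.
  under eq_mean do under eq_mean do under eq_mean do rewrite meanmu.
  transitivity (mean es (fun e' => mean nu (fun x => mean J (fun i =>
    mean J (fun i' => mean nu (fun y => mean J (fun j => mean J (fun j' =>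
      A (x + (f e i - f e i') - (y + (f e' j - f e' j'))))))))))).
    rewrite [RHS]exchange_mean; apply: eq_mean => x.
    rewrite [RHS]exchange_mean; apply: eq_mean => i.
    by rewrite [RHS]exchange_mean; apply: eq_mean => i'.
  apply: eq_mean => e'.
  rewrite /conv !mean_allpairs; apply: eq_mean => x.
  rewrite mean_map; apply: eq_mean => i /=.
  rewrite mean_map exchange_mean.
  under [RHS]eq_mean do rewrite /= !mean_allpairs.
  rewrite [RHS]exchange_mean; apply: eq_mean => y.
  rewrite [RHS]exchange_mean mean_map; apply: eq_mean => i' /=.
  under [RHS]eq_mean do rewrite /= mean_map.
  rewrite [RHS]exchange_mean; apply: eq_mean => j; apply: eq_mean => j' /=.
  congr A; rewrite !opprD opprK !addrA [LHS]addrAC; congr (_ - _).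
  by rewrite [LHS]addrAC [X in X - _ = _]addrAC [LHS]addrAC.
by rewrite E1 -E2; exact: cross_sqr_le.
Qed.

End Autocorrelation.
End PositiveDefinite.

(** * Euclidean geometry of row vectors *)

Section Euclidean.
Variables (R : realType) (d : nat).
Implicit Types u v w x y : 'rV[R]_d.

Definition dot u v : R := \sum_(i < d) u 0 i * v 0 i.

Lemma dotC u v : dot u v = dot v u.
Proof. by apply: eq_bigr => i _; rewrite mulrC. Qed.

Lemma dotDl u v w : dot (u + v) w = dot u w + dot v w.
Proof. by rewrite -big_split/=; apply: eq_bigr => i _; rewrite mxE mulrDl. Qed.

Lemma dotZl (k : R) u v : dot (k *: u) v = k * dot u v.
Proof. by rewrite mulr_sumr; apply: eq_bigr => i _; rewrite mxE mulrA. Qed.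

Lemma dotNl u v : dot (- u) v = - dot u v.
Proof. by rewrite -scaleN1r dotZl mulN1r. Qed.

Lemma dotDr u v w : dot u (v + w) = dot u v + dot u w.
Proof. by rewrite dotC dotDl !(dotC u). Qed.

Lemma dotZr (k : R) u v : dot u (k *: v) = k * dot u v.
Proof. by rewrite dotC dotZl dotC. Qed.

Lemma dot_ge0 u : 0 <= dot u u.
Proof. by apply: sumr_ge0 => i _; rewrite -expr2 sqr_ge0. Qed.

Lemma dot_eq0 u : dot u u = 0 -> u = 0.
Proof.
move=> /eqP; rewrite psumr_eq0; last by move=> i _; rewrite -expr2 sqr_ge0.
move=> /allP u0; apply/rowP => i; rewrite mxE; apply/eqP.
by have /(_ (mem_index_enum i)) := u0 i; rewrite -expr2 sqrf_eq0.
Qed.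

Lemma mulmx_tr_dot u v : u *m v^T = (dot u v)%:M.
Proof.
by apply/rowP => i; rewrite !mxE ord1 mulr1n; apply: eq_bigr => j _; rewrite mxE.
Qed.

Lemma enormE u : enorm u = Num.sqrt (dot u u).
Proof. by rewrite /enorm; congr Num.sqrt; apply: eq_bigr. Qed.

Lemma enorm_ge0 u : 0 <= enorm u. Proof. exact: sqrtr_ge0. Qed.

Lemma sqr_enorm u : enorm u ^+ 2 = dot u u.
Proof. by rewrite enormE sqr_sqrtr// dot_ge0. Qed.

Lemma enorm0 : enorm (0 : 'rV[R]_d) = 0.
Proof.
by rewrite /enorm big1 ?sqrtr0// => i _; rewrite mxE expr0n.
Qed.

Lemma enorm_eq0 u : enorm u = 0 -> u = 0.
Proof. by move=> u0; apply: dot_eq0; rewrite -sqr_enorm u0 expr0n. Qed.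

Lemma enormZ (k : R) u : enorm (k *: u) = `|k| * enorm u.
Proof.
rewrite !enormE dotZl dotZr mulrA -expr2 sqrtrM ?sqr_ge0//.
by rewrite sqrtr_sqr.
Qed.

Lemma enormN u : enorm (- u) = enorm u.
Proof. by rewrite -scaleN1r enormZ normrN1 mul1r. Qed.

Lemma dot_le_enorm u v : `|dot u v| <= enorm u * enorm v.
Proof.
rewrite -(@ler_pXn2r _ 2)// ?nnegrE ?mulr_ge0 ?enorm_ge0//.
rewrite exprMn !sqr_enorm real_normK ?num_real//.
have [v0|vn0] := eqVneq (dot v v) 0.
  by rewrite (dot_eq0 v0) -(scale0r u) !dotZr !mul0r mulr0 expr0n.
have vp : 0 < dot v v by rewrite lt_neqAle eq_sym vn0 dot_ge0.
have := dot_ge0 (dot v v *: u + (- dot u v) *: v).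
rewrite !(dotDl, dotDr, dotZl, dotZr) (dotC v u) => h.
rewrite -subr_ge0 -(pmulr_rge0 _ vp); move: h; congr (_ <= _); ring.
Qed.

Lemma enormD u v : enorm (u + v) <= enorm u + enorm v.
Proof.
rewrite -(@ler_pXn2r _ 2)// ?nnegrE ?addr_ge0 ?enorm_ge0//.
rewrite sqr_enorm !(dotDl, dotDr) sqrrD !sqr_enorm (dotC v u).
have := ler_norm (dot u v); have := dot_le_enorm u v; lra.
Qed.

Lemma enorm_coord u i : `|u 0 i| <= enorm u.
Proof.
rewrite -sqrtr_sqr; apply: ler_wsqrtr.
by rewrite (bigD1 i)//= lerDl sumr_ge0// => j _; exact: sqr_ge0.
Qed.

Lemma enorm_le_sum u : enorm u <= \sum_i `|u 0 i|.
Proof.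
rewrite -(@ler_pXn2r _ 2)// ?nnegrE ?enorm_ge0 ?sumr_ge0//.
rewrite sqr_enorm expr2 mulr_suml ler_sum// => i _.
rewrite -expr2 -real_normK ?num_real// expr2 ler_wpM2l//.
by rewrite (bigD1 i)//= lerDl sumr_ge0.
Qed.

(** Fewer than [d] vectors leave room for a common unit normal. *)
Lemma unit_normal_exists (l : seq 'rV[R]_d) : (size l < d)%N ->
  exists2 xi, enorm xi = 1 & forall x, x \in l -> dot x xi = 0.
Proof.
move=> ld.
pose M := \matrix_(i < d, j < size l) (nth 0 l j) 0 i.
have : kermx M != 0.
  rewrite -mxrank_eq0 mxrank_ker subn_eq0 -ltnNge.
  by apply: leq_ltn_trans ld; exact: rank_leq_col.
move=> /rowV0Pn[v /sub_kermxP vM v0].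
have ev0 : enorm v != 0 by apply: contra_neq v0; exact: enorm_eq0.
exists ((enorm v)^-1 *: v).
  by rewrite enormZ gtr0_norm ?mulVf// invr_gt0 lt_neqAle eq_sym ev0 enorm_ge0.
move=> x xl; rewrite dotZr.
suff -> : dot x v = 0 by rewrite mulr0.
have := congr1 (fun N : 'rV_(size l) => N 0 (Ordinal (etrans (index_mem x l) xl))) vM.
rewrite !mxE /= => <-; apply: eq_bigr => i _.
by rewrite mxE nth_index// mulrC.
Qed.

End Euclidean.

(** * Approximate periods of averaging operators *)

Section Periods.
Variables (R : realType) (d : nat).
Variables (rho om : R).
Implicit Types (u v w x y e : 'rV[R]_d) (nu : seq 'rV[R]_d).

(** Modulus of continuity at a single scale. The bounds are uniform because
    approximate periods below have to hold for all translates of a function at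
    once. *)
Definition tame (F : 'rV[R]_d -> R) :=
  (forall x, `|F x| <= 1) /\
  (forall x y, enorm y <= rho -> `|F (x + y) - F x| <= om).

Lemma tame_translate F x : tame F -> tame (fun z => F (z + x)).
Proof.
move=> [F1 Fo]; split=> [z|z y yr]; first exact: F1.
by rewrite addrAC; exact: Fo.
Qed.

(** The averaging operators of [nu] and of its translate by [y] are within
    [tau] of each other on tame functions. *)
Definition period nu y (tau : R) := forall F, tame F ->
  `|mean nu F - mean nu (fun x => F (x + y))| <= tau.

Lemma period0 nu : period nu 0 0.
Proof. by move=> F _; under [X in _ - X]eq_mean do rewrite addr0; rewrite subrr normr0. Qed.

Lemma periodD nu y y' tau tau' : period nu y tau -> period nu y' tau' ->
  period nu (y + y') (tau + tau').
Proof.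
move=> p p' F tF.
rewrite -[X in `|X|](subrKA (mean nu (fun x => F (x + y)))).
apply: le_trans (ler_normD _ _) _; apply: lerD; first exact: p.
under [X in `|_ - X|]eq_mean do rewrite (addrC y) addrA.
exact: (p' (fun z => F (z + y)) (tame_translate _ tF)).
Qed.

Lemma periodN nu y tau : period nu y tau -> period nu (- y) tau.
Proof.
move=> p F tF; have := p _ (tame_translate (- y) tF).
by rewrite distrC; under [X in `|X - _|]eq_mean do rewrite addrK.
Qed.

Lemma period_le nu y tau tau' : tau <= tau' -> period nu y tau -> period nu y tau'.
Proof. by move=> tt p F tF; exact: le_trans (p F tF) tt. Qed.

Lemma period_small nu y : 0 <= om -> enorm y <= rho -> period nu y om.
Proof.
move=> om0 yr F tF; rewrite distrC -meanB; apply: mean_abs_le => // x.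
exact: tF.2.
Qed.

Lemma period_conv_l nu mu y tau : 0 <= tau -> period nu y tau ->
  period (conv nu mu) y tau.
Proof.
move=> tau0 p F tF; rewrite /conv !mean_allpairs exchange_mean.
rewrite [X in _ - X]exchange_mean -meanB; apply: mean_abs_le => // z.
under [X in _ - X]eq_mean do rewrite addrAC.
exact: p (tame_translate _ tF).
Qed.

Lemma period_conv_r nu mu y tau : 0 <= tau -> period mu y tau ->
  period (conv nu mu) y tau.
Proof.
move=> tau0 p F tF; rewrite /conv !mean_allpairs.
rewrite -meanB; apply: mean_abs_le => // z.
under eq_mean do rewrite addrC.
under [X in _ - X]eq_mean do rewrite (addrC z) addrAC.
exact: p (tame_translate _ tF).
Qed.

(** [H] points with spacing [eta *: e] on a segment. *)
Definition segment (H : nat) (eta : R) e : seq 'rV[R]_d :=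
  [seq (eta * i%:R) *: e | i <- iota 0 H].

(** All but [m] terms at either end cancel. *)
Lemma period_segment_nat H eta e (m : nat) :
  period (segment H eta e) ((eta * m%:R) *: e) (2 * m%:R / H%:R).
Proof.
move=> F [F1 _].
rewrite /segment !mean_map /mean size_iota -mulrBl normrM normfV normr_nat.
rewrite ler_wpM2r ?invr_ge0//=.
pose G i := F ((eta * i%:R) *: e).
have -> : \sum_(i <- iota 0 H) F ((eta * i%:R) *: e + (eta * m%:R) *: e) =
    \sum_(i <- iota 0 H) G (i + m)%N.
  by apply: eq_bigr => i _; rewrite /G natrD mulrDr scalerDl.
elim: m => [|m IH].
  rewrite mulr0; under [X in _ - X]eq_bigr do rewrite addn0.
  by rewrite subrr normr0.
rewrite -(subrKA (\sum_(i <- iota 0 H) G (i + m)%N)).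
apply: le_trans (ler_normD _ _) _.
rewrite -(natr1 m) mulrDr mulr1 lerD// -sumrB.
have -> : iota 0 H = index_iota 0 H by rewrite /index_iota subn0.
have -> : \sum_(0 <= i < H) (G (i + m)%N - G (i + m.+1)%N) = G m - G (H + m)%N.
  elim: H {IH} => [|H IH]; first by rewrite big_nil add0n subrr.
  by rewrite big_nat_recr//= IH subrKA addnS addSn.
by apply: le_trans (ler_normB _ _) _; apply: le_trans (lerD (F1 _) (F1 _)) _; lra.
Qed.

(** A multiple of the spacing moves the two ends of the segment only; the
    remainder is shorter than the spacing, and tameness takes care of it. *)
Lemma period_segment H eta e (t : R) : 0 <= om -> 0 < eta -> eta * enorm e <= rho ->
  period (segment H eta e) (t *: e) (2 * `|t| / (H%:R * eta) + om).
Proof.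
move=> om0 eta0 etae.
wlog t0 : t / 0 <= t => [hw|].
  have [t0|/ltW t0] := leP 0 t; first exact: hw.
  by rewrite -(opprK t) scaleNr normrN; apply: periodN; apply: hw; rewrite oppr_ge0.
rewrite ger0_norm//.
pose m := Num.truncn (t / eta).
have /andP[mt tm] : m%:R <= t / eta < m.+1%:R.
  by rewrite /m; apply: truncn_itv; rewrite divr_ge0// ltW.
have -> : t *: e = (eta * m%:R) *: e + (t - eta * m%:R) *: e.
  by rewrite -scalerDl addrC subrK.
apply: periodD.
  apply: period_le (period_segment_nat _ _ _ _).
  rewrite -!mulrA ler_wpM2l// invfM [leRHS]mulrCA mulrC ler_wpM2l ?invr_ge0//.
apply: period_small => //; rewrite enormZ; apply: le_trans etae.
rewrite ler_wpM2r ?enorm_ge0// ger0_norm.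
  by move: tm; rewrite ltr_pdivrMr// -natr1; lra.
by rewrite subr_ge0 mulrC -ler_pdivlMr.
Qed.

End Periods.

(** * Coordinates in a spread basis *)

Section Spread.
Variables (R : realType) (d : nat).
Implicit Types (u v x y e : 'rV[R]_d) (l : seq ('rV[R]_d * 'rV[R]_d)).

(** The first components, from last to first, are vectors each of which is at
    distance at least [c0] from the span of its predecessors; the second
    component is a unit normal to that span certifying it. *)
Fixpoint spread (c0 : R) l : Prop :=
  if l is p :: l' then
    [/\ enorm p.2 = 1, c0 <= `|dot p.1 p.2|,
        forall q, q \in l' -> dot q.1 p.2 = 0 & spread c0 l']
  else True.

Lemma spread_nth c0 l i : spread c0 l -> (i < size l)%N ->
  let p := nth (0, 0) l i in
  [/\ enorm p.2 = 1, c0 <= `|dot p.1 p.2| & forall j, (i < j < size l)%N ->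
      dot (nth (0, 0) l j).1 p.2 = 0].
Proof.
elim: l i => [//|p l IH] [|i] /= [n1 n2 n3 n4] il.
  by split=> // -[|j]//= jl; apply: n3; rewrite mem_nth.
by have [m1 m2 m3] := IH i n4 il; split=> // -[|j]//= jl; exact: m3.
Qed.

(** Leibniz' formula has [n`!] terms. *)
Lemma norm_det_le n (M : 'M[R]_n) (B : R) : (forall i j, `|M i j| <= B) ->
  `|\det M| <= (n`!)%:R * B ^+ n.
Proof.
move=> MB; apply: le_trans (ler_norm_sum _ _ _) _.
have -> : (n`!)%:R * B ^+ n = \sum_(s : 'S_n) B ^+ n.
  by rewrite sumr_const mulr_natl card_Sn.
apply: ler_sum => s _; rewrite normrM normrX normrN1 expr1n mul1r normr_prod.
rewrite -[in leRHS](card_ord n) -prodr_const.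
by apply: ler_prod => i _; rewrite normr_ge0 MB.
Qed.

(** The Gram-type matrix of the two components is triangular with diagonal
    entries at least [c0] in absolute value; Cramer's rule bounds its
    inverse. *)
Lemma spread_coordinates (c0 D : R) : 0 < c0 -> 1 <= D ->
  exists2 C : R, 0 <= C & forall l, spread c0 l -> size l = d ->
    (forall p, p \in l -> enorm p.1 <= D) ->
    forall y, exists2 c : nat -> R,
      y = \sum_(i < d) c i *: (nth (0, 0) l i).1 &
      forall i, `|c i| <= C * enorm y.
Proof.
move=> c00 D1.
have D0 : 0 <= D by apply: le_trans D1.
exists (d%:R * ((c0 ^+ d)^-1 * ((d.-1`!)%:R * D ^+ d.-1))).
  by rewrite !mulr_ge0// ?invr_ge0 ?exprn_ge0// ltW.
move=> l sl ld lD y.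
pose E : 'M[R]_d := \matrix_(i, j) (nth (0, 0) l i).1 0 j.
pose X : 'M[R]_d := \matrix_(i, j) (nth (0, 0) l i).2 0 j.
pose M := X *m E^T.
have ME i j : M i j = dot (nth (0, 0) l j).1 (nth (0, 0) l i).2.
  by rewrite !mxE; apply: eq_bigr => k _; rewrite !mxE mulrC.
have il (i : 'I_d) : (i < size l)%N by rewrite ld.
have Mle i j : `|M i j| <= D.
  rewrite ME; apply: le_trans (dot_le_enorm _ _) _.
  have [-> _ _] := spread_nth sl (il i).
  by rewrite mulr1 lD// mem_nth.
have Mtrig : is_trig_mx M.
  apply/is_trig_mxP => i j ij; rewrite ME.
  by have [_ _ ->//] := spread_nth sl (il i); rewrite ij il.
have detM : c0 ^+ d <= `|\det M|.
  rewrite det_trig// normr_prod -[in leLHS](card_ord d) -prodr_const.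
  apply: ler_prod => i _; rewrite ltW//= ME.
  by have [] := spread_nth sl (il i).
have detM0 : \det M != 0.
  by rewrite -normr_gt0; apply: lt_le_trans detM; exact: exprn_gt0.
have Mu : M \in unitmx by rewrite unitmxE unitfE.
have Xu : X \in unitmx.
  by rewrite unitmxE unitfE; apply: contraNneq detM0; rewrite det_mulmx => ->; rewrite mul0r.
pose c := y *m X^T *m (invmx M)^T.
have cE : c *m E = y.
  have MT : M^T = E *m X^T by rewrite trmx_mul trmxK.
  have XTu : X^T \in unitmx by rewrite unitmx_tr.
  apply: (can_inj (mulmxK XTu)).
  by rewrite -mulmxA -MT /c -(mulmxA (y *m X^T)) -trmx_mul mulmxV// trmx1 mulmx1.
exists (fun i => if insub i is Some k then c 0 k else 0).
  apply/rowP => j; rewrite -cE mxE summxE; apply: eq_bigr => i _.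
  by rewrite valK !mxE.
move=> i; case: insubP => [k _ _|_]; last first.
  rewrite normr0 mulr_ge0 ?enorm_ge0// !mulr_ge0// ?invr_ge0 ?exprn_ge0//.
  exact: ltW.
rewrite mxE; apply: le_trans (ler_norm_sum _ _ _) _.
have -> : d%:R * ((c0 ^+ d)^-1 * ((d.-1`!)%:R * D ^+ d.-1)) * enorm y =
    \sum_(j < d) enorm y * ((c0 ^+ d)^-1 * ((d.-1`!)%:R * D ^+ d.-1)).
  by rewrite sumr_const card_ord -[RHS]mulr_natl; ring.
apply: ler_sum => j _; rewrite normrM ler_pM//.
  have -> : (y *m X^T) 0 j = dot y (nth (0, 0) l j).2.
    by rewrite mxE; apply: eq_bigr => m _; rewrite !mxE.
  apply: le_trans (dot_le_enorm _ _) _.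
  by have [-> _ _] := spread_nth sl (il j); rewrite mulr1.
rewrite mxE /invmx Mu !mxE normrM ler_pM//.
  by rewrite normfV lef_pV2// posrE ?normr_gt0// exprn_gt0.
rewrite normrM normrX normrN1 expr1n mul1r.
by apply: norm_det_le => a b; rewrite [row' _ _ _ _]mxE [col' _ _ _ _]mxE.
Qed.

End Spread.

(** * Energies of segments in generic directions *)

Section Segments.
Variables (R : realType) (d : nat) (A : 'rV[R]_d -> R).
Hypothesis hA : autocorrelation A.
Variables (rho om eta D : R) (H : nat) (es : seq 'rV[R]_d).
Hypotheses (om0 : 0 <= om) (eta0 : 0 < eta).
Hypothesis Atame : tame rho om A.
Hypotheses (esD : forall e, e \in es -> enorm e <= D) (etaD : eta * D <= rho).
Implicit Types (e x y : 'rV[R]_d) (l : seq ('rV[R]_d * 'rV[R]_d)).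
Local Notation seg := (segment H eta).

(** The mean energy over all ways of composing [nu] with [k] segment averages
    in directions from [es]. *)
Fixpoint segments_energy k nu : R :=
  if k is k'.+1 then mean es (fun e => segments_energy k' (conv nu (seg e)))
  else energy A nu.

Lemma segments_energy_ge0 k nu : 0 <= segments_energy k nu.
Proof.
elim: k nu => [|k IH] nu /=; first exact: energy_ge0.
by apply: mean_ge0.
Qed.

Lemma segments_energy_le1 k nu : segments_energy k nu <= 1.
Proof.
elim: k nu => [|k IH] nu /=; first exact: energy_le1.
by apply: mean_le_cst.
Qed.

(** Cauchy-Schwarz in the innermost direction, Jensen's inequality in the
    others. *)
Lemma segments_energy_sqr_le k nu :
  segments_energy k.+1 nu ^+ 2 <= segments_energy k.+2 nu.
Proof.
elim: k nu => [|k IH] nu.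
  exact: (mean_energy_conv_sqr_le hA es (iota 0 H) (fun e i => (eta * i%:R) *: e)).
rewrite {1}/segments_energy -/segments_energy.
apply: le_trans (mean_sqr_le _ _) _.
by apply: le_mean => e; exact: IH.
Qed.

Lemma segments_energy_exp_le k nu :
  segments_energy 1 nu ^+ (2 ^ k) <= segments_energy k.+1 nu.
Proof.
elim: k => [|k IH]; first by rewrite expn0 expr1.
rewrite expnSr exprM; apply: le_trans (segments_energy_sqr_le _ _).
rewrite ler_pXn2r// ?nnegrE ?exprn_ge0//; exact: segments_energy_ge0.
Qed.

(** The averages over the segments in the directions of [l] compose to the
    average over the parallelepiped that they span. *)
Definition compose l := foldr (fun p nu => conv nu (seg p.1)) [:: 0] l.

Lemma period_compose l (c : nat -> R) (T : R) : 0 <= T ->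
  (forall p, p \in l -> enorm p.1 <= D) -> (forall i, `|c i| <= T) ->
  period rho om (compose l) (\sum_(i < size l) c i *: (nth (0, 0) l i).1)
    ((size l)%:R * (2 * T / (H%:R * eta) + om)).
Proof.
move=> T0; elim: l c => [|p l IH] c lD cT /=.
  by rewrite big_ord0 mul0r; exact: period0.
rewrite big_ord_recl/= mulrS mulrDl mul1r.
have t0 : 0 <= 2 * T / (H%:R * eta) + om.
  by rewrite addr_ge0// divr_ge0 ?mulr_ge0// ltW.
apply: periodD.
  apply: period_conv_r => //.
  apply: period_le (period_segment _ _ om0 eta0 _); last first.
    by apply: le_trans etaD; apply: ler_wpM2l; [exact: ltW|exact/lD/mem_head].
  rewrite lerD2r ler_wpM2r ?ler_wpM2l// invr_ge0 mulr_ge0//; exact: ltW.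
apply: period_conv_l; first by rewrite mulr_ge0.
by apply: (IH (c \o succn)) => [q ql|i]; [apply: lD; rewrite in_cons ql orbT|exact: cT].
Qed.

Variables (c0 C R0 eps : R) (Y : seq 'rV[R]_d).
Hypotheses (c00 : 0 < c0) (C0 : 0 <= C) (R00 : 0 <= R0) (eps0 : 0 <= eps).
Hypothesis coordinatesP : forall l, spread c0 l -> size l = d ->
  (forall p, p \in l -> enorm p.1 <= D) ->
  forall y, exists2 c : nat -> R,
    y = \sum_(i < d) c i *: (nth (0, 0) l i).1 &
    forall i, `|c i| <= C * enorm y.
Hypotheses (Y0 : (0 < size Y)%N) (YR : forall y, y \in Y -> enorm y <= R0).

Let tau := d%:R * (2 * (C * R0) / (H%:R * eta) + om).

Let tau0 : 0 <= tau.
Proof.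
by rewrite mulr_ge0// addr_ge0// divr_ge0 ?mulr_ge0// ltW.
Qed.

(** Every translation by an entry of [Y] is an approximate period of a spread
    composition, so composing with the averaging operator of [Y] changes
    little. *)
Lemma energy_spread_le l (k : R) : 0 < k -> spread c0 l -> size l = d ->
  (forall p, p \in l -> enorm p.1 <= D) ->
  energy A (compose l) <= k + energy A Y / k + tau.
Proof.
move=> k0 sl ld lD.
have k0' := ltW k0; have E0 := energy_ge0 hA Y.
have b0 : 0 <= k + energy A Y / k + tau.
  by rewrite addr_ge0// addr_ge0// divr_ge0.
rewrite /energy /cross exchange_mean; apply: mean_le_cst => // z.
set F := fun x => A (x - z).
have tF : tame rho om F by exact: tame_translate.
have Fper y : y \in Y -> mean (compose l) F <=
    mean (compose l) (fun x => F (x + y)) + tau.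
  move=> yY; have [c yE cC] := coordinatesP sl ld lD y.
  have cT i : `|c i| <= C * R0.
    by apply: le_trans (cC i) _; rewrite ler_wpM2l// YR.
  have := @period_compose l c (C * R0) (mulr_ge0 C0 R00) lD cT F tF.
  rewrite ld -yE -/tau => h.
  by rewrite -lerBlDl; apply: le_trans h; exact: ler_norm.
rewrite -[leLHS](mean_cst _ Y0); apply: le_trans (le_mean_in Fper) _.
rewrite meanD mean_cst// lerD2r exchange_mean; apply: mean_le_cst => [|x].
  by rewrite addr_ge0// divr_ge0.
have := cross_le_energy hA Y [:: z - x] k0; rewrite /cross => h.
apply: le_trans h; rewrite le_eqVlt; apply/orP; left; apply/eqP.
apply: eq_mean => y; rewrite /mean big_seq1 divr1 /F; congr A.
by rewrite opprB addrCA addrA.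
Qed.

Hypothesis es_generic : forall xi, enorm xi = 1 ->
  (count (fun e => `|dot e xi| < c0) es)%:R <= eps * (size es)%:R.

(** The segments are chosen one at a time: given a spread tuple of fewer than
    [d] directions, a unit normal [xi] to all of them exists, and all but a
    proportion [eps] of the directions in [es] have a component of size [c0]
    along [xi], hence extend the tuple. *)
Lemma segments_energy_spread_le n l (k : R) : 0 < k -> spread c0 l ->
  (n + size l)%N = d -> (forall p, p \in l -> enorm p.1 <= D) ->
  segments_energy n (compose l) <= n%:R * eps + (k + energy A Y / k + tau).
Proof.
move=> k0.
have k0' := ltW k0; have E0 := energy_ge0 hA Y.
have b0 : 0 <= k + energy A Y / k + tau.
  by rewrite addr_ge0// addr_ge0// divr_ge0.
elim: n l => [|n IH] l sl ld lD.
  by rewrite mul0r add0r; exact: energy_spread_le.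
have [|xi xi1 xil] := @unit_normal_exists R d [seq p.1 | p <- l].
  by rewrite size_map; apply: leq_trans (eq_leq ld); rewrite addSn ltnS leq_addl.
rewrite mulrS mulrDl mul1r -addrA /=.
apply: (mean_le_except (P := fun e => `|dot e xi| < c0)) => //.
- by rewrite addr_ge0// mulr_ge0.
- by move=> e; exact: segments_energy_le1.
- move=> e ees; rewrite -leNgt => dc.
  apply: (IH ((e, xi) :: l)) => /=.
  + by split=> // q ql; apply: xil; exact: map_f.
  + by rewrite addnS -addSn.
  + by move=> p; rewrite in_cons => /orP[/eqP ->|/lD]//=; exact: esD.
- exact: es_generic.
Qed.

(** Most [d]-tuples of directions are spread; powers of the mean over single
    directions are controlled by means over tuples. *)
Theorem mean_segment_energy_exp_le (k : R) : 0 < k -> (0 < d)%N ->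
  mean es (fun e => energy A (seg e)) ^+ (2 ^ d.-1) <=
  d%:R * eps + (k + energy A Y / k + tau).
Proof.
move=> k0 d0.
have := @segments_energy_spread_le d [::] k k0 I (addn0 d) (fun _ => ltac:(by [])).
apply: le_trans.
rewrite -(congr1 (fun m => segments_energy m (compose [::])) (prednK d0)).
suff -> : mean es (fun e => energy A (seg e)) = segments_energy 1 (compose [::]).
  exact: segments_energy_exp_le.
apply: eq_mean => e; congr (energy A _); rewrite /conv/= cats0 map_id_in// => x _.
by rewrite add0r.
Qed.

End Segments.

(** * Sums over sine-distributed points *)

Section SineSums.
Variable R : realType.
Implicit Types (a G : R -> R) (x y t r : R).

Lemma mean_value (f df : R -> R) x y : x <= y ->
  (forall z, x <= z <= y -> is_derive z 1 f (df z)) ->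
  exists2 c, x <= c <= y & f y - f x = df c * (y - x).
Proof.
move=> xy fd.
have oo z : z \in `]x, y[%R -> is_derive z 1 f (df z).
  by rewrite in_itv/= => /andP[/ltW xz /ltW zy]; apply: fd; rewrite xz.
have cf : {within `[x, y], continuous f}.
  apply: derivable_within_continuous => z; rewrite in_itv/= => zxy.
  by have := fd z zxy => ?; exact: ex_derive.
have [c] := MVT_segment xy oo cf.
by rewrite in_itv/=; exists c.
Qed.

Lemma sin_lipschitz x y : `|sin x - sin y| <= `|x - y|.
Proof.
wlog xy : x y / y <= x => [hw|].
  have [yx|/ltW xy] := leP y x; first exact: hw.
  by rewrite distrC (distrC x); exact: hw.
have [c _ ->] := mean_value xy (fun z _ => is_derive_sin z).
by rewrite normrM ler_piMl// cos_max.
Qed.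

Lemma cos_lipschitz x y : `|cos x - cos y| <= `|x - y|.
Proof.
wlog xy : x y / y <= x => [hw|].
  have [yx|/ltW xy] := leP y x; first exact: hw.
  by rewrite distrC (distrC x); exact: hw.
have [c _ ->] := mean_value xy (fun z _ => is_derive_cos z).
by rewrite normrM ler_piMl// normrN sin_max.
Qed.

Lemma cos_ge_half x : `|x| <= 1 -> 1 / 2 <= cos x.
Proof.
move=> x1; have -> : x = (x / 2) *+ 2 by rewrite mulr2n; field.
rewrite cos_mulr2n cos2sin2.
have : sin (x / 2) ^+ 2 <= (1 / 2) ^+ 2.
  rewrite -real_normK ?num_real// lerXn2r// ?nnegrE//.
  have := sin_lipschitz (x / 2) 0; rewrite sin0 !subr0 normrM (@ger0_norm _ 2^-1)//; lra.
by rewrite -mulr_natr expr_div_n expr1n; lra.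
Qed.

Lemma sin_ge_half x : 0 <= x <= 1 -> x / 2 <= sin x.
Proof.
move=> /andP[x0 x1].
have [c /andP[c0 cx]] := mean_value x0 (fun z _ => is_derive_sin z).
rewrite sin0 !subr0 => ->; rewrite mulrC ler_wpM2r//.
have := @cos_ge_half c; rewrite ger0_norm//; lra.
Qed.

(** Summation by parts. *)
Lemma abel_sum_le (u h : nat -> R) n (B U W : R) : 0 <= B ->
  (forall l, (l <= n)%N -> `|h l| <= B) ->
  (forall l, (l <= n)%N -> `|u l| <= U) ->
  (forall l, (l < n)%N -> `|u l.+1 - u l| <= W) ->
  `|\sum_(0 <= l < n) u l * (h l - h l.+1)| <= 2 * (B * U) + n%:R * (B * W).
Proof.
move=> B0 hB uU uW.
have -> : \sum_(0 <= l < n) u l * (h l - h l.+1) = u 0%N * h 0%N - u n * h n +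
    \sum_(0 <= l < n) (u l.+1 - u l) * h l.+1.
  elim: n {hB uU uW} => [|n IH]; first by rewrite !big_nil subrr addr0.
  by rewrite !big_nat_recr//= IH; ring.
have pB c k : `|c| <= k -> forall l, (l <= n)%N -> `|c * h l| <= B * k.
  by move=> ck l ln; rewrite normrM mulrC ler_pM// hB.
apply: le_trans (ler_normD _ _) _; apply: lerD.
  apply: le_trans (ler_normB _ _) _; rewrite mulrDl mul1r.
  by apply: lerD; apply: pB => //; exact: uU.
apply: le_trans (ler_norm_sum _ _ _) _.
have -> : n%:R * (B * W) = \sum_(0 <= l < n) (B * W).
  by rewrite sumr_const_nat subn0 mulr_natl.
rewrite big_nat [leRHS]big_nat; apply: ler_sum => l /andP[_ ln].
exact: pB (uW l ln) _ ln.
Qed.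

Lemma primitive_exists a (c : R) : continuous a ->
  exists G, forall x, `|x| < c -> is_derive x 1 G (a x).
Proof.
move=> ca.
pose G (x : R) := (\int[lebesgue_measure]_(t in `[(- c)%R, x]) a t)%R.
exists G => x; rewrite ltr_norml => /andP[cx xc].
have [] := @continuous_FTC1 R a (BLeft (- c)) x c xc.
- apply: continuous_compact_integrable; first exact: segment_compact.
  exact: continuous_subspaceT.
- by rewrite lte_fin.
- exact: ca.
by move=> dG Ga; split; [exact: dG|rewrite -derive1E; exact: Ga].
Qed.

(** The abscissae [2 r sin p_l] are so smoothly distributed that shifting all
    of them by [t] changes the sum of [a] over them by [O(|t| N / r)], whatever
    [a] is: up to [om], each term [a (x_l + t) - a x_l] is a difference
    quotient of [H x = int_x^(x+t) a], which is bounded by [|t|], and the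
    factors [1 / (x_l - x_(l+1))] have bounded variation, so that summation by
    parts applies. *)
Lemma sine_sum_shift a (r t om p0 : R) (N n : nat) :
  continuous a -> (forall x, `|a x| <= 1) -> 0 < r -> (0 < N)%N -> (n <= N)%N ->
  (forall l, (l <= n.+1)%N -> `|p0 - l%:R / N%:R| <= 1) ->
  (forall x y, `|x - y| <= 2 * r / N%:R -> `|a x - a y| <= om) ->
  `|\sum_(0 <= l < n) (a (2 * r * sin (p0 - l%:R / N%:R) + t) -
                       a (2 * r * sin (p0 - l%:R / N%:R)))| <=
  8 * `|t| * N%:R / r + 2 * N%:R * om.
Proof.
move=> ca a1 r0 N0 nN p1 aom.
have N0' : 0 < N%:R :> R by rewrite ltr0n.
pose p l := p0 - l%:R / N%:R; pose x l := 2 * r * sin (p l).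
have pS l : p l.+1 = p l - 1 / N%:R by rewrite /p -natr1; field; rewrite gt_eqF.
have [G dG] := primitive_exists (2 * r + `|t| + 1) ca.
pose h (y : R) := G (y + t) - G y.
have Gt y : `|y| <= 2 * r -> `|h y| <= `|t|.
  move=> yr; rewrite /h.
  have mv u v : u <= v -> (forall z, u <= z <= v -> `|z| < 2 * r + `|t| + 1) ->
      `|G v - G u| <= `|v - u|.
    move=> uv uvG.
    have [z _ ->] := mean_value uv (fun z zuv => dG z (uvG z zuv)).
    by rewrite normrM ler_piMl.
  have [t0|/ltW t0] := leP 0 t.
    have := mv y (y + t); rewrite lerDl (_ : y + t - y = t); last by ring.
    apply => // z.
    by move: yr; rewrite (ger0_norm t0) !ler_norml ltr_norml; lra.
  have := mv (y + t) y; rewrite gerDl (_ : y - (y + t) = - t); last by ring.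
  rewrite normrN distrC; apply => // z.
  by move: yr; rewrite (ler0_norm t0) !ler_norml ltr_norml; lra.
pose s := sin (1 / (2 * N%:R)) : R.
have N1 : 1 / N%:R <= 1 :> R by rewrite ler_pdivrMr// mul1r ler1n.
have NV0 : 0 < 1 / N%:R :> R by rewrite divr_gt0.
have eN : 1 / (2 * N%:R) = (1 / N%:R) / 2 :> R by field; rewrite gt_eqF.
have s0 : 1 / N%:R / 4 <= s.
  have := @sin_ge_half (1 / N%:R / 2); rewrite /s eN; lra.
have sp : 0 < s by lra.
pose m l := p l - 1 / (2 * N%:R).
have m1 l : (l <= n)%N -> 1 / 2 <= cos (m l).
  move=> ln; apply: cos_ge_half; have := p1 _ (leqW ln); have := p1 l.+1 ln.
  by rewrite -!/(p _) pS /m eN !ler_norml; lra.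
have xE l : x l - x l.+1 = 4 * r * s * cos (m l).
  rewrite /x -mulrBr pS.
  have -> : p l = m l + 1 / (2 * N%:R) by rewrite /m subrK.
  have -> : m l + 1 / (2 * N%:R) - 1 / N%:R = m l - 1 / (2 * N%:R) by rewrite eN; lra.
  by move: (m l) => ml; rewrite sinD sinB -/s; ring.
pose u l := (4 * r * s * cos (m l))^-1.
have rs0 : 0 < r * s by rewrite mulr_gt0.
have D0 l : (l <= n)%N -> 0 < 4 * r * s * cos (m l).
  by move=> /m1 ml; rewrite mulr_gt0//; lra.
have rN : r / N%:R / 4 <= r * s.
  by apply: le_trans (ler_wpM2l (ltW r0) s0); rewrite le_eqVlt; apply/orP; left; apply/eqP; field; rewrite gt_eqF.
have uU l : (l <= n)%N -> `|u l| <= 2 * N%:R / r.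
  move=> ln; rewrite gtr0_norm ?invr_gt0 ?D0//.
  have -> : 2 * N%:R / r = (r / (2 * N%:R))^-1 by rewrite invf_div.
  rewrite lef_pV2 ?posrE ?D0 ?divr_gt0 ?mulr_gt0//.
  have -> : r / (2 * N%:R) = r / N%:R / 2 by field; rewrite gt_eqF.
  by have := m1 l ln; nra.
have uW l : (l < n)%N -> `|u l.+1 - u l| <= 4 / r.
  move=> ln.
  have := D0 _ (ltnW ln); have := D0 _ ln.
  have := m1 _ (ltnW ln); have := m1 _ ln.
  have : `|cos (m l) - cos (m l.+1)| <= 1 / N%:R.
    apply: le_trans (cos_lipschitz _ _) _.
    have -> : m l - m l.+1 = 1 / N%:R by rewrite /m pS; lra.
    by rewrite gtr0_norm.
  rewrite /u; move: (cos (m l)) (cos (m l.+1)) => c c' cc' c1' c1 d' d.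
  have c0 : 0 < c by lra.
  have c0' : 0 < c' by lra.
  have -> : (4 * r * s * c')^-1 - (4 * r * s * c)^-1 =
      (c - c') / (4 * (r * s) * c * c').
    by field; rewrite !gt_eqF.
  rewrite normrM normfV (gtr0_norm (_ : 0 < 4 * (r * s) * c * c')); last first.
    by rewrite !mulr_gt0.
  rewrite ler_pdivrMr ?mulr_gt0//; apply: le_trans cc' _.
  have -> : 4 / r * (4 * (r * s) * c * c') = 16 * s * (c * c') by field; rewrite gt_eqF.
  have : 1 / 4 <= c * c' by nra.
  by nra.
have xr l : `|x l| <= 2 * r.
  by rewrite /x normrM gtr0_norm ?mulr_gt0// ler_piMr ?mulr_ge0 ?sin_max// ltW.
have om0 : 0 <= om.
  have := aom 0 0; rewrite !subrr normr0; apply.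
  by rewrite divr_ge0// mulr_ge0// ltW.
have term l : (l < n)%N ->
    `|(a (x l + t) - a (x l)) - u l * (h (x l) - h (x l.+1))| <= 2 * om.
  move=> ln; have dl := D0 _ (ltnW ln).
  have xx : x l.+1 <= x l by rewrite -subr_ge0 xE ltW.
  have xx2 : x l - x l.+1 <= 2 * r / N%:R.
    apply: le_trans (ler_norm _) _; rewrite /x -mulrBr normrM gtr0_norm ?mulr_gt0//.
    rewrite ler_pM2l ?mulr_gt0//; apply: le_trans (sin_lipschitz _ _) _.
    by rewrite pS opprB addrCA subrr addr0 gtr0_norm// div1r.
  have dh z : x l.+1 <= z <= x l -> is_derive z 1 h (a (z + t) - a z).
    move=> zx; have zr : `|z| <= 2 * r.
      by have := xr l; have := xr l.+1; rewrite !ler_norml; lra.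
    have t0 : 0 <= `|t| by [].
    have dGt : is_derive (z + t) 1 G (a (z + t)).
      apply: dG; apply: le_lt_trans (ler_normD _ _) _; lra.
    have dGz : is_derive z 1 G (a z) by apply: dG; lra.
    have dt : is_derive z 1 (fun y : R => y + t) (1 + 0) by exact: is_deriveD.
    have dGs := @is_derive1_comp R G (fun y => y + t) z (a (z + t)) (1 + 0) dGt dt.
    rewrite addr0 mulr1 in dGs.
    exact: is_deriveB.
  have [z zx ->] := mean_value xx dh.
  rewrite /u -xE mulrC mulfK; last by rewrite xE gt_eqF.
  have -> : a (x l + t) - a (x l) - (a (z + t) - a z) =
     (a (x l + t) - a (z + t)) - (a (x l) - a z) by ring.
  apply: le_trans (ler_normB _ _) _.
  have zl : `|x l - z| <= 2 * r / N%:R by rewrite ger0_norm; lra.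
  have := aom _ _ zl; have := aom (x l + t) (z + t).
  by rewrite opprD addrACA subrr addr0 => /(_ zl); lra.
have := abel_sum_le (u := u) (h := h \o x) (n := n) (normr_ge0 t)
  (fun l _ => Gt _ (xr l)) uU uW.
rewrite /= => ab.
set Sum := (X in `|X| <= _).
have : `|Sum - \sum_(0 <= l < n) u l * (h (x l) - h (x l.+1))| <= N%:R * (2 * om).
  rewrite -sumrB; apply: le_trans (ler_norm_sum _ _ _) _.
  apply: (@le_trans _ _ (\sum_(0 <= l < n) (2 * om))).
    by rewrite big_nat [leRHS]big_nat; apply: ler_sum => l /andP[_]; exact: term.
  by rewrite sumr_const_nat subn0 -[_ *+ n]mulr_natl ler_wpM2r ?mulr_ge0// ler_nat.
have nN' : n%:R * (`|t| * (4 / r)) <= N%:R * (`|t| * (4 / r)).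
  by rewrite ler_wpM2r ?ler_nat// mulr_ge0// divr_ge0// ltW.
move=> Sd.
have : `|Sum| <= N%:R * (2 * om) + (2 * (`|t| * (2 * N%:R / r)) + N%:R * (`|t| * (4 / r))).
  apply: le_trans (lerD Sd (le_trans ab (lerD (lexx _) nN'))).
  by rewrite -[X in `|X|](subrK (\sum_(0 <= l < n) u l * (h (x l) - h (x l.+1)))) ler_normD.
congr (_ <= _); field; rewrite gt_eqF//.
Qed.

End SineSums.

(** * Energies of circular arcs *)

Section Arcs.
Variable R : realType.

(** The square [0, N)^2 is cut along the lines [k + l = c], on which the chord
    direction will be constant. *)
Lemma sum_antidiagonals (N : nat) (F : nat -> nat -> R) :
  \sum_(0 <= k < N) \sum_(0 <= l < N) F k l =
  \sum_(0 <= c < 2 * N) \sum_(c.+1 - N <= l < minn c.+1 N) F (c - l)%N l.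
Proof.
have inner c : \sum_(c.+1 - N <= l < minn c.+1 N) F (c - l)%N l =
    \sum_(0 <= l < N | (l <= c < l + N)%N) F (c - l)%N l.
  rewrite (big_nat_widenl _ 0)//= (big_nat_widen _ _ N) ?geq_minr//.
  rewrite big_nat_cond [RHS]big_nat_cond; apply: eq_bigl => l.
  by lia.
under [RHS]eq_bigr do rewrite inner.
rewrite [LHS]exchange_big/= [RHS](exchange_big_dep_nat xpredT)//=.
rewrite big_nat [RHS]big_nat; apply: eq_bigr => l /= lN.
have -> : \sum_(0 <= k < N) F k l = \sum_(l <= c < l + N) F (c - l)%N l.
  rewrite [RHS](_ : _ = \sum_(0 + l <= c < l + N) F (c - l)%N l); last by rewrite add0n.
  rewrite big_addn addKn; apply: eq_bigr => k _.
  by rewrite addnK.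
rewrite (big_nat_widenl _ 0)//= (big_nat_widen _ _ (2 * N)); last by lia.
rewrite big_nat_cond [RHS]big_nat_cond; apply: eq_bigl => c; lia.
Qed.

Variable d : nat.
Implicit Types e w : 'rV[R]_d.

Lemma tame_line_continuous (A : 'rV[R]_d -> R) e :
  (forall om, 0 < om -> exists2 rho, 0 < rho & tame rho om A) ->
  continuous (fun x : R => A (x *: e)).
Proof.
move=> Auc x; apply/cvgrPdist_le => om om0.
have [rho rho0 [_ At]] := Auc om om0.
have diffE y : `|A (x *: e) - A (y *: e)| <= om \/ rho < `|x - y| * enorm e.
  have [ye|ye] := leP (`|x - y| * enorm e) rho; [left|by right].
  have -> : y *: e = x *: e + (y - x) *: e by rewrite -scalerDl addrC subrK.
  by rewrite distrC; apply: At; rewrite enormZ distrC.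
have e1 : 0 < enorm e + 1 by rewrite ltr_wpDl ?enorm_ge0.
apply/nbhs_ballP; exists (rho / (enorm e + 1)) => /=; first exact: divr_gt0.
move=> y; rewrite /ball/= ltr_pdivlMr// => xy.
have [//|] := diffE y; have := normr_ge0 (x - y); lra.
Qed.

Variable A : 'rV[R]_d -> R.
Hypothesis hA : autocorrelation A.
Hypothesis Auc : forall om, 0 < om -> exists2 rho, 0 < rho & tame rho om A.
Variables (rho om : R).
Hypothesis Atame : tame rho om A.

(** The differences of points on a circular arc, grouped by the direction of
    the chord, have lengths distributed like the values of a sine; averaging
    along the direction of the chord at a scale much smaller than [r] thus
    makes little difference. *)
Lemma arc_energy_le (N H : nat) (eta r D k : R) (w e : nat -> 'rV[R]_d) :
  (2 < N)%N -> (0 < H)%N -> 0 < eta -> 0 < r -> 0 < k ->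
  (forall c, enorm (e c) <= D) -> 2 * r / N%:R * D <= rho ->
  (forall i j, w i - w j =
     (2 * sin ((i%:R - j%:R) / (2 * N%:R))) *: e (i + j)%N) ->
  energy A [seq r *: w i | i <- iota 0 N] <=
    2 * k + 2 / k * mean (iota 0 (2 * N))
                      (fun c => energy A (segment H eta (e c))) +
    16 * (H%:R * eta) / r + 4 * om.
Proof.
move=> N2 H0 eta0 r0 k0 eD rhoD wE.
have N0 : (0 < N)%N by apply: ltn_trans N2.
have N0' : 0 < N%:R :> R by rewrite ltr0n.
have D0 : 0 <= D by apply: le_trans (eD 0%N); exact: enorm_ge0.
have om0 : 0 <= om.
  apply: le_trans (Atame.2 0 0 _); rewrite ?normr_ge0// enorm0.
  by apply: le_trans rhoD; rewrite mulr_ge0// divr_ge0// mulr_ge0// ltW.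
pose a c (x : R) := A (x *: e c).
pose x c l : R := 2 * r * sin ((c%:R - 2 * l%:R) / (2 * N%:R)).
pose L := H%:R * eta.
pose E c := energy A (segment H eta (e c)).
have E0 c : 0 <= E c by exact: energy_ge0.
pose B := 8 * L * N%:R / r + 2 * N%:R * om.
have B0 : 0 <= B.
  by rewrite addr_ge0// ?divr_ge0 ?mulr_ge0// ltW.
have osc c y z : `|y - z| <= 2 * r / N%:R -> `|a c y - a c z| <= om.
  move=> yz; rewrite /a.
  have -> : y *: e c = z *: e c + (y - z) *: e c by rewrite -scalerDl addrC subrK.
  apply: Atame.2; rewrite enormZ; apply: le_trans rhoD.
  by apply: ler_pM; rewrite ?normr_ge0 ?enorm_ge0.
have key c : (c < 2 * N)%N -> \sum_(c.+1 - N <= l < minn c.+1 N) a c (x c l) <=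
    N%:R * (k + E c / k) + B.
  move=> cN; set l0 := (c.+1 - N)%N; set l1 := minn c.+1 N.
  pose n := (l1 - l0)%N.
  have nN : (n <= N)%N by rewrite /n /l1 /l0; lia.
  have -> : \sum_(l0 <= l < l1) a c (x c l) = \sum_(0 <= l < n) a c (x c (l + l0)%N).
    rewrite [LHS](_ : _ = \sum_(0 + l0 <= l < l1) a c (x c l)); last by rewrite add0n.
    by rewrite big_addn.
  pose p0 : R := (c%:R - 2 * l0%:R) / (2 * N%:R).
  have pE l : p0 - l%:R / N%:R = (c%:R - 2 * (l + l0)%:R) / (2 * N%:R).
    by rewrite /p0 natrD; field; rewrite gt_eqF.
  have p1 l : (l <= n.+1)%N -> `|p0 - l%:R / N%:R| <= 1.
    move=> ln; rewrite pE normrM normfV (@gtr0_norm _ (2 * _)) ?mulr_gt0//.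
    rewrite ler_pdivrMr ?mulr_gt0// mul1r ler_norml -!natrM; apply/andP; split.
      rewrite lerBrDl lerBlDr -natrD ler_nat; rewrite /n /l1 /l0 in ln *; lia.
    rewrite lerBlDr -natrD ler_nat; rewrite /n /l1 /l0 in ln *; lia.
  have shift t : 0 <= t <= L -> \sum_(0 <= l < n) a c (x c (l + l0)%N) <=
      \sum_(0 <= l < n) a c (t + x c (l + l0)%N) + B.
    move=> /andP[t0 tL].
    have := sine_sum_shift t (tame_line_continuous (e := e c) Auc)
      (fun y => Atame.1 _) r0 N0 nN p1 (osc c).
    rewrite sumrB distrC (ger0_norm t0) => h.
    rewrite -lerBlDl; apply: le_trans (_ : 8 * t * N%:R / r + 2 * N%:R * om <= _).
      apply: le_trans h; apply: le_trans (ler_norm _); rewrite le_eqVlt.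
      apply/orP; left; apply/eqP; congr (_ - _); apply: eq_bigr => l _.
        by rewrite /x -pE.
      by rewrite /x -pE addrC.
    rewrite lerD2r ler_pM2r ?invr_gt0// ler_pM2r// ler_pM2l//.
  have sumE : \sum_(0 <= l < n) a c (x c (l + l0)%N) <= \sum_(0 <= l < n)
      mean (iota 0 H) (fun i => a c (eta * i%:R + x c (l + l0)%N)) + B.
    have -> : \sum_(0 <= l < n)
        mean (iota 0 H) (fun i => a c (eta * i%:R + x c (l + l0)%N)) =
      mean (iota 0 H) (fun i => \sum_(0 <= l < n) a c (eta * i%:R + x c (l + l0)%N)).
      by rewrite /mean -mulr_suml exchange_big.
    have sH : (0 < size (iota 0 H))%N by rewrite size_iota.
    rewrite -[B](mean_cst _ sH) -meanD -[leLHS](mean_cst _ sH).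
    apply: le_mean_in => i; rewrite mem_iota add0n => /andP[_ iH]; apply: shift.
    apply/andP; split; first by rewrite mulr_ge0// ltW.
    by rewrite /L mulrC ler_pM2r// ler_nat ltnW.
  apply: le_trans sumE _; rewrite lerD2r.
  apply: (@le_trans _ _ (\sum_(0 <= l < n) (k + E c / k))).
    apply: ler_sum => l _.
    have := cross_le_energy hA (segment H eta (e c)) [:: - (x c (l + l0)%N *: e c)] k0.
    apply: le_trans; rewrite /cross /segment mean_map le_eqVlt; apply/orP; left.
    apply/eqP; apply: eq_mean => i /=; rewrite /mean big_seq1 divr1 opprK.
    by rewrite /a scalerDl.
  rewrite sumr_const_nat subn0 -[_ *+ n]mulr_natl ler_wpM2r ?ler_nat//.
  by apply: addr_ge0; [exact: ltW|apply: divr_ge0 => //; exact: ltW].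
have -> : energy A [seq r *: w i | i <- iota 0 N] =
    (\sum_(0 <= c < 2 * N) \sum_(c.+1 - N <= l < minn c.+1 N) a c (x c l)) / N%:R ^+ 2.
  pose F i j := a (i + j)%N (x (i + j)%N j).
  have -> : \sum_(0 <= c < 2 * N) \sum_(c.+1 - N <= l < minn c.+1 N) a c (x c l) =
      \sum_(0 <= i < N) \sum_(0 <= j < N) F i j.
    rewrite sum_antidiagonals; apply: eq_bigr => c _.
    rewrite big_nat [RHS]big_nat; apply: eq_bigr => l lc.
    by rewrite /F subnK//; move: lc; lia.
  rewrite /energy /cross mean_map /mean size_iota size_map size_iota.
  rewrite -mulr_suml expr2 invfM mulrA; congr (_ / _ / _).
  rewrite /index_iota subn0; apply: eq_bigr => i _; rewrite big_map.
  apply: eq_bigr => j _; rewrite -scalerBr wE scalerA /F /a /x; congr (A (_ *: _)).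
  by rewrite natrD (_ : i%:R + j%:R - 2 * j%:R = i%:R - j%:R :> R); ring.
rewrite ler_pdivrMr ?exprn_gt0//.
apply: (@le_trans _ _ (\sum_(0 <= c < 2 * N) (N%:R * (k + E c / k) + B))).
  by rewrite big_nat [leRHS]big_nat; apply: ler_sum => c /andP[_]; exact: key.
rewrite big_split/= sumr_const_nat subn0 -mulr_sumr big_split/= sumr_const_nat subn0.
rewrite -mulr_suml /mean size_iota -/(E _) [index_iota _ _]/(iota 0 (2 * N - 0)) subn0.
rewrite -[B *+ _]mulr_natl -[k *+ _]mulr_natl natrM le_eqVlt; apply/orP; left.
by apply/eqP; rewrite /B /L; field; rewrite !gt_eqF.
Qed.

End Arcs.

(** * Plane rotations and their chords *)

Section PlaneRotations.
Variables (R : realType) (d : nat).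
Implicit Types a b v x xi : 'rV[R]_d.

Definition orthonormal a b := [/\ dot a a = 1, dot b b = 1 & dot a b = 0].

(** The rotation by [t] in the oriented plane of basis [a], [b]. *)
Definition rot a b (t : R) : 'M[R]_d :=
  1%:M + (cos t - 1) *: (a^T *m a + b^T *m b) + sin t *: (a^T *m b - b^T *m a).

Lemma mulmx_rot a b t x : x *m rot a b t =
  x + (cos t - 1) *: (dot x a *: a + dot x b *: b) +
  sin t *: (dot x a *: b - dot x b *: a).
Proof.
by rewrite /rot !mulmxDr mulmx1 -!scalemxAr !mulmxDr mulmxN !mulmxA
  !mulmx_tr_dot !mul_scalar_mx.
Qed.

Lemma rot0 a b : rot a b 0 = 1%:M.
Proof. by rewrite /rot cos0 sin0 subrr !scale0r !addr0. Qed.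

Lemma trmx_rot a b t : (rot a b t)^T = rot a b (- t).
Proof.
apply/matrixP => i j; rewrite !mxE !big_ord1 !mxE eq_sym cosN sinN.
by rewrite [a 0 i * a 0 j]mulrC [b 0 i * b 0 j]mulrC; ring.
Qed.

Lemma rotD a b s t : orthonormal a b -> rot a b s *m rot a b t = rot a b (s + t).
Proof.
move=> [aa bb ab].
have ba : dot b a = 0 by rewrite dotC.
apply/row_matrixP => i; rewrite !rowE mulmxA !mulmx_rot.
rewrite !(dotDl, dotZl, dotNl) aa bb ab ba cosD sinD.
by apply/rowP => j; rewrite !mxE; ring.
Qed.

(** A rotation is the square of the rotation by half the angle, whose
    determinant is [1] or [-1]. *)
Lemma rot_SO a b t : orthonormal a b -> SO R d (rot a b t).
Proof.
move=> ab.
have RR s : rot a b s *m (rot a b s)^T = 1%:M.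
  by rewrite trmx_rot rotD// subrr rot0.
split => //.
have -> : rot a b t = rot a b (t / 2) *m rot a b (t / 2).
  by rewrite rotD//; congr (rot _ _ _); field.
by have := congr1 determinant (RR (t / 2)); rewrite !det_mulmx det_tr det1.
Qed.

(** The direction of the chord between the rotations of [v] by [t + h] and
    [t - h]. *)
Definition chord a b v (t : R) : 'rV[R]_d :=
  - (dot v a * sin t + dot v b * cos t) *: a +
  (dot v a * cos t - dot v b * sin t) *: b.

Lemma rot_sub_rot a b v (t h : R) :
  v *m rot a b (t + h) - v *m rot a b (t - h) = (2 * sin h) *: chord a b v t.
Proof.
rewrite !mulmx_rot /chord cosB sinB cosD sinD.
by apply/rowP => j; rewrite !mxE; ring.
Qed.

Lemma enorm_chord_le a b v t : orthonormal a b -> enorm (chord a b v t) <= 4 * enorm v.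
Proof.
move=> [aa bb _].
have a1 : enorm a = 1 by rewrite enormE aa sqrtr1.
have b1 : enorm b = 1 by rewrite enormE bb sqrtr1.
apply: le_trans (enormD _ _) _; rewrite !enormZ a1 b1 !mulr1 normrN.
have va := dot_le_enorm v a; have vb := dot_le_enorm v b.
rewrite a1 mulr1 in va; rewrite b1 mulr1 in vb.
have tr (z w : R) : `|z| <= enorm v -> `|w| <= 1 -> `|z * w| <= enorm v.
  by move=> zv w1; rewrite normrM -[leRHS]mulr1 ler_pM.
have h1 := tr _ _ va (sin_max t); have h2 := tr _ _ va (cos_max t).
have h3 := tr _ _ vb (sin_max t); have h4 := tr _ _ vb (cos_max t).
have := ler_normD (dot v a * sin t) (dot v b * cos t).
have := ler_normB (dot v a * cos t) (dot v b * sin t).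
lra.
Qed.

Lemma dot_chord a b v xi t : dot (chord a b v t) xi =
  (dot v a * dot xi b - dot v b * dot xi a) * cos t -
  (dot v a * dot xi a + dot v b * dot xi b) * sin t.
Proof. by rewrite /chord dotDl !dotZl !(dotC xi); ring. Qed.

End PlaneRotations.

(** * Near zeros of trigonometric sums *)

Section GenericDirections.
Variable R : realType.

Lemma count_iota_diameter (M : nat) (P : pred nat) (W : R) : 0 <= W ->
  (forall i j, (i <= j < M)%N -> P i -> P j -> j%:R - i%:R <= W) ->
  (count P (iota 0 M))%:R <= W + 1.
Proof.
move=> W0 PW; rewrite -size_filter.
have [/hasP[i iM Pi]|/hasPn noP] := boolP (has P (iota 0 M)); last first.
  rewrite (_ : seq.filter P _ = [::]) ?addr_ge0//.
  by apply/eqP; rewrite -[_ == _]negbK -has_filter; apply/hasPn.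
have exP : exists i, P i by exists i.
case: (ex_minnP exP) => m Pm mmin.
have : {subset seq.filter P (iota 0 M) <= iota m (Num.truncn W).+1}.
  move=> j; rewrite mem_filter !mem_iota add0n => /andP[Pj /andP[_ jM]].
  have mj := mmin _ Pj; rewrite mj/= addnS ltnS -leq_subLR.
  rewrite truncn_ge_nat// natrB//; apply: PW => //.
  by rewrite mj.
move=> /(uniq_leq_size (filter_uniq _ (iota_uniq 0 M))); rewrite size_iota => h.
apply: (@le_trans _ _ (Num.truncn W).+1%:R); first by rewrite ler_nat.
by rewrite -natr1 lerD2r; have /andP[] := truncn_itv W0.
Qed.

(** Two nearly common zeros of [p cos - q sin] at a definite distance would
    make both [p] and [q] small. *)
Lemma count_small_trig_le (N : nat) (p q m c0 : R) : (0 < N)%N -> 0 < m ->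
  0 < c0 -> m ^+ 2 <= p ^+ 2 + q ^+ 2 ->
  (count (fun c => `|p * cos (c%:R / (2 * N%:R)) - q * sin (c%:R / (2 * N%:R))| < c0)
     (iota 0 (2 * N)))%:R <= 12 * c0 / m * N%:R + 1.
Proof.
move=> N0 m0 c00 mpq.
have N0' : 0 < N%:R :> R by rewrite ltr0n.
apply: count_iota_diameter.
  by rewrite mulr_ge0// divr_ge0 ?mulr_ge0// ltW.
move=> i j /andP[ij jN].
set s : R := i%:R / _; set t : R := j%:R / _ => hs ht.
have ts : j%:R - i%:R = 2 * N%:R * (t - s) :> R by rewrite /s /t; field; rewrite gt_eqF.
have st0 : 0 <= t - s.
  by rewrite -(pmulr_rge0 _ (_ : 0 < 2 * N%:R)) ?mulr_gt0// -ts subr_ge0 ler_nat.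
have st1 : t - s <= 1.
  rewrite -(ler_pM2l (_ : 0 < 2 * N%:R)) ?mulr_gt0// -ts mulr1 -natrM.
  by rewrite lerBlDr -natrD ler_nat; apply: leq_trans (ltnW jN) (leq_addr _ _).
have sin2 : (t - s) / 2 <= sin (t - s) by apply: sin_ge_half; rewrite st0.
set x := p * cos s - q * sin s in hs; set y := p * cos t - q * sin t in ht.
have pe : p * sin (t - s) = x * sin t - y * sin s by rewrite sinB /x /y; ring.
have qe : q * sin (t - s) = x * cos t - y * cos s by rewrite sinB /x /y; ring.
have bd (u v : R) : `|u| <= 1 -> `|v| <= 1 -> `|x * u - y * v| <= 2 * c0.
  move=> u1 v1; apply: le_trans (ler_normB _ _) _; rewrite !normrM.
  have : `|x| * `|u| <= c0 * 1 by rewrite ler_pM// ltW.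
  have : `|y| * `|v| <= c0 * 1 by rewrite ler_pM// ltW.
  lra.
have sq (u : R) : `|u| <= 2 * c0 -> u ^+ 2 <= (2 * c0) ^+ 2.
  by move=> uc; rewrite -real_normK ?num_real// lerXn2r// nnegrE mulr_ge0// ltW.
have hp : (p * sin (t - s)) ^+ 2 <= (2 * c0) ^+ 2.
  by rewrite pe; apply/sq/bd; exact: sin_max.
have hq : (q * sin (t - s)) ^+ 2 <= (2 * c0) ^+ 2.
  by rewrite qe; apply/sq/bd; exact: cos_max.
have : (m * sin (t - s)) ^+ 2 <= (3 * c0) ^+ 2.
  rewrite exprMn; apply: (@le_trans _ _ ((p ^+ 2 + q ^+ 2) * sin (t - s) ^+ 2)).
    by rewrite ler_wpM2r// sqr_ge0.
  rewrite mulrDl -!exprMn; apply: le_trans (lerD hp hq) _.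
  by rewrite !expr2; have := mulr_ge0 (ltW c00) (ltW c00); lra.
rewrite ler_pXn2r// ?nnegrE; last 2 first.
- apply: mulr_ge0; [exact: ltW|lra].
- by rewrite mulr_ge0// ltW.
move=> ms; rewrite ts.
have -> : 12 * c0 / m * N%:R = 2 * N%:R * (6 * c0 / m) by ring.
rewrite ler_pM2l ?mulr_gt0// ler_pdivlMr//.
have : m * ((t - s) / 2) <= m * sin (t - s) by rewrite ler_pM2l.
lra.
Qed.

End GenericDirections.

(** * Planes in general position *)

Section Frames.
Variables (R : realType) (d : nat).
Local Notation V := 'rV[R]_d.+2.

(** The planes are spanned by the point of the moment curve of parameter [s]
    and a vector orthogonal to it. *)
Let moment (s : nat) : V := \row_i s%:R ^+ i.

Let normal (s : nat) : V :=
  \row_i (if i == 0 then - s%:R else if i == 1 then 1 else 0).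

Let moment_gt0 s : 0 < enorm (moment s).
Proof.
by apply: lt_le_trans (enorm_coord _ 0); rewrite mxE expr0 normr1.
Qed.

Let normal_gt0 s : 0 < enorm (normal s).
Proof.
by apply: lt_le_trans (enorm_coord _ 1); rewrite mxE/= normr1.
Qed.

Let dot_moment_normal s : dot (moment s) (normal s) = 0.
Proof.
rewrite /dot !big_ord_recl/= big1 ?addr0 => [|i _]; rewrite !mxE/= ?mulr0//.
by rewrite expr0 mul1r expr1 mulr1 addrC subrr.
Qed.

Definition frame_fst s : V := (enorm (moment s))^-1 *: moment s.
Definition frame_snd s : V := (enorm (normal s))^-1 *: normal s.

Lemma orthonormal_frame s : orthonormal (frame_fst s) (frame_snd s).
Proof.
split; rewrite /frame_fst /frame_snd dotZl dotZr ?dot_moment_normal ?mulr0//.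
  by rewrite -sqr_enorm; field; rewrite gt_eqF.
by rewrite -sqr_enorm; field; rewrite gt_eqF.
Qed.

(** Any [d.+2] points of the moment curve form a basis, by Vandermonde. *)
Let moment_basis (f : {ffun 'I_d.+2 -> nat}) : injective f ->
  exists2 C, 0 <= C & forall (xi : V) (t : R),
    (forall i, `|dot xi (moment (f i))| <= t) -> enorm xi <= C * t.
Proof.
move=> finj.
pose W := Vandermonde d.+2 (\row_j (f j)%:R : V).
have Wu : W \in unitmx.
  rewrite unitmxE unitfE det_Vandermonde.
  apply/prodf_neq0 => i _; apply/prodf_neq0 => j ij.
  rewrite !mxE subr_eq0 eqr_nat; apply: contraTneq ij => /finj ->.
  by rewrite ltnn.
exists (\sum_j \sum_i `|invmx W i j|).
  by apply: sumr_ge0 => j _; apply: sumr_ge0.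
move=> xi t xit; apply: le_trans (enorm_le_sum _) _.
rewrite mulr_suml; apply: ler_sum => j _.
have {1}-> : xi = xi *m W *m invmx W by rewrite mulmxK.
rewrite mxE mulr_suml; apply: le_trans (ler_norm_sum _ _ _) _.
apply: ler_sum => i _; rewrite normrM mulrC ler_wpM2l//.
apply: le_trans (xit i); rewrite le_eqVlt; apply/orP; left; apply/eqP.
by rewrite mxE; congr `|_|; apply: eq_bigr => k _; rewrite !mxE.
Qed.

(** Smallness against [d.+2] vectors of a basis forces smallness of [xi]; there
    are finitely many choices of [d.+2] vectors among [K]. *)
Lemma frames_generic (K : nat) : exists2 c : R, 0 < c & forall xi : V,
  (count (fun s => `|dot xi (frame_fst s)| < c * enorm xi)%R (iota 0 K) < d.+2)%N.
Proof.
pose U := 1 + \sum_(s <- iota 0 K) enorm (moment s).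
have [C C0 CP] : exists2 C, 0 <= C & forall (f : {ffun 'I_d.+2 -> 'I_K}),
    injective f -> forall (xi : V) (t : R), 0 <= t ->
    (forall i, `|dot xi (moment (f i))| <= t) -> enorm xi <= C * t.
  have Cf (f : {ffun 'I_d.+2 -> 'I_K}) : exists C, 0 <= C /\ (injective f ->
      forall (xi : V) (t : R),
      (forall i, `|dot xi (moment (f i))| <= t) -> enorm xi <= C * t).
    have [fi|] := pselect (injective f); last by exists 0.
    have [|C C0 CP] := @moment_basis [ffun i => f i : nat].
      by move=> i j; rewrite !ffunE => /val_inj/fi.
    by exists C; split => // _ xi t xit; apply: CP => i; rewrite ffunE.
  have [Cof CofP] := choice Cf.
  exists (\sum_f Cof f); first by apply: sumr_ge0 => f _; case: (CofP f).
  move=> f fi xi t t0 xit; apply: le_trans ((CofP f).2 fi xi t xit) _.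
  rewrite ler_wpM2r// (bigD1 f)//= lerDl; apply: sumr_ge0 => g _.
  by case: (CofP g).
have U0 : 0 < U by rewrite ltr_pwDl// sumr_ge0// => s _; exact: enorm_ge0.
have CU : 0 < 2 * (C + 1) * U by rewrite !mulr_gt0// ltr_wpDl.
exists (2 * (C + 1) * U)^-1; first by rewrite invr_gt0.
move=> xi; rewrite ltnNge; apply/negP; rewrite -size_filter.
set L := [seq x <- _ | _] => dL.
have Lmem i : (i < d.+2)%N -> nth 0%N L i \in L.
  by move=> id; rewrite mem_nth// (leq_trans id).
have LK i : i \in L -> (i < K)%N.
  by rewrite mem_filter mem_iota add0n => /andP[_ /andP[]].
pose f : {ffun 'I_d.+2 -> 'I_K} :=
  [ffun i : 'I_d.+2 => Ordinal (LK _ (Lmem i (ltn_ord i)))].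
have fi : injective f.
  move=> i j; rewrite !ffunE => /(congr1 val)/= /eqP.
  rewrite nth_uniq ?(leq_trans (ltn_ord _))// => [/eqP/val_inj//|].
  exact/filter_uniq/iota_uniq.
have xi0 : 0 < enorm xi.
  have := Lmem 0%N isT; rewrite mem_filter => /andP[h _].
  by have := le_lt_trans (normr_ge0 _) h; rewrite pmulr_rgt0 ?invr_gt0.
have := CP f fi xi ((2 * (C + 1))^-1 * enorm xi).
rewrite mulr_ge0 ?enorm_ge0 ?invr_ge0 ?mulr_ge0 ?addr_ge0// => /(_ isT).
apply/not_implyP; split; last first.
  apply/negP; rewrite -ltNge mulrA -[ltRHS]mul1r ltr_pM2r//.
  by rewrite ltr_pdivrMr ?mulr_gt0 ?ltr_wpDl//; lra.
move=> i; have := Lmem i (ltn_ord i); rewrite mem_filter => /andP[h iK].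
have -> : moment (f i) = enorm (moment (f i)) *: frame_fst (f i).
  by rewrite /frame_fst scalerA mulfV ?scale1r// gt_eqF.
rewrite dotZr normrM gtr0_norm//; rewrite ffunE /=.
set s := nth _ _ _ in h iK *.
have sU : enorm (moment s) <= U.
  rewrite /U (bigD1_seq s)//= ?iota_uniq// addrCA lerDl addr_ge0// sumr_ge0// => j _.
  exact: enorm_ge0.
apply: (@le_trans _ _ (U * ((2 * (C + 1) * U)^-1 * enorm xi))).
  by apply: ler_pM; rewrite ?enorm_ge0// ltW.
rewrite mulrA ler_wpM2r ?enorm_ge0// le_eqVlt; apply/orP; left; apply/eqP.
by field; rewrite (gt_eqF U0) gt_eqF// ltr_wpDl.
Qed.

End Frames.

(** * Chords in general position *)

Section Decorrelation.
Variable R : realType.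

Lemma count_allpairs X Y Z (f : X -> Y -> Z) (s : seq X) (t : seq Y) (P : pred Z) :
  count P [seq f x y | x <- s, y <- t] = (\sum_(x <- s) count (P \o f x) t)%N.
Proof.
rewrite -sum1_count big_mkcond big_allpairs_dep/=; apply: eq_bigr => x _.
by rewrite -sum1_count [RHS]big_mkcond.
Qed.

Variable d : nat.
Local Notation V := 'rV[R]_d.+2.
Implicit Types v xi : V.

Let a := @frame_fst R d.
Let b := @frame_snd R d.

Definition chords (K N : nat) v : seq V :=
  [seq chord (a s) (b s) v (c%:R / (2 * N%:R)) | s <- iota 0 K, c <- iota 0 (2 * N)].

(** A chord direction in the plane number [s] is nearly orthogonal to [xi] only
    if [v] or [xi] is nearly orthogonal to [a s], or else at few angles. *)
Lemma chords_generic (S eps : R) : 0 < S -> 0 < eps ->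
  exists K c0 N0, [/\ (0 < K)%N, 0 < c0 & forall N v, (N0 <= N)%N ->
    S <= enorm v -> forall xi, enorm xi = 1 ->
    (count (fun e => `|dot e xi| < c0) (chords K N v))%:R <=
      eps * (size (chords K N v))%:R].
Proof.
move=> S0 eps0.
pose n := d.+2.
pose K := (Num.truncn (4 * n%:R / eps)).+1.
have KE : 2 * n%:R <= eps / 2 * K%:R.
  have := ltW (truncnS_gt (4 * n%:R / eps)); rewrite -/K ler_pdivrMr//; lra.
have [c c0 cP] := @frames_generic R d K.
pose m := c * S * c.
have m0 : 0 < m by rewrite !mulr_gt0.
exists K, (eps * m / 24), (maxn 1 (Num.truncn (2 / eps)).+1).
split=> //; first by rewrite divr_gt0// mulr_gt0.
move=> N v; rewrite geq_max => /andP[N0 NE] Sv xi xi1.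
have N0' : 0 < N%:R :> R by rewrite ltr0n.
have epsN : 2 <= eps * N%:R.
  rewrite mulrC -ler_pdivrMr//; apply: ltW (lt_le_trans (truncnS_gt _) _).
  by rewrite ler_nat.
rewrite /chords count_allpairs size_allpairs !size_iota.
pose badv s := `|dot v (a s)| < c * enorm v.
pose badx s := `|dot xi (a s)| < c * enorm xi.
have step s : (count ((fun e => `|dot e xi| < eps * m / 24)%R \o
      (fun c => chord (a s) (b s) v (c%:R / (2 * N%:R)))) (iota 0 (2 * N)))%:R <=
    2 * N%:R * ((badv s)%:R + (badx s)%:R) + (12 * (eps * m / 24) / m * N%:R + 1) :> R.
  have pos : 0 <= 12 * (eps * m / 24) / m * N%:R + 1 :> R.
    by rewrite addr_ge0// mulr_ge0// divr_ge0 ?mulr_ge0 ?divr_ge0 ?mulr_ge0// ltW.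
  have triv : (1 : R) <= (badv s)%:R + (badx s)%:R -> (count ((fun e => `|dot e xi| < eps * m / 24)%R \o
      (fun c => chord (a s) (b s) v (c%:R / (2 * N%:R)))) (iota 0 (2 * N)))%:R <=
    2 * N%:R * ((badv s)%:R + (badx s)%:R) + (12 * (eps * m / 24) / m * N%:R + 1) :> R.
    move=> h; apply: (@le_trans _ _ (2 * N%:R * 1)).
      by rewrite mulr1 -natrM ler_nat -[leqRHS](size_iota 0) count_size.
    by rewrite ler_wpDr// ler_pM2l// mulr_gt0.
  have [bv|bv] := orP (orbN (badv s)); first by apply: triv; rewrite bv lerDl.
  have [bx|bx] := orP (orbN (badx s)); first by apply: triv; rewrite bx lerDr.
  rewrite (negbTE bv) (negbTE bx) addr0 mulr0 add0r.
  rewrite -leNgt in bv; rewrite -leNgt xi1 mulr1 in bx.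
  pose p := dot v (a s) * dot xi (b s) - dot v (b s) * dot xi (a s).
  pose q := dot v (a s) * dot xi (a s) + dot v (b s) * dot xi (b s).
  have pq : m ^+ 2 <= p ^+ 2 + q ^+ 2.
    apply: (@le_trans _ _ ((dot v (a s) * dot xi (a s)) ^+ 2)).
      rewrite -[leRHS]real_normK ?num_real// lerXn2r ?nnegrE ?(ltW m0)//.
      rewrite normrM; apply: ler_pM => //; rewrite ?mulr_ge0// ?(ltW c0) ?(ltW S0)//.
      by apply: le_trans bv; rewrite ler_pM2l.
    have -> : p ^+ 2 + q ^+ 2 = (dot v (a s) * dot xi (a s)) ^+ 2 +
      ((dot v (a s) * dot xi (b s)) ^+ 2 + (dot v (b s) * dot xi (a s)) ^+ 2 +
      (dot v (b s) * dot xi (b s)) ^+ 2) by rewrite /p /q; ring.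
    by rewrite lerDl !addr_ge0 ?sqr_ge0.
  have em0 : 0 < eps * m / 24 by rewrite divr_gt0// mulr_gt0.
  have := @count_small_trig_le R N p q m (eps * m / 24) N0 m0 em0 pq.
  apply: le_trans.
  rewrite ler_nat; apply: sub_count => j /=.
  by rewrite dot_chord.
rewrite natr_sum; apply: le_trans (ler_sum _ (fun s _ => step s)) _.
rewrite big_split/= -mulr_sumr big_split/=.
have cnt (P : pred nat) : \sum_(s <- iota 0 K) (P s)%:R = (count P (iota 0 K))%:R :> R.
  rewrite -sum1_count natr_sum [RHS]big_mkcond.
  by apply: eq_bigr => s _; case: (P s).
rewrite !cnt.
have cv : (count badv (iota 0 K))%:R <= n%:R :> R by rewrite ler_nat ltnW// cP.
have cx : (count badx (iota 0 K))%:R <= n%:R :> R by rewrite ler_nat ltnW// cP.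
have -> : \sum_(s <- iota 0 K) (12 * (eps * m / 24) / m * N%:R + 1) =
    K%:R * (eps / 2 * N%:R + 1).
  rewrite big_const_seq count_predT size_iota iter_addr_0 -[LHS]mulr_natl.
  by congr (_ * _); field; rewrite gt_eqF.
have cc : (count badv (iota 0 K))%:R + (count badx (iota 0 K))%:R <= eps / 2 * K%:R.
  by apply: le_trans KE; lra.
have : 2 * N%:R * ((count badv (iota 0 K))%:R + (count badx (iota 0 K))%:R) <=
  2 * N%:R * (eps / 2 * K%:R) by rewrite ler_pM2l ?mulr_gt0.
have : K%:R * (eps / 2 * N%:R + 1) <= K%:R * (eps * N%:R).
  by rewrite ler_wpM2l//; lra.
rewrite !natrM; lra.
Qed.

End Decorrelation.

(** * Decorrelation by rotations *)

Section Rotations.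
Variables (R : realType) (d : nat).
Local Notation V := 'rV[R]_d.+2.
Implicit Types v xi : V.

Let a := @frame_fst R d.
Let b := @frame_snd R d.

Lemma natr_large (x : R) : exists2 n, (0 < n)%N & x <= n%:R.
Proof. by exists (Num.truncn x).+1 => //; exact/ltW/truncnS_gt. Qed.

(** If [A] is the autocorrelation of a function whose averages at the scale [R0]
    are small, then the averages of that function over the rotations of
    [r *: v] are small. The modulus of continuity of [A] only decides how many
    rotations are needed, so that [C] can be the same for all [A]. *)
Theorem rotations_decorrelate (S D eps : R) : 0 < S -> 0 < D -> 0 < eps ->
  exists e4 C, [/\ 0 < e4, 0 < C & forall R0, 0 < R0 ->
    forall A : V -> R, autocorrelation A ->
    (forall om, 0 < om -> exists2 rho, 0 < rho & tame rho om A) ->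
    forall Y, (0 < size Y)%N -> (forall y, y \in Y -> enorm y <= R0) ->
      energy A Y <= e4 ->
    forall r, C * R0 <= r -> exists Qs : seq 'M[R]_d.+2,
      [/\ (0 < size Qs)%N, forall Q, Q \in Qs -> SO R d.+2 Q &
        forall v, S <= enorm v <= D ->
          energy A [seq r *: (v *m Q) | Q <- Qs] <= eps]].
Proof.
move=> S0 D0 eps0.
pose n := d.+2; have n0 : 0 < n%:R :> R by rewrite ltr0n.
(* The final bound is [2 k + (2 / k) y + 16 L / r + 4 om], where [y] bounds the
   mean energy of the segments, and [z] is the bound needed on its power. *)
pose k := eps / 16; have k0 : 0 < k by rewrite divr_gt0.
pose y := eps * k / 16; have y0 : 0 < y by rewrite divr_gt0// mulr_gt0.
pose z := y ^+ (2 ^ n.-1); have z0 : 0 < z by exact: exprn_gt0.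
pose eps1 := z / (4 * n%:R).
have eps10 : 0 < eps1 by rewrite divr_gt0// mulr_gt0.
have [K [c0 [N1 [K0 c00 chordsP]]]] := @chords_generic R d S eps1 S0 eps10.
pose D1 := 4 * D + 1; have D10 : 0 < D1 by rewrite addr_gt0// mulr_gt0.
have [|C1 C10 coordP] := @spread_coordinates R n c0 D1 c00.
  by rewrite /D1 lerDr mulr_ge0// ltW.
pose om := Num.min (eps / 32) (z / (8 * n%:R)).
have om0 : 0 < om by rewrite lt_min !divr_gt0// mulr_gt0.
have om1 : 4 * om <= eps / 8.
  have : om <= eps / 32 by rewrite /om ge_min lexx.
  lra.
have om2 : n%:R * om <= z / 8.
  have : om <= z / (8 * n%:R) by rewrite /om ge_min lexx orbT.
  by rewrite ler_pdivlMr ?mulr_gt0//; lra.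
pose Lam := 16 * n%:R * (C1 + 1) / z.
have Lam0 : 0 < Lam by rewrite divr_gt0// !mulr_gt0// ltr_wpDl.
exists ((z / 4) ^+ 2), (8 * 16 * Lam / eps); split.
- by rewrite exprn_gt0// divr_gt0.
- by rewrite divr_gt0// mulr_gt0.
move=> R0 R00 A hA Auc Y Y0 YR EY r rR.
have r0 : 0 < r by apply: lt_le_trans rR; rewrite mulr_gt0// divr_gt0// mulr_gt0.
(* The length of the segments, between the scales [R0] and [r]. *)
pose L := Lam * R0; have L0 : 0 < L by rewrite mulr_gt0.
have Lr : 16 * L / r <= eps / 8.
  rewrite ler_pdivrMr//; move: rR.
  rewrite mulrAC ler_pdivrMr// /L; lra.
have [rho rho0 Atame] := Auc om om0.
(* Enough points on the segments, and enough rotations, for all spacings to be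
   below the scale [rho] of the modulus of continuity. *)
have [H H0 HP] := natr_large (L * D1 / rho).
have H0' : 0 < H%:R :> R by rewrite ltr0n.
pose eta := L / H%:R; have eta0 : 0 < eta by rewrite divr_gt0.
have etaD : eta * D1 <= rho.
  by rewrite /eta mulrAC ler_pdivrMr// [leRHS]mulrC -ler_pdivrMr.
have HL : H%:R * eta = L by rewrite /eta mulrC divfK// gt_eqF.
have [N2 N20 N2P] := natr_large (2 * r * D1 / rho).
pose N := maxn 3 (maxn N1 N2).
have N3 : (2 < N)%N by rewrite leq_max.
have NN1 : (N1 <= N)%N by rewrite /N !leq_max leqnn orbT.
have NN2 : (N2 <= N)%N by rewrite /N !leq_max leqnn !orbT.
have N0 : 0 < N%:R :> R by rewrite ltr0n; apply: ltn_trans N3.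
have rhoD : 2 * r / N%:R * D1 <= rho.
  rewrite mulrAC ler_pdivrMr// [leRHS]mulrC -ler_pdivrMr//; apply: le_trans N2P _.
  by rewrite ler_nat.
pose Qs := [seq rot (a s) (b s) (j%:R / N%:R) | s <- iota 0 K, j <- iota 0 N].
exists Qs; split.
- by rewrite size_allpairs !size_iota muln_gt0 K0; apply: ltn_trans N3.
- move=> Q /allpairsP[[s j] [_ _ ->]]; exact: rot_SO (orthonormal_frame R d s).
move=> v /andP[Sv vD].
have chordD s t : enorm (chord (a s) (b s) v t) <= D1.
  apply: le_trans (enorm_chord_le _ _ (orthonormal_frame R d s)) _.
  by rewrite /D1; lra.
pose es := chords K N v.
have esD e : e \in es -> enorm e <= D1.
  by move=> /allpairsP[[s j] [_ _ ->]].
pose E e := energy A (segment H eta e).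
have smallE : mean es E <= y.
  have EY' : energy A Y / (z / 4) <= z / 4.
    by rewrite ler_pdivrMr ?divr_gt0// -expr2.
  have := @mean_segment_energy_exp_le R n A hA rho om eta D1 H es (ltW om0) eta0
    Atame esD etaD c0 C1 R0 eps1 Y C10 (ltW R00) (ltW eps10) coordP Y0 YR
    (chordsP N v NN1 Sv) (z / 4) (divr_gt0 z0 (ltr0n _ 4)) isT.
  rewrite HL -/E => h.
  rewrite -(@ler_pXn2r _ (2 ^ n.-1)) ?expn_gt0// ?nnegrE ?(ltW y0)//; last first.
    by apply: mean_ge0 => e; exact: energy_ge0.
  apply: le_trans h _; rewrite -/z.
  have -> : n%:R * eps1 = z / 4 by rewrite /eps1; field; rewrite gt_eqF.
  have : n%:R * (2 * (C1 * R0) / L + om) <= z / 4.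
    rewrite mulrDr.
    have : n%:R * (2 * (C1 * R0) / L) <= z / 8.
      have -> : n%:R * (2 * (C1 * R0) / L) = z / 8 * (C1 / (C1 + 1)).
        by rewrite /L /Lam; field; rewrite !gt_eqF// ltr_wpDl.
      by rewrite ger_pMr ?divr_gt0// ler_pdivrMr ?ltr_wpDl//; lra.
    lra.
  lra.
rewrite /Qs map_allpairs.
apply: le_trans (energy_family_le hA _ _ _) _.
have arc s : energy A [seq r *: (v *m rot (a s) (b s) (j%:R / N%:R)) | j <- iota 0 N] <=
    2 * k + 2 / k * mean (iota 0 (2 * N)) (fun c =>
       E (chord (a s) (b s) v (c%:R / (2 * N%:R)))) + 16 * L / r + 4 * om.
  rewrite -HL.
  apply: (@arc_energy_le R n A hA Auc rho om Atame N H eta r D1 k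
    (fun j => v *m rot (a s) (b s) (j%:R / N%:R))
    (fun c => chord (a s) (b s) v (c%:R / (2 * N%:R)))) => //.
  move=> i j.
  have := rot_sub_rot (a s) (b s) v ((i + j)%:R / (2 * N%:R)) ((i%:R - j%:R) / (2 * N%:R)).
  have -> : (i + j)%:R / (2 * N%:R) + (i%:R - j%:R) / (2 * N%:R) = i%:R / N%:R :> R.
    by rewrite natrD; field; rewrite gt_eqF.
  have -> : (i + j)%:R / (2 * N%:R) - (i%:R - j%:R) / (2 * N%:R) = j%:R / N%:R :> R.
    by rewrite natrD; field; rewrite gt_eqF.
  by [].
apply: le_trans (le_mean _ arc) _.
have sK : (0 < size (iota 0 K))%N by rewrite size_iota.
under eq_mean do rewrite -!addrA.
rewrite meanD mean_cst// meanD mean_cst// meanZ.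
have -> : mean (iota 0 K) (fun s => mean (iota 0 (2 * N))
    (fun c => E (chord (a s) (b s) v (c%:R / (2 * N%:R))))) = mean es E.
  by rewrite /es /chords mean_allpairs.
have : 2 / k * mean es E <= 2 / k * y by rewrite ler_pM2l// divr_gt0.
have -> : 2 / k * y = eps / 8 by rewrite /y; field; rewrite gt_eqF.
rewrite /k; lra.
Qed.

End Rotations.

(** * The Lebesgue outer measure as an extension of the cost of boxes *)

Section BoxCost.
Variables (R : realType) (d : nat).
Local Notation V := 'rV[R]_d.+1.
Local Open Scope ereal_scope.

(** The price of a set that is neither empty nor a box is [+oo], so that boxes
    are the only useful members of a cover. *)
Definition box_cost (A : set V) : \bar R := ereal_inf [set v |
  (A = set0 /\ v = 0) \/ exists a b : V, [/\ forall i, (a 0 i <= b 0 i)%R,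
    A = box a b & v = (box_volume a b)%:E]].

Lemma box_volume_ge0 (a b : V) : (forall i, a 0 i <= b 0 i)%R -> (0 <= box_volume a b)%R.
Proof. by move=> ab; apply: prodr_ge0 => i _; rewrite subr_ge0. Qed.

Lemma box_inj (a b a' b' : V) : (forall i, a 0 i <= b 0 i)%R ->
  (forall i, a' 0 i <= b' 0 i)%R -> box a b = box a' b' -> a = a' /\ b = b'.
Proof.
move=> ab ab' e.
have : box a' b' a by rewrite -e => i; rewrite lexx ab.
have : box a' b' b by rewrite -e => i; rewrite lexx ab.
have : box a b a' by rewrite e => i; rewrite lexx ab'.
have : box a b b' by rewrite e => i; rewrite lexx ab'.
move=> h1 h2 h3 h4; split; apply/rowP => i; apply/eqP; rewrite eq_le.
  by have /andP[-> _] := h2 i; have /andP[-> _] := h4 i.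
by have /andP[_ ->] := h1 i; have /andP[_ ->] := h3 i.
Qed.

Lemma box_cost_ge0 A : 0 <= box_cost A.
Proof.
apply: le_ereal_inf_tmp => v [[_ ->]//|[a [b [ab _ ->]]]].
by rewrite lee_fin box_volume_ge0.
Qed.

Lemma box_cost0 : box_cost set0 = 0.
Proof.
apply/eqP; rewrite eq_le box_cost_ge0 andbT.
by apply: ereal_inf_lbound; left.
Qed.

Lemma box_cost_box (a b : V) : (forall i, a 0 i <= b 0 i)%R ->
  box_cost (box a b) <= (box_volume a b)%:E.
Proof. by move=> ab; apply: ereal_inf_lbound; right; exists a, b. Qed.

Lemma box_volume0 (a : V) : box_volume a a = 0%R.
Proof. by rewrite /box_volume big_ord_recl subrr mul0r. Qed.

Lemma box_cost_fin A : box_cost A != +oo -> exists p : V * V,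
  [/\ forall i, (p.1 0 i <= p.2 0 i)%R, A `<=` box p.1 p.2 &
      (box_volume p.1 p.2)%:E <= box_cost A].
Proof.
move=> Aoo; have [A0|An] := pselect (A = set0).
  exists (0, 0)%R; split => //=; first by rewrite A0.
  by rewrite box_volume0; exact: box_cost_ge0.
have [a [b [ab Aab]]] : exists a b : V, (forall i, (a 0 i <= b 0 i)%R) /\ A = box a b.
  apply: contrapT => nab; move/eqP: Aoo; apply.
  rewrite /box_cost (_ : [set v | _] = set0) ?ereal_inf0//.
  apply/seteqP; split => // v [[//]|[a [b [ab Aab _]]]].
  by apply: nab; exists a, b.
exists (a, b); split => //=; first by rewrite Aab.
apply: le_ereal_inf_tmp => v [[//]|[a' [b' [ab' Aab' ->]]]].
by have [-> ->] := box_inj ab ab' (etrans (esym Aab) Aab').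
Qed.

End BoxCost.

Section LebesgueOuterMeasure.
Variables (R : realType) (d : nat).
Local Notation V := 'rV[R]_d.+1.
Local Open Scope ereal_scope.

(** The space with all its subsets measurable: a carrier for the generic
    construction of an outer measure from the cost of covering sets. *)
Definition all_measurable := V.
HB.instance Definition _ := Pointed.on all_measurable.

Let all_measurable_set0 : [set: set all_measurable] set0. Proof. by []. Qed.
Let all_measurableC A : [set: set all_measurable] A -> [set: set all_measurable] (~` A).
Proof. by []. Qed.
Let all_measurable_bigcup (F : (set all_measurable)^nat) :
  (forall i, [set: set all_measurable] (F i)) -> [set: set all_measurable] (\bigcup_i F i).
Proof. by []. Qed.

HB.instance Definition _ := @isMeasurable.Build default_measure_display
  all_measurable [set: set all_measurable] all_measurable_set0 all_measurableC
  all_measurable_bigcup.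

Lemma lebesgue_rV_mu_ext :
  @lebesgue_rV R d.+1 = mu_ext (box_cost (d := d) : set all_measurable -> \bar R).
Proof.
apply/funext => X; apply/eqP; rewrite eq_le; apply/andP; split.
  apply: le_ereal_inf_tmp => _ [F [_ XF] <-].
  have [[k koo]|nk] := pselect (exists k, box_cost (F k) = +oo).
    by rewrite (eseries_pinfty _ _ koo) ?leey// => n _; rewrite -ltNye
      (lt_le_trans _ (box_cost_ge0 _)).
  have Ffin k : box_cost (F k) != +oo.
    by apply/eqP => koo; apply: nk; exists k.
  have [p pP] := choice (fun k => box_cost_fin (Ffin k)).
  apply: (@le_trans _ _ (\sum_(0 <= k <oo) (box_volume (p k).1 (p k).2)%:E)).
    apply: ereal_inf_lbound; exists (fst \o p), (snd \o p); split => //=.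
    - by move=> k i; case: (pP k).
    - by move=> x /XF[k _ Fx]; exists k => //; case: (pP k) => _ + _; exact.
  apply: lee_nneseries => [k _ _|k _]; last by case: (pP k).
  by rewrite lee_fin box_volume_ge0; case: (pP k).
apply: le_ereal_inf_tmp => _ [a [b [ab Xab ->]]].
apply: (@le_trans _ _ (\sum_(0 <= k <oo) box_cost (box (a k) (b k)))).
  by apply: ereal_inf_lbound; exists (fun k => box (a k) (b k)).
by apply: lee_nneseries => [k _ _|k _]; [exact: box_cost_ge0|exact: box_cost_box].
Qed.

Lemma lebesgue_rV0 : @lebesgue_rV R d.+1 set0 = 0.
Proof. by rewrite lebesgue_rV_mu_ext; apply: mu_ext0 => *; [exact: box_cost0|exact: box_cost_ge0]. Qed.

Lemma lebesgue_rV_ge0 A : 0 <= @lebesgue_rV R d.+1 A.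
Proof. by rewrite lebesgue_rV_mu_ext; apply: mu_ext_ge0 => *; exact: box_cost_ge0. Qed.

Lemma le_lebesgue_rV : {homo @lebesgue_rV R d.+1 : A B / A `<=` B >-> A <= B}.
Proof. by rewrite lebesgue_rV_mu_ext => A B AB; exact: (le_mu_ext (T := all_measurable)). Qed.

Lemma lebesgue_rV_sigma_subadditive : sigma_subadditive (@lebesgue_rV R d.+1).
Proof.
move=> F; rewrite lebesgue_rV_mu_ext.
exact: (@mu_ext_sigma_subadditive _ all_measurable _ _ (@box_cost_ge0 R d)).
Qed.

HB.instance Definition _ := isOuterMeasure.Build R V (@lebesgue_rV R d.+1)
  lebesgue_rV0 lebesgue_rV_ge0 le_lebesgue_rV lebesgue_rV_sigma_subadditive.

End LebesgueOuterMeasure.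

(** * Affine invariance and measurability of half-spaces *)

Section LebesgueProperties.
Variables (R : realType) (d : nat).
Local Notation V := 'rV[R]_d.+1.
Local Notation lam := (@lebesgue_rV R d.+1).
Implicit Types (A X : set V) (u x y : V).
Local Open Scope ereal_scope.

Lemma lebesgue_rV_affine_le (k : R) u A : (0 < k)%R ->
  (k ^+ d.+1)%:E * lam [set y | A (k *: y + u)%R] <= lam A.
Proof.
move=> k0; apply: le_ereal_inf_tmp => _ [a [b [ab Aab ->]]].
have kn0 : (0 < k ^+ d.+1)%R by exact: exprn_gt0.
pose sc (v : V) := (k^-1 *: (v - u))%R.
have vol j : box_volume (a j) (b j) = (k ^+ d.+1 * box_volume (sc (a j)) (sc (b j)))%R.
  rewrite /box_volume -[in X in (k ^+ X)%R](card_ord d.+1) -prodr_const -big_split/=.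
  by apply: eq_bigr => i _; rewrite !mxE; field; rewrite gt_eqF.
have scab j i : (sc (a j) 0 i <= sc (b j) 0 i)%R.
  by rewrite !mxE ler_pM2l ?invr_gt0// lerD2r.
under eq_eseriesr do rewrite vol EFinM.
rewrite nneseriesZl; last by move=> j _; rewrite lee_fin box_volume_ge0.
rewrite lee_pmul2l//; apply: ereal_inf_lbound.
exists (sc \o a), (sc \o b); split => //= y /Aab[j _ yj].
exists j => // i; have := yj i; rewrite !mxE.
rewrite ![(k^-1 * _)%R]mulrC ler_pdivrMr// ler_pdivlMr// ![(y 0 i * k)%R]mulrC.
by rewrite lerBlDr lerBrDr.
Qed.

Lemma lebesgue_rV_affine (k : R) u A : (0 < k)%R ->
  lam A = (k ^+ d.+1)%:E * lam [set y | A (k *: y + u)%R].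
Proof.
move=> k0; apply/eqP; rewrite eq_le lebesgue_rV_affine_le// andbT.
have k0' : (0 < k^-1)%R by rewrite invr_gt0.
have kn0 : (0 < k ^+ d.+1)%R by exact: exprn_gt0.
have := @lebesgue_rV_affine_le k^-1 (- (k^-1 *: u))%R [set y | A (k *: y + u)%R] k0'.
have -> : [set y | [set y0 | A (k *: y0 + u)%R] (k^-1 *: y - k^-1 *: u)%R] = A.
  apply/seteqP; split => y /=;
  by rewrite scalerBr !scalerA mulfV ?gt_eqF// !scale1r subrK.
rewrite exprVn => h.
by rewrite -[lam A]mul1e -(@mulfV _ (k ^+ d.+1)%R) ?gt_eqF// EFinM -muleA lee_pmul2l.
Qed.

Lemma lebesgue_rV_translate u A : lam [set y | A (y + u)%R] = lam A.
Proof.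
rewrite (lebesgue_rV_affine u A ltr01) expr1n mul1e.
by congr (lam _); apply/funext => y; rewrite /mkset scale1r.
Qed.

Lemma lebesgue_rV_box_le (a b : V) : (forall i, (a 0 i <= b 0 i)%R) ->
  lam (box a b) <= (box_volume a b)%:E.
Proof.
move=> ab; apply: ereal_inf_lbound.
exists (fun k => if k == 0%N then a else 0%R), (fun k => if k == 0%N then b else 0%R).
split.
- by case=> [|k] i /=; [exact: ab|exact: lexx].
- by move=> x xab; exists 0%N.
- rewrite nneseries_recl//; last first.
    by move=> [|k] _ /=; rewrite lee_fin; [exact: box_volume_ge0|rewrite box_volume0].
  rewrite eseries_cond/= eseries0 ?adde0// => -[|k]// _ _.
  by rewrite box_volume0.
Qed.

(** A half-space cuts every box into two boxes, whose volumes add up. *)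
Lemma half_space_measurable (i : 'I_d.+1) (c : R) :
  lebesgue_measurable [set x : V | (x 0 i <= c)%R].
Proof.
set H := [set x : V | _].
apply: le_caratheodory_measurable => X /=.
apply: le_ereal_inf_tmp => _ [a [b [ab Xab ->]]].
pose m k := (Num.max (a k 0 i) (Num.min (b k 0 i) c))%R.
have am k : (a k 0 i <= m k)%R by rewrite /m le_max lexx.
have mb k : (m k <= b k 0 i)%R by rewrite /m ge_max ab ge_min lexx.
pose b' k : V := (\row_j (if j == i then m k else b k 0 j))%R.
pose a' k : V := (\row_j (if j == i then m k else a k 0 j))%R.
have ab' k j : (a k 0 j <= b' k 0 j)%R by rewrite mxE; case: eqP => // ->.
have a'b k j : (a' k 0 j <= b k 0 j)%R by rewrite mxE; case: eqP => // ->.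
have vol k : box_volume (a k) (b k) =
    (box_volume (a k) (b' k) + box_volume (a' k) (b k))%R.
  rewrite /box_volume (bigD1 i)//= [X in (_ = X + _)%R](bigD1 i)//=.
  rewrite [X in (_ = _ + X)%R](bigD1 i)//=.
  rewrite (eq_bigr (fun j => b k 0 j - a k 0 j)%R); last by [].
  rewrite [X in (_ = _ * X + _)%R](eq_bigr (fun j => b k 0 j - a k 0 j)%R); last first.
    by move=> j ji; rewrite mxE (negbTE ji).
  rewrite [X in (_ = _ + _ * X)%R](eq_bigr (fun j => b k 0 j - a k 0 j)%R); last first.
    by move=> j ji; rewrite mxE (negbTE ji).
  by rewrite !mxE eqxx -mulrDl; congr (_ * _)%R; ring.
under eq_eseriesr do rewrite vol EFinD.
rewrite nneseriesD; last 2 first.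
- by move=> k _; rewrite lee_fin box_volume_ge0.
- by move=> k _; rewrite lee_fin box_volume_ge0.
apply: leeD; apply: ereal_inf_lbound.
- exists a, b'; split => // x [/Xab[k _ xk] xc].
  exists k => // j; rewrite mxE; case: eqP => [->|_]; last exact: xk.
  have /andP[h1 h2] := xk i; rewrite h1/=.
  by rewrite /m le_max le_min h2 xc orbT.
- exists a', b; split => // x [/Xab[k _ xk] /negP]; rewrite -ltNge => xc.
  exists k => // j; rewrite mxE; case: eqP => [->|_]; last exact: xk.
  have /andP[h1 h2] := xk i; rewrite h2 andbT.
  by rewrite /m ge_max h1 ge_min (ltW xc) orbT.
Qed.

End LebesgueProperties.

(** * Volumes and integrals *)

Section Integral.
Variables (R : realType) (d : nat).
Local Notation V := 'rV[R]_d.+1.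
Local Notation lam := (@lebesgue_rV R d.+1).
(** The function bundled with its outer measure structure, from which the
    Caratheodory theorem makes a measure. *)
Definition lebesgue_outer : {outer_measure set V -> \bar R} := lam.
Local Notation T := (caratheodory_type lebesgue_outer).
Local Notation mu := ((lebesgue_outer : set T -> \bar R) : {measure set T -> \bar R}).
Implicit Types (A B : set V) (u x y : V) (f g : V -> R).

Lemma measurableE A : lebesgue_measurable A = measurable (A : set T).
Proof. by []. Qed.

Lemma lebesgue_measurable0 : lebesgue_measurable (set0 : set V).
Proof. exact: (@caratheodory_measurable_set0 R V lebesgue_outer). Qed.

Lemma lebesgue_measurableI A B : lebesgue_measurable A -> lebesgue_measurable B ->
  lebesgue_measurable (A `&` B).
Proof. exact: (@caratheodory_measurable_setI R V lebesgue_outer). Qed.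

Lemma lebesgue_measurableU A B : lebesgue_measurable A -> lebesgue_measurable B ->
  lebesgue_measurable (A `|` B).
Proof. exact: (@caratheodory_measurable_setU R V lebesgue_outer). Qed.

Lemma lebesgue_measurableD A B : lebesgue_measurable A -> lebesgue_measurable B ->
  lebesgue_measurable (A `\` B).
Proof. exact: (@caratheodory_measurable_setD R V lebesgue_outer). Qed.

(** Half-spaces being measurable, so are the coordinates. *)
Lemma measurable_coord (i : 'I_d.+1) : measurable_fun [set: T] (fun x : T => (x : V) 0 i).
Proof.
apply: (measurability _ (RGenOInfty.measurableE R)) => /= _ [_] [c] -> <-.
rewrite setTI.
have -> : (fun x : T => (x : V) 0 i) @^-1` `]c, +oo[%classic =
    ~` [set x : V | x 0 i <= c].
  by apply/seteqP; split => x /=; rewrite in_itv/= andbT ltNge => /negP.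
apply: measurableC; exact: half_space_measurable.
Qed.

Lemma measurable_enorm_sub u : measurable_fun [set: T] (fun x : T => enorm ((x : V) - u)).
Proof.
apply: measurableT_comp => //.
  by apply: continuous_measurable_fun; exact: sqrt_continuous.
apply: measurable_sum => i; apply: measurable_funX.
rewrite (_ : (fun x : T => _) = (fun x : T => (x : V) 0 i - u 0 i)); last first.
  by apply/funext => x; rewrite !mxE.
apply: measurable_funB => //; exact: measurable_coord.
Qed.

Lemma measurable_eball u (r : R) : lebesgue_measurable (eball u r).
Proof.
rewrite measurableE.
have -> : eball u r = (fun x : T => enorm ((x : V) - u)) @^-1` `]-oo, r]%classic.
  by apply/seteqP; split => x /=; rewrite in_itv.
rewrite -[X in measurable X]setTI.
by apply: (measurable_enorm_sub u) => //; exact: measurable_itv.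
Qed.

Lemma measurable_translate u A : lebesgue_measurable A ->
  lebesgue_measurable [set x | A (x + u)].
Proof.
move=> mA X; rewrite -(lebesgue_rV_translate (- u) X).
rewrite (mA [set x | X (x - u)]); congr (_ + _)%E.
  rewrite -[RHS](lebesgue_rV_translate (- u)); congr (lam _).
  by apply/seteqP; split => x /=; rewrite subrK.
rewrite -[RHS](lebesgue_rV_translate (- u)); congr (lam _).
by apply/seteqP; split => x /=; rewrite subrK.
Qed.

Definition bounded A := exists r : R, forall x, A x -> enorm x <= r.

Lemma lebesgue_rV_bounded A : bounded A -> (lam A < +oo)%E.
Proof.
move=> [r Ar].
pose a : V := const_mx (- `|r|); pose b : V := const_mx `|r|.
have ab i : a 0 i <= b 0 i by rewrite !mxE ge0_cp.
apply: (@le_lt_trans _ _ (lam (box a b))); last first.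
  exact: le_lt_trans (lebesgue_rV_box_le ab) (ltry _).
apply: le_lebesgue_rV => x /Ar xr i; rewrite !mxE -ler_norml.
apply: le_trans (enorm_coord _ _) (le_trans xr _); exact: ler_norm.
Qed.

(** Only meaningful on bounded sets, where the measure is finite. *)
Definition vol A : R := fine (lam A).

Lemma vol_ge0 A : 0 <= vol A.
Proof. exact/fine_ge0/lebesgue_rV_ge0. Qed.

Lemma volE A : bounded A -> lam A = (vol A)%:E.
Proof.
by move=> bA; rewrite /vol fineK// ge0_fin_numE ?lebesgue_rV_bounded// lebesgue_rV_ge0.
Qed.

Lemma sub_bounded A B : A `<=` B -> bounded B -> bounded A.
Proof. by move=> AB [r Br]; exists r => x /AB/Br. Qed.

Lemma bounded_eball u r : bounded (eball u r).
Proof.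
exists (enorm u + r) => x xur; rewrite -(subrK u x) addrC.
by apply: le_trans (enormD _ _) _; rewrite lerD2l.
Qed.

Lemma boundedU A B : bounded A -> bounded B -> bounded (A `|` B).
Proof.
move=> [r Ar] [s Bs]; exists (Num.max r s) => x [/Ar|/Bs] h; rewrite le_max h ?orbT//.
Qed.

Lemma bounded_translate u A : bounded A -> bounded [set x | A (x + u)].
Proof.
move=> [r Ar]; exists (r + enorm u) => x /Ar h; rewrite -(addrK u x).
by apply: le_trans (enormD _ _) _; rewrite enormN lerD2r.
Qed.

Lemma le_vol A B : A `<=` B -> bounded B -> vol A <= vol B.
Proof.
move=> AB bB; have bA := sub_bounded AB bB.
by rewrite -lee_fin -!volE//; exact: le_lebesgue_rV.
Qed.

Lemma volU_le A B : bounded A -> bounded B -> vol (A `|` B) <= vol A + vol B.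
Proof.
move=> bA bB; rewrite -lee_fin EFinD -!volE//; last exact: boundedU.
exact: outer_measureU2.
Qed.

Lemma vol_split A B : bounded A -> lebesgue_measurable B ->
  vol A = vol (A `&` B) + vol (A `\` B).
Proof.
move=> bA mB; apply: EFin_inj.
have b1 : bounded (A `&` B) by apply: sub_bounded bA => x [].
have b2 : bounded (A `\` B) by apply: sub_bounded bA => x [].
by rewrite EFinD -!volE// setDE; exact: mB.
Qed.

Lemma vol_translate u A : vol [set x | A (x + u)] = vol A.
Proof. by rewrite /vol lebesgue_rV_translate. Qed.

(** Stable under sums, products and translations, and integrable: a class in
    which integrals can be manipulated without side conditions. *)
Definition testfun f := [/\ measurable_fun [set: T] f,
  exists M : R, forall x, `|f x| <= M & bounded [set x | f x != 0]].

Definition integ f : R := Rintegral mu setT f.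

Lemma testfun_integrable f : testfun f -> mu.-integrable setT (EFin \o f).
Proof.
move=> [mf [M fM] [r fr]].
have mB : measurable (eball 0 r : set T) by exact: measurable_eball.
have : mu.-integrable (eball 0 r : set T) (EFin \o f).
  apply: measurable_bounded_integrable => //.
  - apply: lebesgue_rV_bounded; exact: bounded_eball.
  - exact: measurable_funTS.
  - exists M; split; first exact: num_real.
    by move=> N MN x _; apply: le_trans (fM x) (ltW MN).
move/integrable_mkcond => /(_ mB); apply: eq_integrable => // x _.
rewrite patchE; case: ifPn => // /negP xr; apply/esym; congr EFin.
apply/eqP; apply: contrapT => /negP/fr h; apply: xr.
by rewrite inE/= /eball/= subr0.
Qed.

Lemma testfunD f g : testfun f -> testfun g -> testfun (fun x => f x + g x).
Proof.
move=> [mf [M fM] bf] [mg [N gN] bg]; split.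
- exact: measurable_funD.
- by exists (M + N) => x; apply: le_trans (ler_normD _ _) (lerD _ _).
- apply: sub_bounded (boundedU bf bg) => x /=.
  have [->|] := eqVneq (f x) 0; last by left.
  by rewrite add0r; right.
Qed.

Lemma testfunM f g : testfun f -> testfun g -> testfun (fun x => f x * g x).
Proof.
move=> [mf [M fM] bf] [mg [N gN] bg]; split.
- exact: measurable_funM.
- by exists (M * N) => x; rewrite normrM ler_pM.
- apply: sub_bounded bf => x /=.
  by apply: contra_neq => ->; rewrite mul0r.
Qed.

Lemma testfunZ (k : R) f : testfun f -> testfun (fun x => k * f x).
Proof.
move=> [mf [M fM] bf]; split.
- exact: measurable_funM.
- by exists (`|k| * M) => x; rewrite normrM ler_wpM2l.
- apply: sub_bounded bf => x /=.
  by apply: contra_neq => ->; rewrite mulr0.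
Qed.

Lemma testfun_translate u f : testfun f -> testfun (fun x => f (x + u)).
Proof.
move=> [mf [M fM] bf]; split.
- move=> _ Y mY; rewrite setTI.
  have := mf measurableT Y mY; rewrite setTI => h.
  exact: (measurable_translate u h).
- by exists M.
- exact: (bounded_translate u bf).
Qed.

Lemma testfun_indic A : lebesgue_measurable A -> bounded A ->
  testfun (\1_A : V -> R).
Proof.
move=> mA bA; split.
- exact: (@measurable_indic _ T R setT A mA).
- by exists 1 => x; rewrite indicE; case: (_ \in _); rewrite ?normr1 ?normr0.
- apply: sub_bounded bA => x /=; rewrite indicE.
  by case: (boolP (x \in A)) => [/set_mem//|_]; rewrite eqxx.
Qed.

Lemma testfun_sum X (s : seq X) (F : X -> V -> R) :
  (forall i, testfun (F i)) -> testfun (fun x => \sum_(i <- s) F i x).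
Proof.
move=> tF; elim: s => [|i s IH].
  rewrite (_ : (fun x => _) = (fun x => 0 * \1_(eball 0 0) x)).
    by apply/testfunZ/testfun_indic; [exact: measurable_eball|exact: bounded_eball].
  by apply/funext => x; rewrite big_nil mul0r.
rewrite (_ : (fun x => _) = (fun x => F i x + \sum_(j <- s) F j x)).
  exact: testfunD.
by apply/funext => x; rewrite big_cons.
Qed.

Lemma integD f g : testfun f -> testfun g -> integ (fun x => f x + g x) = integ f + integ g.
Proof. by move=> tf tg; apply: RintegralD => //; exact: testfun_integrable. Qed.

Lemma integZ (k : R) f : testfun f -> integ (fun x => k * f x) = k * integ f.
Proof. by move=> tf; apply: RintegralZl => //; exact: testfun_integrable. Qed.

Lemma integ_sum X (s : seq X) (F : X -> V -> R) : (forall i, testfun (F i)) ->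
  integ (fun x => \sum_(i <- s) F i x) = \sum_(i <- s) integ (F i).
Proof.
move=> tF; elim: s => [|i s IH].
  rewrite big_nil (_ : (fun x => _) = (fun x => 0 * \1_(eball 0 0) x)).
    rewrite integZ ?mul0r//.
    by apply/testfun_indic; [exact: measurable_eball|exact: bounded_eball].
  by apply/funext => x; rewrite big_nil mul0r.
rewrite (_ : (fun x => _) = (fun x => F i x + \sum_(j <- s) F j x)).
  by rewrite integD ?big_cons ?IH//; exact: testfun_sum.
by apply/funext => x; rewrite big_cons.
Qed.

Lemma integ_ge0 f : (forall x, 0 <= f x) -> 0 <= integ f.
Proof. by move=> f0; apply: Rintegral_ge0. Qed.

Lemma le_integ f g : testfun f -> testfun g -> (forall x, f x <= g x) -> integ f <= integ g.
Proof. by move=> tf tg fg; apply: le_Rintegral => //; exact: testfun_integrable. Qed.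

Lemma integ_indic A : lebesgue_measurable A -> integ (\1_A : V -> R) = vol A.
Proof. by move=> mA; rewrite /integ /Rintegral integral_indic// setIT. Qed.

Lemma integ_translate u f : testfun f -> integ (fun x => f (x + u)) = integ f.
Proof.
move=> tf; have [mf _ _] := tf.
pose phi (x : T) : T := (x : V) + u.
have mphi : measurable_fun setT phi.
  by move=> _ Y mY; rewrite setTI; exact: (measurable_translate u mY).
have itf := testfun_integrable (testfun_translate u tf).
rewrite /integ /Rintegral; congr fine.
have := @integral_pushforward _ _ T T R phi mphi mu setT (EFin \o f).
rewrite preimage_setT => h.
transitivity (\int[pushforward mu phi]_(y in setT) (EFin \o f) y)%E.
  by rewrite (h (proj2 (measurable_EFinP _ _) mf) itf measurableT).
apply: eq_measure_integral => A mA _; rewrite /pushforward.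
exact: (lebesgue_rV_translate u A).
Qed.

End Integral.

(** * Approximation by finitely many boxes *)

Section Boxes.
Variables (R : realType) (d : nat).
Local Notation V := 'rV[R]_d.+1.
Local Notation lam := (@lebesgue_rV R d.+1).
Implicit Types (A B X : set V) (u x y a b : V) (bs : seq (V * V)).

Lemma measurable_box a b : lebesgue_measurable (box a b).
Proof.
rewrite measurableE.
have -> : box a b = \bigcap_(i in [set: 'I_d.+1]) [set x : V | a 0 i <= x 0 i <= b 0 i].
  by apply/seteqP; split => [x xab i _|x xab i]; apply: xab.
apply: fin_bigcap_measurable => // i _.
have -> : [set x : V | a 0 i <= x 0 i <= b 0 i] =
    (fun x : V => x 0 i) @^-1` `[a 0 i, b 0 i]%classic.
  by apply/seteqP; split => x /=; rewrite in_itv.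
rewrite -[X in measurable X]setTI.
by apply: (measurable_coord i) => //; exact: measurable_itv.
Qed.

Lemma bounded_box a b : bounded (box a b).
Proof.
exists (\sum_i (`|a 0 i| + `|b 0 i|)) => x xab.
apply: le_trans (enorm_le_sum _) _; apply: ler_sum => i _.
have /andP[h1 h2] := xab i; rewrite ler_norml.
have := ler_norm (- a 0 i); have := ler_norm (b 0 i); rewrite normrN.
have := normr_ge0 (a 0 i); have := normr_ge0 (b 0 i); lra.
Qed.

(** The box with corners [p.1] and [p.2], moved outwards by [h]. *)
Definition enlarge (h : R) (p : V * V) : set V :=
  box (p.1 - const_mx h) (p.2 + const_mx h).

(** The shells decrease to the empty set as [h] tends to [0]. *)
Lemma enlarge_box_small p (eps : R) : 0 < eps ->
  exists2 h, 0 < h & vol (enlarge h p `\` enlarge 0 p) <= eps.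
Proof.
move=> eps0.
pose S (k : nat) : set V := enlarge k.+1%:R^-1 p `\` enlarge 0 p.
have mS k : lebesgue_measurable (S k).
  by apply: lebesgue_measurableD; exact: measurable_box.
have Scap : \bigcap_k S k = set0.
  rewrite -subset0 => x xS; have [] := xS 0%N I => _; apply => i.
  have key (c : R) : (forall k : nat, c <= k.+1%:R^-1) -> c <= 0.
    move=> ck; rewrite leNgt; apply/negP => c0.
    have := ck (Num.truncn c^-1); rewrite leNgt => /negP; apply.
    by rewrite invf_plt ?posrE//; exact: truncnS_gt.
  rewrite !mxE subr0 addr0; apply/andP; split.
    rewrite -subr_le0; apply: key => k; have [/(_ i)] := xS k I.
    by rewrite !mxE => /andP[h _] _; rewrite lerBlDr addrC -lerBlDr.
  rewrite -subr_le0; apply: key => k; have [/(_ i)] := xS k I.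
  by rewrite !mxE => /andP[_ h] _; rewrite lerBlDl.
have bS k : bounded (S k).
  by apply: sub_bounded (bounded_box (p.1 - const_mx k.+1%:R^-1) (p.2 + const_mx k.+1%:R^-1)) => x [].
pose om := lebesgue_outer R d.
pose mu : {measure set (caratheodory_type om) -> \bar R} := (om : set (caratheodory_type om) -> \bar R).
have : mu \o S @ \oo --> mu (\bigcap_k S k).
  apply: nonincreasing_cvg_mu => //.
  - exact: lebesgue_rV_bounded.
  - by rewrite Scap; exact: measurable0.
  - move=> m n mn; apply/subsetPset => x [xn nx]; split => // i.
    have := xn i; rewrite !mxE => /andP[h1 h2].
    have : n.+1%:R^-1 <= m.+1%:R^-1 :> R by rewrite lef_pV2 ?posrE// ler_nat.
    by move: h1 h2; move: (n.+1%:R^-1) (m.+1%:R^-1) => s t *; apply/andP; split; lra.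
rewrite Scap measure0 => /fine_cvgP[_] /cvgr0_norm_le /(_ _ eps0)[N _ NP].
exists N.+1%:R^-1 => //.
by apply: le_trans (ler_norm _) (NP N (leqnn N)).
Qed.

Definition boxes bs (h : R) : set V := [set x | exists2 p, p \in bs & enlarge h p x].

Lemma boxes_cons p bs h : boxes (p :: bs) h = enlarge h p `|` boxes bs h.
Proof.
apply/seteqP; split => [x [q]|x [xp|[q qbs xq]]].
- by rewrite in_cons => /predU1P[->|qbs] xq; [left|right; exists q].
- by exists p => //; rewrite mem_head.
- by exists q => //; rewrite in_cons qbs orbT.
Qed.

Lemma boxes_nil h : boxes [::] h = set0.
Proof. by apply/seteqP; split => // x []. Qed.

Lemma measurable_boxes bs h : lebesgue_measurable (boxes bs h).
Proof.
elim: bs => [|p bs IH]; first by rewrite boxes_nil; exact: lebesgue_measurable0.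
by rewrite boxes_cons; apply: lebesgue_measurableU => //; exact: measurable_box.
Qed.

Lemma bounded_boxes bs h : bounded (boxes bs h).
Proof.
elim: bs => [|p bs IH]; first by rewrite boxes_nil; exists 0.
by rewrite boxes_cons; apply: boundedU => //; exact: bounded_box.
Qed.

Lemma le_enlarge p h h' : h <= h' -> enlarge h p `<=` enlarge h' p.
Proof.
by move=> hh x xh i; have := xh i; rewrite !mxE => /andP[h1 h2]; apply/andP; split; lra.
Qed.

Lemma le_boxes bs h h' : h <= h' -> boxes bs h `<=` boxes bs h'.
Proof. by move=> hh x [p pbs xp]; exists p => //; exact: le_enlarge xp. Qed.

Lemma boxes_shell_small bs (eps : R) : 0 < eps ->
  exists2 h, 0 < h & vol (boxes bs h `\` boxes bs 0) <= eps.
Proof.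
elim: bs eps => [|p bs IH] eps eps0.
  by exists 1 => //; rewrite !boxes_nil set0D /vol lebesgue_rV0/= ltW.
have e2 : 0 < eps / 2 by rewrite divr_gt0.
have [h1 h10 H1] := enlarge_box_small p e2.
have [h2 h20 H2] := IH _ e2.
exists (Num.min h1 h2); first by rewrite lt_min h10.
have b1 : bounded (enlarge h1 p `\` enlarge 0 p).
  by apply: sub_bounded (bounded_box (p.1 - const_mx h1) (p.2 + const_mx h1)) => x [].
have b2 : bounded (boxes bs h2 `\` boxes bs 0).
  by apply: sub_bounded (bounded_boxes bs h2) => x [].
have -> : eps = eps / 2 + eps / 2 by field.
apply: le_trans (lerD H1 H2); apply: le_trans (volU_le b1 b2).
apply: le_vol; last exact: boundedU.
rewrite !boxes_cons => x [[xp|xb] nx].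
  left; split; last by move=> ?; apply: nx; left.
  by apply: le_enlarge xp; rewrite ge_min lexx.
right; split; last by move=> ?; apply: nx; right.
by apply: le_boxes xb; rewrite ge_min lexx orbT.
Qed.

(** A near-optimal cover of [X] by boxes, truncated to finitely many. *)
Lemma boxes_approximation X (eps : R) : lebesgue_measurable X -> bounded X ->
  0 < eps -> exists bs, vol (X `\` boxes bs 0) <= eps /\ vol (boxes bs 0 `\` X) <= eps.
Proof.
move=> mX bX eps0.
have Xfin : (lam X \is a fin_num)%E by rewrite (volE bX).
have [_ [a [b [ab Xab ->]]] Slt] := lb_ereal_inf_adherent eps0 Xfin.
rewrite -/(lam X) (volE bX) -EFinD in Slt.
pose v k : \bar R := (box_volume (a k) (b k))%:E.
have v0 k : (0 <= v k)%E by rewrite lee_fin box_volume_ge0.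
have Soo : (\sum_(0 <= k <oo) v k < +oo)%E by apply: lt_trans Slt (ltry _).
have := @nneseries_tail_cvg R v xpredT Soo (fun k _ => v0 k).
move=> /fine_cvgP[[N1 _ N1P]] /cvgr0_norm_le /(_ _ eps0)[N2 _ N2P].
pose N := maxn N1 N2.
have tail : (\sum_(N <= k <oo) v k <= eps%:E)%E.
  rewrite -[leLHS]fineK ?lee_fin; last by apply: N1P; rewrite /= leq_maxl.
  by apply: le_trans (ler_norm _) (N2P _ _); rewrite /= leq_maxr.
pose bs := [seq (a k, b k) | k <- iota 0 N].
have enl0 k : enlarge 0 (a k, b k) = box (a k) (b k).
  apply/seteqP; split => x xk i; have := xk i; by rewrite !mxE subr0 addr0.
exists bs; split.
  rewrite -lee_fin -volE; last by apply: sub_bounded bX => x [].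
  apply: le_trans tail.
  apply: (@le_trans _ _ (\sum_(N <= k <oo) lam (box (a k) (b k)))%E); last first.
    apply: lee_nneseries => k _; first by move=> _; exact: lebesgue_rV_ge0.
    exact: lebesgue_rV_box_le.
  apply: le_trans (outer_measure_sigma_subadditive_tail (lebesgue_outer R d) N _).
  apply: le_lebesgue_rV => x [/Xab[k _ xk] nx]; exists k => //= kN; apply: nx.
  exists (a k, b k); last by rewrite enl0.
  by apply/mapP; exists k => //; rewrite mem_iota add0n.
pose G := \bigcup_k box (a k) (b k).
have GX : (lam (G `\` X) < eps%:E)%E.
  have : (lam G < (vol X + eps)%:E)%E.
    apply: le_lt_trans Slt.
    apply: le_trans (outer_measure_sigma_subadditive (lebesgue_outer R d) _) _.
    apply: lee_nneseries => k _; first by move=> _; exact: lebesgue_rV_ge0.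
    exact: lebesgue_rV_box_le.
  rewrite (mX G) (_ : G `&` X = X); last by apply/setIidPr.
  by rewrite (volE bX) EFinD lteD2lE// -setDE.
rewrite -lee_fin -volE; last by apply: sub_bounded (bounded_boxes bs 0) => x [].
apply: le_trans (ltW GX); apply: le_lebesgue_rV => x [[p /mapP[k _ ->]]].
by rewrite enl0 => xk nx; split => //; exists k.
Qed.

(** A translation by less than [h] carries a union of boxes into its
    enlargement by [h]. *)
Lemma vol_translate_continuous X (eps : R) : lebesgue_measurable X -> bounded X ->
  0 < eps -> exists2 h, 0 < h & forall u, enorm u <= h ->
    vol ([set x | X (x + u)] `\` X) <= eps.
Proof.
move=> mX bX eps0; have e3 : 0 < eps / 3 by rewrite divr_gt0.
have [bs [XF FX]] := boxes_approximation mX bX e3.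
have [h h0 Fh] := boxes_shell_small bs e3.
exists h => // u uh; set F := boxes bs 0 in XF FX Fh.
have b1 : bounded [set x | (X `\` F) (x + u)].
  by apply: bounded_translate; apply: sub_bounded bX => x [].
have b2 : bounded (boxes bs h `\` F).
  by apply: sub_bounded (bounded_boxes bs h) => x [].
have b3 : bounded (F `\` X).
  by apply: sub_bounded (bounded_boxes bs 0) => x [].
have -> : eps = eps / 3 + eps / 3 + eps / 3 by field.
rewrite -(vol_translate u) in XF.
apply: le_trans (lerD (lerD XF Fh) FX).
apply: le_trans (lerD (volU_le b1 b2) (lexx _)).
apply: le_trans (volU_le (boundedU b1 b2) b3).
apply: le_vol; last exact/boundedU/b3/boundedU.
move=> x [/= Xxu nX].
have [Fxu|nFxu] := pselect (F (x + u)); last by left; left.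
have [Fx|nFx] := pselect (F x); first by right.
left; right; split => //.
have [p pbs xp] := Fxu; exists p => // i; have := xp i; rewrite !mxE.
by have := enorm_coord u i; rewrite ler_norml; lra.
Qed.

End Boxes.

(** * Approximation by grid cells *)

Section Grid.
Variables (R : realType) (d : nat).
Local Notation V := 'rV[R]_d.+1.
Local Notation C := 'rV[int]_d.+1.
Implicit Types (A B X : set V) (u x y z : V) (c : C) (L : seq C).

Section Cells.
Variable s : R.
Hypothesis s0 : 0 < s.

(** The half-open cubes of side [s] with corners in the lattice of step [s]
    partition the space; a cube is named by the integer coordinates of its
    corner. *)
Definition cell_index x : C := \row_i Num.floor (x 0 i / s).
Definition cell c : set V := [set x | cell_index x = c].
Definition lattice c : V := \row_i (s * (c 0 i)%:~R).

Lemma cell_index_lattice x c : cell_index (x + lattice c) = cell_index x + c.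
Proof.
apply/rowP => i; rewrite !mxE mulrDl [s * _]mulrC mulfK ?gt_eqF//.
by rewrite floorDrz ?intr_int// intrKfloor.
Qed.

Lemma cell_index_bounds x i :
  (cell_index x 0 i)%:~R * s <= x 0 i < ((cell_index x 0 i)%:~R + 1) * s.
Proof.
have /andP[h1 h2] := floor_itv (x 0 i / s).
rewrite !mxE -ler_pdivlMr// h1/= -ltr_pdivrMr//.
by rewrite -[1]/(1%:~R) -intrD.
Qed.

Lemma measurable_cell c : lebesgue_measurable (cell c).
Proof.
rewrite measurableE.
have -> : cell c = \bigcap_(i in [set: 'I_d.+1])
    (fun x : V => x 0 i) @^-1` `[(c 0 i)%:~R * s, ((c 0 i)%:~R + 1) * s[%classic.
  apply/seteqP; split => [x <- i _ /=|x xc].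
    by rewrite in_itv/=; exact: cell_index_bounds.
  apply/rowP => i; rewrite mxE; apply: floor_def.
  have := xc i I; rewrite /= in_itv/= => /andP[h1 h2].
  by rewrite ler_pdivlMr// h1/= ltr_pdivrMr// intrD.
apply: fin_bigcap_measurable => // i _.
rewrite -[X in measurable X]setTI.
by apply: (measurable_coord i) => //; exact: measurable_itv.
Qed.

Lemma enorm_cell x y : cell_index x = cell_index y -> enorm (x - y) <= d.+1%:R * s.
Proof.
move=> xy; apply: le_trans (enorm_le_sum _) _.
rewrite mulr_natl -[in leRHS](card_ord d.+1) -sumr_const; apply: ler_sum => i _.
have := cell_index_bounds x i; have := cell_index_bounds y i; rewrite xy !mxE.
rewrite ler_norml mulrDl mul1r => /andP[? ?] /andP[? ?]; apply/andP; split; lra.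
Qed.

Lemma bounded_cell c : bounded (cell c).
Proof.
have [[y yc]|nc] := pselect (exists y, cell c y); last first.
  by exists 0 => x xc; exfalso; apply: nc; exists x.
exists (enorm y + d.+1%:R * s) => x xc.
have -> : x = y + (x - y) by rewrite addrC subrK.
apply: le_trans (enormD _ _) _; rewrite lerD2l; apply: enorm_cell.
by rewrite xc yc.
Qed.

Lemma vol_cell c : vol (cell c) = vol (cell 0).
Proof.
rewrite -(vol_translate (lattice c)); congr vol.
apply/seteqP; split => x; rewrite /cell/= cell_index_lattice.
  by move=> h; apply: (addIr c); rewrite h add0r.
by move=> ->; rewrite add0r.
Qed.

Definition cells L : set V := [set x | cell_index x \in L].

Lemma measurable_cells L : lebesgue_measurable (cells L).
Proof.
elim: L => [|c L IH].
  by rewrite (_ : cells _ = set0) ?subset0//; [exact: lebesgue_measurable0|apply/seteqP; split].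
rewrite (_ : cells _ = cell c `|` cells L).
  by apply: lebesgue_measurableU => //; exact: measurable_cell.
by apply/seteqP; split => x; rewrite /cells/= in_cons; [move=> /predU1P|move=> h; apply/predU1P].
Qed.

Lemma bounded_cells L : bounded (cells L).
Proof.
elim: L => [|c L IH]; first by exists 0.
apply: sub_bounded (boundedU (bounded_cell c) IH) => x.
by rewrite /cells/= in_cons => /predU1P.
Qed.

Lemma sum_indic_cells A L x : uniq L ->
  \sum_(c <- L) \1_(A `&` cell c) x = \1_(A `&` cells L) x :> R.
Proof.
move=> uL.
have -> : \sum_(c <- L) \1_(A `&` cell c) x =
    \1_A x * \sum_(c <- L) (cell_index x == c)%:R :> R.
  rewrite mulr_sumr; apply: eq_bigr => c _; rewrite !indicE in_setI.
  rewrite -mulnb natrM; congr (_ * (nat_of_bool _)%:R).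
  by apply/idP/eqP => [/set_mem//|h]; exact/mem_set.
rewrite !indicE in_setI -mulnb natrM; congr (_ * _).
rewrite (_ : (x \in cells L) = (cell_index x \in L)); last first.
  by apply/idP/idP => [/set_mem//|h]; exact/mem_set.
rewrite -(count_uniq_mem _ uL) -sum1_count natr_sum [RHS]big_mkcond/=.
by apply: eq_bigr => c _; rewrite eq_sym; case: eqP.
Qed.

Lemma sum_vol_cells A L : lebesgue_measurable A -> bounded A -> uniq L ->
  \sum_(c <- L) vol (A `&` cell c) = vol (A `&` cells L).
Proof.
move=> mA bA uL.
have mc c : lebesgue_measurable (A `&` cell c).
  by apply: lebesgue_measurableI => //; exact: measurable_cell.
rewrite -integ_indic; last by apply: lebesgue_measurableI => //; exact: measurable_cells.
under [LHS]eq_bigr do rewrite -integ_indic//.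
rewrite -integ_sum; last first.
  by move=> c; apply: testfun_indic => //; apply: sub_bounded bA => x [].
by congr integ; apply/funext => x; exact: sum_indic_cells.
Qed.

End Cells.

Definition grid (k : nat) : seq C :=
  [seq (\row_i ((f i : nat)%:Z - k%:Z) : C) | f : {ffun 'I_d.+1 -> 'I_(2 * k).+1}].

Lemma uniq_grid k : uniq (grid k).
Proof.
rewrite map_inj_uniq ?enum_uniq// => f g /rowP fg.
apply/ffunP => i; have := fg i; rewrite !mxE => /addIr/eqP.
by rewrite eqz_nat => /eqP/val_inj.
Qed.

Lemma mem_grid k c : (forall i, `|c 0 i| <= k%:Z) -> c \in grid k.
Proof.
move=> ck; have cf i : (absz (c 0 i + k%:Z)%R < (2 * k).+1)%N.
  have := ck i; rewrite ler_norml; lia.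
apply/mapP; exists [ffun i => Ordinal (cf i)]; first by rewrite mem_enum.
apply/rowP => i; rewrite mxE ffunE /=.
by have := ck i; rewrite ler_norml; lia.
Qed.

Lemma bounded_sub_cells A s : 0 < s -> bounded A ->
  exists k, A `<=` cells s (grid k).
Proof.
move=> s0 [r Ar].
exists (Num.truncn (r / s)).+2 => x /Ar xr; apply: mem_grid => i.
set k := Num.truncn _.
have kr : r < k.+1%:R * s by rewrite -ltr_pdivrMr//; exact: truncnS_gt.
have := le_trans (enorm_coord x i) xr; rewrite ler_norml => /andP[x1 x2].
have /andP[c1 c2] := cell_index_bounds s0 x i.
set m := cell_index s x 0 i in c1 c2 *.
have m1 : m%:~R < k.+1%:~R :> R.
  by rewrite -(ltr_pM2r s0); apply: le_lt_trans c1 (le_lt_trans x2 kr).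
have m2 : (- (k.+2%:Z))%:~R < m%:~R :> R.
  rewrite -(ltr_pM2r s0) rmorphN/= mulNr.
  have -> : k.+2%:~R = k.+1%:R + 1 :> R by rewrite natr1.
  move: c2 kr; rewrite !mulrDl !mul1r; lra.
by move: m1 m2; rewrite !ltr_int ler_norml => ? ?; apply/andP; split; lia.
Qed.

(** A quantitative Lebesgue density theorem. Approximate [X] by a finite union
    of boxes [G], and let [U] be a slight enlargement of [G]. On a fine grid,
    a cell that meets [G] is contained in [U]; if [X] does not nearly fill it,
    then [U `\` X] occupies a definite proportion of it. Since [U `\` X] has
    small volume, so have all such cells together. *)
Lemma full_cells X (eps kap smax : R) : lebesgue_measurable X -> bounded X ->
  0 < eps -> 0 < kap <= 1 -> 0 < smax ->
  exists s F, [/\ 0 < s <= smax, lebesgue_measurable F, bounded F,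
    vol (X `\` F) <= eps & forall x, F x ->
    (1 - kap) * vol (cell s 0) <= vol (X `&` cell s (cell_index s x))].
Proof.
move=> mX bX eps0 /andP[kap0 kap1] smax0.
pose e1 := eps * kap / 3; have e10 : 0 < e1 by rewrite divr_gt0// mulr_gt0.
have [bs [XG GX]] := boxes_approximation mX bX e10.
have [h h0 Gh] := boxes_shell_small bs e10.
set G := boxes bs 0 in XG GX Gh; set U := boxes bs h in Gh.
pose s := Num.min smax (h / d.+1%:R).
have s0 : 0 < s by rewrite lt_min smax0 divr_gt0.
have sh : d.+1%:R * s <= h.
  rewrite mulrC -ler_pdivlMr// /s ge_min lexx orbT//.
have [k Xk] := bounded_sub_cells s0 bX.
pose good c := (1 - kap) * vol (cell s 0) <= vol (X `&` cell s c).
pose L := [seq c <- grid k | good c].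
have uk := uniq_grid k.
exists s, (cells s L); split.
- by rewrite s0 /s ge_min lexx.
- exact: measurable_cells.
- exact: bounded_cells.
- have mU : lebesgue_measurable U by exact: measurable_boxes.
  have mG : lebesgue_measurable G by exact: measurable_boxes.
  have mF := measurable_cells s0 L.
  have bXF : bounded (X `\` cells s L) by apply: sub_bounded bX => x [].
  have bXG : bounded (X `\` G) by apply: sub_bounded bX => x [].
  have bUX : bounded (U `\` X) by apply: sub_bounded (bounded_boxes bs h) => x [].
  have bUG : bounded (U `\` G) by apply: sub_bounded (bounded_boxes bs h) => x [].
  have bGX : bounded (G `\` X) by apply: sub_bounded (bounded_boxes bs 0) => x [].
  have mXF : lebesgue_measurable (X `\` cells s L) by exact: lebesgue_measurableD.
  have mXG : lebesgue_measurable (X `\` G) by exact: lebesgue_measurableD.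
  have mUX : lebesgue_measurable (U `\` X) by exact: lebesgue_measurableD.
  have bI A c : bounded (A `&` cell s c) by apply: sub_bounded (bounded_cell s0 c) => x [].
  have percell c : vol ((X `\` cells s L) `&` cell s c) <=
      vol ((X `\` G) `&` cell s c) + kap^-1 * vol ((U `\` X) `&` cell s c).
    have rhs0 : 0 <= kap^-1 * vol ((U `\` X) `&` cell s c).
      by rewrite mulr_ge0 ?vol_ge0// invr_ge0 ltW.
    have [gc|ngc] := boolP (good c).
      apply: (@le_trans _ _ 0); last by rewrite addr_ge0// vol_ge0.
      rewrite (_ : _ `&` _ = set0) ?/vol ?lebesgue_rV0// -subset0 => x [[Xx nx] xc].
      apply: nx; rewrite /cells /= mem_filter xc gc /=.
      by have := Xk _ Xx; rewrite /cells /= xc.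
    have [[y [Gy yc]]|nG] := pselect (exists y, G y /\ cell s c y); last first.
      apply: (@le_trans _ _ (vol ((X `\` G) `&` cell s c))); last by rewrite lerDl.
      apply: le_vol => // x [[Xx _] xc]; split => //; split => // Gx.
      by apply: nG; exists x.
    have cU : cell s c `<=` U.
      move=> x xc; have [p pbs yp] := Gy; exists p => // i.
      have := enorm_coord (x - y) i.
      have := @enorm_cell s s0 x y (etrans xc (esym yc)).
      have := yp i; rewrite !mxE ler_norml; lra.
    apply: (@le_trans _ _ (kap^-1 * vol ((U `\` X) `&` cell s c))); last first.
      by rewrite lerDr vol_ge0.
    have := @vol_split _ _ (cell s c) X (bounded_cell s0 c) mX.
    rewrite (vol_cell s0 c) setIC.
    have -> : cell s c `\` X = (U `\` X) `&` cell s c.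
      by apply/seteqP; split => x [] => [xc nx|[_ nx] xc]; split => //; split => //; exact: cU.
    have : vol ((X `\` cells s L) `&` cell s c) <= vol (X `&` cell s c).
      by apply: le_vol => // x [[]].
    move: ngc; rewrite /good -ltNge.
    have := vol_ge0 (cell s 0).
    move: (vol (cell s 0)) (vol (X `&` cell s c)) (vol ((U `\` X) `&` cell s c))
      (vol (_ `&` cell s c)) => v0 p q w v00 pv wp e.
    rewrite mulrC ler_pdivlMr//; nra.
  have -> : vol (X `\` cells s L) = \sum_(c <- grid k) vol ((X `\` cells s L) `&` cell s c).
    rewrite (sum_vol_cells s0)//; congr vol; apply/esym/setIidPl => x [/Xk//].
  apply: le_trans (ler_sum _ (fun c _ => percell c)) _.
  rewrite big_split/= -mulr_sumr !(sum_vol_cells s0)//.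
  have h1 : vol ((X `\` G) `&` cells s (grid k)) <= e1.
    by apply: le_trans XG; apply: le_vol => // x [].
  have h2 : vol ((U `\` X) `&` cells s (grid k)) <= 2 * e1.
    rewrite mulrDl mul1r; apply: le_trans (lerD Gh GX).
    apply: le_trans (volU_le bUG bGX); apply: le_vol; last exact: boundedU.
    move=> x [[Ux nX] _]; have [Gx|nG] := pselect (G x); [by right|by left].
  have h3 : kap^-1 * vol ((U `\` X) `&` cells s (grid k)) <= kap^-1 * (2 * e1).
    by rewrite ler_wpM2l// invr_ge0 ltW.
  have -> : eps = eps / 3 + kap^-1 * (2 * e1) by rewrite /e1; field; rewrite gt_eqF.
  apply: lerD h3; apply: le_trans h1 _; rewrite /e1; nra.
- by move=> x; rewrite /cells /= mem_filter => /andP[].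
Qed.

End Grid.

(** * Volumes of balls and upper density *)

Section Density.
Variables (R : realType) (d : nat).
Local Notation V := 'rV[R]_d.+1.
Local Notation lam := (@lebesgue_rV R d.+1).
Implicit Types (A E X : set V) (u x y z : V).

Lemma vol_eball u (r : R) : 0 < r -> vol (eball u r) = r ^+ d.+1 * vol (eball (0 : V) 1).
Proof.
move=> r0; apply: EFin_inj; rewrite EFinM -!volE; try exact: bounded_eball.
rewrite (lebesgue_rV_affine u _ r0); congr (_ * lam _)%E.
apply/funext => y; apply/propext; rewrite /eball/= addrK subr0 enormZ gtr0_norm//.
by rewrite -ler_pdivlMl// mulVf// gt_eqF.
Qed.

Lemma bounded_capr A u (r : R) : bounded (A `&` eball u r).
Proof. by apply: sub_bounded (bounded_eball u r) => x []. Qed.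

Lemma le_vol_cap A u (r : R) : vol (A `&` eball u r) <= vol (eball u r).
Proof. by apply: le_vol => [x []//|]; exact: bounded_eball. Qed.

(** What the density provides: an upper bound on all balls that are large
    enough, and almost equality on some balls as large as one likes. The
    positivity of the volume of the unit ball comes for free: otherwise all
    quotients in the definition of the density would vanish. *)
Lemma density_facts E (theta : R) : 0 <= theta ->
  (theta%:E < upper_banach_density E)%E ->
  exists delta : R, [/\ theta < delta <= 1, 0 < vol (eball (0 : V) 1),
    (forall eps, 0 < eps -> exists2 R0, 0 < R0 & forall r x, R0 <= r ->
       vol (E `&` eball x r) <= (delta + eps) * vol (eball x r)) &
    (forall eps R1, 0 < eps -> exists r x, [/\ R1 <= r, 0 < r &
       (delta - eps) * vol (eball x r) <= vol (E `&` eball x r)])].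
Proof.
move=> theta0 hE.
pose q (r : R) (x : V) : \bar R := (lam (E `&` eball x r) / lam (eball x r))%E.
pose f (r : R) : \bar R := ereal_sup [set q r x | x in [set: V]].
have DE : upper_banach_density E = ereal_inf [set ereal_sup (f @` A) | A in (+oo : set_system R)] by [].
have tail (M : R) : (+oo : set_system R) [set r | M < r] by exists M; split; rewrite ?num_real.
have ub (M : R) : (upper_banach_density E <= ereal_sup (f @` [set r | (M < r)%R]))%E.
  by rewrite DE; apply: ereal_inf_lbound; exists [set r | M < r].
have w0 : 0 < vol (eball (0 : V) 1).
  rewrite lt_neqAle vol_ge0 andbT; apply/negP => /eqP w0.
  have := lt_le_trans hE (ub 0); apply/negP; rewrite -leNgt.
  apply: (@le_trans _ _ 0%E); last by rewrite lee_fin.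
  apply: ge_ereal_sup => _ [r /= r0 <-]; apply: ge_ereal_sup => _ [x _ <-].
  rewrite /q (volE (bounded_capr E x r)).
  have -> : vol (E `&` eball x r) = 0; last by rewrite mul0e.
  apply/eqP; rewrite eq_le vol_ge0 andbT.
  by apply: le_trans (le_vol_cap E x r) _; rewrite (vol_eball x r0) -w0 mulr0.
have vb x (r : R) : 0 < r -> 0 < vol (eball x r).
  by move=> r0; rewrite vol_eball// mulr_gt0// exprn_gt0.
have qE r x : 0 < r -> q r x = (vol (E `&` eball x r) / vol (eball x r))%:E.
  move=> r0; rewrite /q (volE (bounded_capr E x r)) (volE (bounded_eball x r)).
  by rewrite inver gt_eqF ?vb.
have D1 : (upper_banach_density E <= 1)%E.
  apply: le_trans (ub 0) _; apply: ge_ereal_sup => _ [r /= r0 <-].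
  apply: ge_ereal_sup => _ [x _ <-]; rewrite (qE _ _ r0) lee_fin ler_pdivrMr ?vb//.
  by rewrite mul1r le_vol_cap.
have Dfin : upper_banach_density E \is a fin_num.
  rewrite fin_numE; apply/andP; split; apply/eqP => e.
    by rewrite e in hE.
  by rewrite e in D1.
pose delta := fine (upper_banach_density E).
have dE : upper_banach_density E = delta%:E by rewrite fineK.
exists delta; split => //.
- by rewrite -lte_fin -dE hE/= -lee_fin -dE.
- move=> eps eps0.
  have [_ [A [M [_ MA]] <-]] := lb_ereal_inf_adherent eps0 Dfin.
  rewrite -DE dE -EFinD => sA.
  exists (Num.max M 0 + 1); first by rewrite ltr_wpDl// le_max lexx orbT.
  move=> r x rM.
  have [Mr r0] : M < r /\ 0 < r.
    have : M <= Num.max M 0 by rewrite le_max lexx.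
    have : 0 <= Num.max M 0 by rewrite le_max lexx orbT.
    by split; lra.
  rewrite -ler_pdivrMr ?vb// -lee_fin -qE//; apply: ltW; apply: le_lt_trans sA.
  apply: (@le_trans _ _ (f r)); first by apply: ereal_sup_ubound; exists x.
  by apply: ereal_sup_ubound; exists r => //; exact: MA.
- move=> eps R1 eps0.
  have : ((delta - eps)%:E < ereal_sup (f @` [set r | (Num.max R1 0 < r)%R]))%E.
    by apply: lt_le_trans (ub _); rewrite dE lte_fin ltrBlDr ltrDl.
  move=> /ereal_sup_gt[_ [r /= rM <-]] /ereal_sup_gt[_ [x _ <-]] h.
  move: rM; rewrite gt_max => /andP[R1r r0].
  exists r, x; split => //; first exact: ltW.
  by rewrite -ler_pdivlMr ?vb// -lee_fin -qE//; exact: ltW.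
Qed.

End Density.

(** * The autocorrelation of the balanced indicator *)

Section Autocorrelation.
Variables (R : realType) (d : nat).
Local Notation V := 'rV[R]_d.+1.
Implicit Types (A B E X : set V) (u x y z : V) (f g h : V -> R).

Lemma integ_abs_le f h : testfun f -> testfun h -> (forall x, `|f x| <= h x) ->
  `|integ f| <= integ h.
Proof.
move=> tf th fh; rewrite ler_norml; apply/andP; split; last first.
  by apply: le_integ => // x; apply: le_trans (ler_norm _) (fh x).
rewrite -mulN1r -(integZ (-1) th); apply: (le_integ (testfunZ (-1) th) tf) => x.
by have := fh x; rewrite ler_norml mulN1r => /andP[].
Qed.

Lemma testfun_mean (Y : seq V) f : testfun f ->
  testfun (fun z => mean Y (fun y => f (z + y))).
Proof.
move=> tf; rewrite (_ : (fun z => _) =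
    fun z => (size Y)%:R^-1 * \sum_(y <- Y) f (z + y)).
  by apply: testfunZ; apply: testfun_sum => y; exact: testfun_translate.
by apply/funext => z; rewrite /mean mulrC.
Qed.

Lemma integ_mean (Y : seq V) f : (0 < size Y)%N -> testfun f ->
  integ (fun z => mean Y (fun y => f (z + y))) = integ f.
Proof.
move=> Y0 tf; rewrite (_ : (fun z => _) =
    fun z => (size Y)%:R^-1 * \sum_(y <- Y) f (z + y)).
  have tfy y : testfun (fun z => f (z + y)) by exact: testfun_translate.
  rewrite (integZ _ (testfun_sum Y tfy)) (integ_sum _ tfy).
  under eq_bigr do rewrite integ_translate//.
  rewrite big_const_seq count_predT iter_addr_0 -[integ f *+ _]mulr_natl mulKf//.
  by rewrite pnatr_eq0 -lt0n.
by apply/funext => z; rewrite /mean mulrC.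
Qed.

(** Normalised so that a function supported on [B] and bounded by [1] has value
    at most [1] at [0]. *)
Definition autocorr g B u : R := integ (fun z => g z * g (z + u)) / vol B.

Section Normalised.
Variables (g : V -> R) (B : set V).
Hypotheses (tg : testfun g) (mB : lebesgue_measurable B) (bB : bounded B).
Hypotheses (B0 : 0 < vol B) (gB : forall x, `|g x| <= \1_B x).

Let tgu u : testfun (fun z => g (z + u)). Proof. exact: (testfun_translate u tg). Qed.

Lemma autocorr_sub x y :
  autocorr g B (x - y) = integ (fun z => g (z + x) * g (z + y)) / vol B.
Proof.
rewrite /autocorr -(integ_translate y); last exact: testfunM.
congr (integ _ / _); apply/funext => z.
by rewrite mulrC -addrA (addrC y) subrK.
Qed.

(** The energy is indeed the normalised square norm of the averages of [g]. *)
Lemma energy_autocorr Y :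
  energy (autocorr g B) Y = integ (fun z => mean Y (fun y => g (z + y)) ^+ 2) / vol B.
Proof.
pose n : R := (size Y)%:R.
have -> : (fun z => mean Y (fun y => g (z + y)) ^+ 2) = fun z =>
    (n ^+ 2)^-1 * \sum_(x <- Y) \sum_(y <- Y) g (z + x) * g (z + y).
  apply/funext => z; rewrite /mean -/n expr_div_n mulrC; congr (_ * _).
  by rewrite expr2 mulr_suml; apply: eq_bigr => x _; rewrite mulr_sumr.
have t2 x y : testfun (fun z => g (z + x) * g (z + y)) by exact: testfunM.
have t1 x : testfun (fun z => \sum_(y <- Y) g (z + x) * g (z + y)).
  exact: testfun_sum.
rewrite integZ; last exact: testfun_sum.
rewrite integ_sum//; under [in RHS]eq_bigr do rewrite integ_sum//.
rewrite /energy /cross /mean -/n -mulr_suml.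
set S := (X in _ = _ * X / _).
have -> : \sum_(x <- Y) \sum_(y <- Y) autocorr g B (x - y) = S / vol B.
  rewrite mulr_suml; apply: eq_bigr => x _; rewrite mulr_suml.
  by apply: eq_bigr => y _; exact: autocorr_sub.
by rewrite expr2 invfM; ring.
Qed.

Lemma autocorr_autocorrelation : autocorrelation (autocorr g B).
Proof.
split.
- move=> u; rewrite -sub0r autocorr_sub /autocorr; congr (integ _ / _).
  by apply/funext => z; rewrite addr0.
- move=> l.
  have t2 p q : testfun (fun z => p.1 * q.1 * (g (z + p.2) * g (z + q.2))) .
    by apply: testfunZ; exact: testfunM.
  have -> : \sum_(p <- l) \sum_(q <- l) p.1 * q.1 * autocorr g B (p.2 - q.2) =
     integ (fun z => (\sum_(p <- l) p.1 * g (z + p.2)) ^+ 2) / vol B.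
    have -> : (fun z => (\sum_(p <- l) p.1 * g (z + p.2)) ^+ 2) = fun z =>
        \sum_(p <- l) \sum_(q <- l) p.1 * q.1 * (g (z + p.2) * g (z + q.2)).
      apply/funext => z; rewrite expr2 mulr_suml; apply: eq_bigr => p _.
      by rewrite mulr_sumr; apply: eq_bigr => q _; ring.
    rewrite integ_sum; last by move=> p; exact: testfun_sum.
    rewrite mulr_suml; apply: eq_bigr => p _; rewrite integ_sum// mulr_suml.
    by apply: eq_bigr => q _; rewrite autocorr_sub (integZ _ (testfunM (tgu _) (tgu _))) mulrA.
  by rewrite divr_ge0 ?vol_ge0//; apply: integ_ge0 => z; exact: sqr_ge0.
- rewrite /autocorr ler_pdivrMr// mul1r -integ_indic//; apply: le_integ.
  + exact: testfunM.
  + exact: testfun_indic.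
  move=> z; apply: le_trans (ler_norm _) _; rewrite normrM addr0.
  have := gB z; rewrite indicE; case: (z \in B) => /= h; last by have := normr_ge0 (g z); nra.
  by have := normr_ge0 (g z); nra.
Qed.

Lemma autocorr_continuous (eps eta : R) :
  (forall u, enorm u <= eta -> exists2 h, testfun h /\ integ h <= eps * vol B &
     forall z, `|g (z + u) - g z| <= h z) ->
  tame eta eps (autocorr g B).
Proof.
move=> gu; split; first by move=> x; exact: autocorrelation_norm_le1 autocorr_autocorrelation _.
move=> u y /gu[k [tk Jk] kP].
rewrite /autocorr -mulrBl normrM normfV (gtr0_norm B0) ler_pdivrMr//.
have tz w : testfun (fun z => g z * g (z + w)) by exact: testfunM.
have -> : integ (fun z => g z * g (z + (u + y))) - integ (fun z => g z * g (z + u)) =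
   integ (fun z => g z * g (z + (u + y)) + (-1) * (g z * g (z + u))).
  by rewrite (integD (tz _) (testfunZ (-1) (tz _))) (integZ _ (tz _)) mulN1r.
apply: le_trans Jk; rewrite -(integ_translate u tk); apply: integ_abs_le.
- exact: (testfunD (tz _) (testfunZ (-1) (tz _))).
- exact: testfun_translate.
move=> z; rewrite mulN1r -mulrBr normrM addrA.
apply: le_trans (kP (z + u)); apply: ler_piMl => //.
by apply: le_trans (gB z) _; rewrite indicE; case: (_ \in _).
Qed.

End Normalised.

(** The deviation of the set [X] from its expected density [delta] in [B]. *)
Definition balanced (delta : R) X B : V -> R := fun z => \1_X z - delta * \1_B z.

Lemma testfun_balanced delta X B : lebesgue_measurable X -> lebesgue_measurable B ->
  bounded X -> bounded B -> testfun (balanced delta X B).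
Proof.
move=> mX mB bX bB.
have -> : balanced delta X B = fun z => \1_X z + (- delta) * \1_B z.
  by apply/funext => z; rewrite mulNr.
by apply: testfunD; [exact: testfun_indic|apply: testfunZ; exact: testfun_indic].
Qed.

Lemma balanced_le delta X B z : 0 <= delta <= 1 -> X `<=` B ->
  `|balanced delta X B z| <= \1_B z.
Proof.
move=> /andP[d0 d1] XB; rewrite /balanced !indicE.
case: (boolP (z \in B)) => zB.
  by case: (z \in X); rewrite /= mulr1 ler_norml; apply/andP; split; lra.
rewrite (_ : z \in X = false) ?mulr0 ?subr0 ?normr0//.
by apply: contraNF zB => /set_mem/XB zB; exact/mem_set.
Qed.

(** The change of the balanced indicator under a small translation is dominated
    by the indicators of four thin sets. *)
Lemma balanced_translate delta X B (eps : R) : 0 <= delta <= 1 ->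
  lebesgue_measurable X -> lebesgue_measurable B -> bounded X -> bounded B ->
  0 < eps -> exists2 eta, 0 < eta & forall u, enorm u <= eta ->
    exists2 h, testfun h /\ integ h <= eps &
    forall z, `|balanced delta X B (z + u) - balanced delta X B z| <= h z.
Proof.
move=> /andP[d0 d1] mX mB bX bB eps0; have e4 : 0 < eps / 4 by rewrite divr_gt0.
have [h1 h10 H1] := vol_translate_continuous mX bX e4.
have [h2 h20 H2] := vol_translate_continuous mB bB e4.
exists (Num.min h1 h2); first by rewrite lt_min h10.
move=> u; rewrite le_min => /andP[uh1 uh2].
pose S1 A : set V := [set z | A (z + u)] `\` A.
pose S2 A : set V := A `\` [set z | A (z + u)].
have mS1 A : lebesgue_measurable A -> lebesgue_measurable (S1 A).
  by move=> mA; apply: lebesgue_measurableD => //; exact: measurable_translate.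
have mS2 A : lebesgue_measurable A -> lebesgue_measurable (S2 A).
  by move=> mA; apply: lebesgue_measurableD => //; exact: measurable_translate.
have bS1 A : bounded A -> bounded (S1 A).
  by move=> bA; apply: sub_bounded (bounded_translate u bA) => x [].
have bS2 A : bounded A -> bounded (S2 A).
  by move=> bA; apply: sub_bounded bA => x [].
have vS2 A hA : (forall u, enorm u <= hA -> vol ([set z | A (z + u)] `\` A) <= eps / 4) ->
    enorm u <= hA -> vol (S2 A) <= eps / 4.
  move=> H uh; rewrite -(vol_translate (- u)).
  apply: le_trans (H (- u) _); last by rewrite enormN.
  rewrite le_eqVlt; apply/orP; left; apply/eqP; congr vol.
  by apply/seteqP; split => z [/= a b]; split => //; move: b; rewrite /= subrK.
pose k z : R := (\1_(S1 X) z + \1_(S2 X) z) + (\1_(S1 B) z + \1_(S2 B) z).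
have tS1X : testfun (\1_(S1 X) : V -> R) by apply: testfun_indic; [exact: mS1|exact: bS1].
have tS2X : testfun (\1_(S2 X) : V -> R) by apply: testfun_indic; [exact: mS2|exact: bS2].
have tS1B : testfun (\1_(S1 B) : V -> R) by apply: testfun_indic; [exact: mS1|exact: bS1].
have tS2B : testfun (\1_(S2 B) : V -> R) by apply: testfun_indic; [exact: mS2|exact: bS2].
have tX := testfunD tS1X tS2X; have tB := testfunD tS1B tS2B.
exists k; [split|].
- exact: (testfunD tX tB).
- rewrite /k (integD tX tB) (integD tS1X tS2X) (integD tS1B tS2B).
  rewrite (integ_indic (mS1 _ mX)) (integ_indic (mS2 _ mX)) (integ_indic (mS1 _ mB)) (integ_indic (mS2 _ mB)).
  have := H1 u uh1; have := H2 u uh2; have := vS2 X h1 H1 uh1; have := vS2 B h2 H2 uh2.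
  rewrite /S1; lra.
- move=> z; rewrite /balanced /k.
  have key A : `|\1_A (z + u) - \1_A z| <= \1_(S1 A) z + \1_(S2 A) z :> R.
    rewrite /S1 /S2 !indicE !in_setD.
    rewrite (_ : (z \in [set z0 | A (z0 + u)]) = (z + u \in A)); last first.
      by apply/idP/idP => /set_mem h; exact/mem_set.
    by case: (z + u \in A); case: (z \in A) => /=; rewrite ?subrr ?subr0 ?sub0r ?normrN ?normr0 ?normr1 ?addr0 ?add0r.
  have -> : \1_X (z + u) - delta * \1_B (z + u) - (\1_X z - delta * \1_B z) =
     (\1_X (z + u) - \1_X z) - delta * (\1_B (z + u) - \1_B z) :> R by ring.
  apply: le_trans (ler_normB _ _) (lerD (key X) _).
  rewrite normrM ger0_norm//; apply: le_trans (key B).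
  by rewrite ler_piMl.
Qed.

End Autocorrelation.

(** * Small averages at a bounded scale *)

Section SmallAverages.
Variables (R : realType) (d : nat).
Local Notation V := 'rV[R]_d.+1.
Implicit Types (A B E X : set V) (u x y z : V).

Lemma bernoulli_le (t : R) m : 0 <= t <= 1 -> 1 - m%:R * t <= (1 - t) ^+ m.
Proof.
move=> /andP[t0 t1]; elim: m => [|m IH]; first by rewrite mul0r subr0 expr0.
rewrite exprS -natr1; apply: (@le_trans _ _ ((1 - t) * (1 - m%:R * t))).
  have : 0 <= m%:R * t * t by rewrite !mulr_ge0.
  lra.
by rewrite ler_wpM2l// subr_ge0.
Qed.

(** The boundary losses of cells of relative size [t] in a ball are absorbed by
    one more [eps]. *)
Lemma shrink_exists (delta eps : R) n : 0 <= delta <= 1 -> 0 < eps <= 1 ->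
  exists2 t, 0 < t < 1 &
    (delta + eps) * (1 + t) ^+ n <= (delta + 2 * eps) * ((1 - t) * (1 - t) ^+ n).
Proof.
move=> /andP[d0 d1] /andP[e0 e1].
pose m := (2 * n).+1; have m0 : 0 < m%:R :> R by rewrite ltr0n.
pose t := eps / (3 * m%:R).
have tm : m%:R * t = eps / 3 by rewrite /t; field; rewrite gt_eqF.
have t0 : 0 < t by rewrite divr_gt0// mulr_gt0.
have t1 : t < 1.
  have : 1 * t <= m%:R * t by rewrite ler_pM2r// ler1n.
  by rewrite tm mul1r; lra.
exists t; first by rewrite t0.
have q0 : 0 < (1 - t) ^+ n by rewrite exprn_gt0// subr_gt0.
rewrite -(ler_pM2r q0) -!mulrA -exprMn.
have : (1 - t) * ((1 - t) ^+ n * (1 - t) ^+ n) = (1 - t) ^+ m.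
  by rewrite -exprD -exprS addnn -mul2n.
move=> ->.
have h1 : ((1 + t) * (1 - t)) ^+ n <= 1.
  apply: exprn_ile1; first by rewrite mulr_ge0; lra.
  have := sqr_ge0 t; lra.
have h2 := @bernoulli_le t m (ltac:(by rewrite (ltW t0) (ltW t1))).
rewrite tm in h2.
apply: (@le_trans _ _ ((delta + eps) * 1)).
  by rewrite ler_wpM2l// addr_ge0// ltW.
apply: (@le_trans _ _ ((delta + 2 * eps) * (1 - eps / 3))); last first.
  by rewrite ler_wpM2l// addr_ge0// mulr_ge0// ltW.
nra.
Qed.

(** The lattice of step [s] samples the set [F] of cells that [X] nearly fills:
    [z + y] is in [F] only if [X] nearly fills the cell of [z + y]. These cells
    are disjoint and contained in a ball around [z] slightly larger than [R0],
    so the average of the indicator of [F] over lattice points exceeds the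
    density of [X] in that ball by a factor close to [1] at most. *)
Lemma lattice_averages_le X (R0 delta eps e : R) :
  lebesgue_measurable X -> bounded X -> 0 < vol (eball (0 : V) 1) -> 0 < R0 ->
  0 <= delta <= 1 -> 0 < eps <= 1 -> 0 < e ->
  (forall r x, R0 <= r -> vol (X `&` eball x r) <= (delta + eps) * vol (eball x r)) ->
  exists Y F, [/\ (0 < size Y)%N, forall y, y \in Y -> enorm y <= R0,
    lebesgue_measurable F /\ bounded F, vol (X `\` F) <= e &
    forall z, mean Y (fun y => \1_F (z + y)) <= delta + 2 * eps].
Proof.
move=> mX bX w0 R00 hd he e0 dens.
have [t /andP[t0 t1] tP] := shrink_exists d.+1 hd he.
have smax0 : 0 < t * R0 / d.+1%:R by rewrite divr_gt0// mulr_gt0.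
have tt : 0 < t <= 1 by rewrite t0 ltW.
have [s [F [/andP[s0 ss] mF bF XF FP]]] := full_cells mX bX e0 tt smax0.
have ns : d.+1%:R * s <= t * R0 by rewrite mulrC -ler_pdivlMr.
have bR0 : bounded (eball (0 : V) R0) by exact: bounded_eball.
have [k kP] := bounded_sub_cells s0 bR0.
pose L := [seq c <- grid d k | enorm (lattice s c : V) <= R0].
have uL : uniq L by rewrite filter_uniq// uniq_grid.
pose v0 := vol (cell s 0 : set V).
pose P := R0 ^+ d.+1 * vol (eball (0 : V) 1).
have P0 : 0 < P by rewrite mulr_gt0// exprn_gt0.
have t1' : 0 < 1 - t by rewrite subr_gt0.
have ci0 : cell_index s (0 : V) = 0.
  by apply/rowP => i; rewrite !mxE mul0r floor0.
have cil c : cell_index s (lattice s c : V) = c.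
  by rewrite -[lattice s c]add0r cell_index_lattice// ci0 add0r.
have Lv0 : (1 - t) ^+ d.+1 * P <= (size L)%:R * v0.
  have r0 : 0 < R0 * (1 - t) by rewrite mulr_gt0.
  have -> : (1 - t) ^+ d.+1 * P = vol (eball (0 : V) (R0 * (1 - t))).
    by rewrite vol_eball// exprMn /P; ring.
  have -> : (size L)%:R * v0 = \sum_(c <- L) v0.
    by rewrite big_const_seq count_predT iter_addr_0 mulr_natl.
  have -> : vol (eball (0 : V) (R0 * (1 - t))) =
      \sum_(c <- L) vol (eball (0 : V) (R0 * (1 - t)) `&` cell s c).
    rewrite sum_vol_cells//; [|exact: measurable_eball|exact: bounded_eball].
    congr vol; apply/esym/setIidPl => x; rewrite /eball /= subr0 => xr.
    rewrite /cells/= mem_filter; apply/andP; split.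
      set c := cell_index s x.
      have -> : lattice s c = x + (lattice s c - x) by rewrite addrC subrK.
      apply: le_trans (enormD _ _) _.
      have : enorm (lattice s c - x) <= t * R0.
        by apply: le_trans (enorm_cell s0 _) ns; rewrite cil.
      lra.
    apply: kP; rewrite /eball /= subr0; apply: le_trans xr _.
    by rewrite ger_pMr// gerBl ltW.
  apply: ler_sum => c _; rewrite /v0 -(vol_cell s0 c).
  by apply: le_vol => [x []//|]; exact: bounded_cell.
have LvP : 0 < (size L)%:R * v0.
  by apply: lt_le_trans Lv0; rewrite mulr_gt0// exprn_gt0.
have v00 : 0 < v0.
  by rewrite lt_neqAle vol_ge0 andbT; apply: contraTneq LvP => <-; rewrite mulr0 ltxx.
have sL : 0 < (size L)%:R :> R by rewrite -(pmulr_lgt0 _ v00).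
exists [seq lattice s c | c <- L], F; split => //.
- by rewrite size_map -(ltr0n R).
- by move=> y /mapP[c]; rewrite mem_filter => /andP[h _] ->.
move=> z; rewrite mean_map /mean ler_pdivrMr//.
set S := \sum_(c <- L) _.
have : (1 - t) * v0 * S <= (delta + eps) * ((1 + t) ^+ d.+1 * P).
  have r0 : 0 < R0 * (1 + t) by rewrite mulr_gt0// addr_gt0.
  have -> : (1 + t) ^+ d.+1 * P = vol (eball z (R0 * (1 + t))).
    by rewrite vol_eball// exprMn /P; ring.
  apply: le_trans (dens (R0 * (1 + t)) z _); last by rewrite ler_peMr ?ltW//; lra.
  pose L' := [seq cell_index s z + c | c <- L].
  have uL' : uniq L' by rewrite map_inj_uniq//; exact: addrI.
  apply: (@le_trans _ _ (vol (X `&` cells s L'))); last first.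
    apply: le_vol; last exact: bounded_capr.
    move=> x [Xx /mapP[c cL xc]]; split => //; rewrite /eball /=.
    have -> : x - z = (x - (z + lattice s c)) + lattice s c.
      by rewrite opprD addrA subrK.
    apply: le_trans (enormD _ _) _.
    have : enorm (x - (z + lattice s c)) <= t * R0.
      by apply: le_trans (enorm_cell s0 _) ns; rewrite cell_index_lattice.
    move: cL; rewrite mem_filter => /andP[]; lra.
  rewrite -sum_vol_cells// big_map mulr_sumr; apply: ler_sum => c _ /=.
  rewrite indicE; case: (boolP (z + lattice s c \in F)) => [/set_mem/FP|_]; last first.
    by rewrite mulr0 vol_ge0.
  by rewrite cell_index_lattice// mulr1.
move=> h.
have tv : 0 < (1 - t) * v0 by rewrite mulr_gt0.
rewrite -(ler_pM2l tv); apply: le_trans h _.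
apply: (@le_trans _ _ ((delta + 2 * eps) * ((1 - t) * (1 - t) ^+ d.+1) * P)).
  by rewrite mulrA ler_pM2r.
have -> : (1 - t) * v0 * ((delta + 2 * eps) * (size L)%:R) =
   (delta + 2 * eps) * (1 - t) * ((size L)%:R * v0) by ring.
rewrite -!mulrA mulrA [leRHS]mulrA ler_wpM2l//.
by rewrite mulr_ge0 ?(ltW t1')// addr_ge0 ?mulr_ge0//; case/andP: hd he => ? _ /andP[/ltW].
Qed.

(** The averages [Phi g] of the balanced indicator over the lattice points of a
    ball of radius [R0] are bounded above by a function [pos] with small
    integral, because the density of [E] in large balls hardly exceeds [delta];
    and their own integral is not much below zero, because [X] has density
    nearly [delta] in [B]. Hence [|Phi g| <= 2 pos - Phi g] has a small
    integral. *)
Lemma small_energy_exists E x0 (M R0 delta eps : R) :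
  lebesgue_measurable E -> 0 < vol (eball (0 : V) 1) -> 0 < R0 -> R0 < M ->
  0 <= delta <= 1 -> 0 < eps <= 1 ->
  (forall r x, R0 <= r -> vol (E `&` eball x r) <= (delta + eps) * vol (eball x r)) ->
  (delta - eps) * vol (eball x0 M) <= vol (E `&` eball x0 M) ->
  vol (eball x0 (M + R0)) - vol (eball x0 (M - R0)) <= eps * vol (eball x0 M) ->
  let B := eball x0 M in let X := E `&` B in
  exists Y, [/\ (0 < size Y)%N, forall y, y \in Y -> enorm y <= R0 &
    energy (autocorr (balanced delta X B) B) Y <= 9 * eps].
Proof.
move=> mE w0 R00 RM hd he dens XB ann B X.
have M0 : 0 < M by apply: lt_trans RM.
have [d0 d1] := andP hd; have [e0 e1] := andP he.
have mB : lebesgue_measurable B by exact: measurable_eball.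
have bB : bounded B by exact: bounded_eball.
have mX : lebesgue_measurable X by exact: lebesgue_measurableI.
have bX : bounded X by exact: bounded_capr.
have B0 : 0 < vol B by rewrite /B vol_eball// mulr_gt0// exprn_gt0.
have eB : 0 < eps * vol B by rewrite mulr_gt0.
have densX r x : R0 <= r -> vol (X `&` eball x r) <= (delta + eps) * vol (eball x r).
  move=> Rr; apply: le_trans (dens r x Rr); apply: le_vol; last exact: bounded_capr.
  by move=> y [[]].
have [Y [F [Y0 YR [mF bF] XF YF]]] :=
  lattice_averages_le mX bX w0 R00 hd he eB densX.
exists Y; split => //.
have tX : testfun (\1_X : V -> R) by exact: testfun_indic.
have tB : testfun (\1_B : V -> R) by exact: testfun_indic.
set g := balanced delta X B.
have tg : testfun g by exact: testfun_balanced.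
rewrite energy_autocorr// ler_pdivrMr//.
pose W := X `\` F.
have mW : lebesgue_measurable W by exact: lebesgue_measurableD.
have bW : bounded W by apply: sub_bounded bX => x [].
have tW : testfun (\1_W : V -> R) by exact: testfun_indic.
pose N := eball x0 (M + R0) `\` eball x0 (M - R0).
have mN : lebesgue_measurable N by apply: lebesgue_measurableD; exact: measurable_eball.
have bN : bounded N by apply: sub_bounded (bounded_eball x0 (M + R0)) => x [].
have tN : testfun (\1_N : V -> R) by exact: testfun_indic.
have vN : vol N <= eps * vol B.
  apply: le_trans ann.
  have := @vol_split _ _ (eball x0 (M + R0)) (eball x0 (M - R0)) (bounded_eball _ _)
    (measurable_eball _ _).
  rewrite (_ : _ `&` _ = eball x0 (M - R0)); last first.
    by apply/setIidPr => x; rewrite /eball/= => /le_trans; apply; lra.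
  by move=> ->; rewrite addrC addKr.
pose Phi f z := mean Y (fun y => f (z + y)) : R.
have tPhi f : testfun f -> testfun (Phi f) by exact: testfun_mean.
have JPhi f : testfun f -> integ (Phi f) = integ f by exact: integ_mean.
have g1 z : `|g z| <= 1.
  apply: le_trans (balanced_le z hd _) _; first by move=> x [].
  by rewrite indicE; case: (_ \in _).
have Phi1 z : `|Phi g z| <= 1 by exact: mean_abs_le.
(* The second term accounts for the part of [X] outside of the cells that it
   nearly fills, the third one for the boundary of [B]. *)
pose pos z := 2 * eps * \1_B z + Phi \1_W z + \1_N z.
have PhiW0 z : 0 <= Phi \1_W z by exact: mean_ge0.
have pos0 z : 0 <= pos z.
  by rewrite /pos addr_ge0// addr_ge0// !mulr_ge0 ?(ltW e0)//.
have tpos : testfun pos.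
  exact: (testfunD (testfunD (testfunZ _ tB) (tPhi _ tW)) tN).
have Phipos z : Phi g z <= pos z.
  have [zN|] := boolP (z \in N).
    apply: le_trans (le_trans (ler_norm _) (Phi1 z)) _.
    rewrite /pos [\1_N z]indicE zN lerDr addr_ge0// !mulr_ge0 ?(ltW e0)//.
  move=> zN; have [zM|zM] := leP (enorm (z - x0)) (M - R0).
    have zyB y : y \in Y -> z + y \in B.
      move=> /YR yR; apply/mem_set; rewrite /B /eball/= addrAC.
      by apply: le_trans (enormD _ _) _; lra.
    have zB : z \in B by apply/mem_set; rewrite /B /eball/=; lra.
    have -> : Phi g z = Phi \1_X z - delta.
      rewrite /Phi /g /balanced meanB; congr (_ - _).
      apply: etrans (mean_cst delta Y0); apply: eq_mean_in => y /zyB yB.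
      by rewrite indicE yB mulr1.
    have : Phi \1_X z <= Phi \1_F z + Phi \1_W z.
      rewrite /Phi -meanD; apply: le_mean => y; rewrite /W !indicE in_setD.
      by case: (z + y \in X); case: (z + y \in F) => //=; lra.
    have : 0 <= \1_N z :> R by [].
    have := YF z; rewrite -/(Phi \1_F z) /pos [\1_B z]indicE zB mulr1; lra.
  have zMR : M + R0 < enorm (z - x0).
    rewrite ltNge; apply: contra zN => h; apply/mem_set; split => //.
    by rewrite /eball/=; apply/negP; rewrite -ltNge.
  have -> : Phi g z = 0; last exact: pos0.
  apply: etrans (mean_cst 0 Y0); apply: eq_mean_in => y /YR yR; apply/eqP.
  rewrite -normr_le0; apply: le_trans (balanced_le _ hd _) _; first by move=> x [].
  rewrite indicE; case: (boolP (_ \in _)) => // /set_mem; rewrite /B /eball/= => h.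
  exfalso; move: zMR; rewrite ltNge => /negP; apply.
  have -> : z - x0 = (z + y - x0) - y by rewrite addrAC addrK.
  by apply: le_trans (enormD _ _) _; rewrite enormN lerD.
apply: (@le_trans _ _ (integ (fun z => 2 * pos z + (-1) * Phi g z))).
  apply: le_integ.
  - rewrite (_ : (fun z => _) = fun z => Phi g z * Phi g z).
      by apply: testfunM; exact: tPhi.
    by apply/funext => z; rewrite expr2.
  - exact: (testfunD (testfunZ 2 tpos) (testfunZ (-1) (tPhi _ tg))).
  move=> z; rewrite -/(Phi g z).
  have := Phi1 z; rewrite ler_norml; have := Phipos z; have := pos0 z.
  move: (Phi g z) (pos z) => a b; rewrite expr2; nra.
rewrite (integD (testfunZ 2 tpos) (testfunZ (-1) (tPhi _ tg))) (integZ _ tpos) (integZ _ (tPhi _ tg)).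
rewrite (JPhi _ tg).
have -> : integ pos = 2 * eps * vol B + vol W + vol N.
  have t2 := testfunZ (2 * eps) tB; have tPW := tPhi _ tW.
  rewrite /pos (integD (testfunD t2 tPW) tN) (integD t2 tPW) (integZ _ tB) (JPhi _ tW).
  by rewrite (integ_indic mB) (integ_indic mW) (integ_indic mN).
have -> : integ g = vol X - delta * vol B.
  rewrite /g (_ : balanced _ _ _ = fun z => \1_X z + (- delta) * \1_B z).
    by rewrite (integD tX (testfunZ _ tB)) (integZ _ tB) (integ_indic mX) (integ_indic mB) mulNr.
  by apply/funext => z; rewrite mulNr.
move: XB vN XF; rewrite -/B -/X -/W; lra.
Qed.

End SmallAverages.

(** * Distances in a finite set *)

Section Distances.
Variables (R : realType) (d : nat).
Implicit Types (P : {fset 'rV[R]_d}) (x y v : 'rV[R]_d).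

Lemma enorm_SO (Q : 'M[R]_d) v : SO R d Q -> enorm (v *m Q) = enorm v.
Proof.
move=> [QQ _]; rewrite !enormE; congr Num.sqrt.
have : (dot (v *m Q) (v *m Q))%:M = (dot v v)%:M :> 'M[R]_1.
  by rewrite -!mulmx_tr_dot trmx_mul mulmxA -(mulmxA v) QQ mulmx1.
by move=> /matrixP/(_ 0 0); rewrite !mxE !mulr1n.
Qed.

Lemma le_diam P x y : x \in P -> y \in P -> x != y -> enorm (x - y) <= diam P.
Proof.
move=> xP yP xy.
apply: le_trans (@le_bigmax_seq _ R _ (enum_fset P) 0 x xpredT _ xP isT).
exact: (@le_bigmax_seq _ R _ (enum_fset P) 0 y (fun z => x != z)
  (fun z => enorm (x - z)) yP xy).
Qed.

Lemma ge_sep P x y : x \in P -> y \in P -> x != y -> sep P <= enorm (x - y).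
Proof.
move=> xP yP xy.
apply: (le_trans (@ge_bigmin_seq _ R _ (enum_fset P) _ x xpredT _ xP isT)).
exact: (@ge_bigmin_seq _ R _ (enum_fset P) _ y (fun z => x != z)
  (fun z => enorm (x - z)) yP xy).
Qed.

End Distances.

(** * Finding the pattern *)

Section Counting.
Variables (R : realType) (d : nat).
Local Notation V := 'rV[R]_d.+1.
Implicit Types (A B E X : set V) (u x y z : V).

(** The ratio of the volumes of concentric balls of radii [M + rho] and
    [M - rho] tends to [1] as [M] grows. *)
Lemma annulus_small (rho eps : R) : 0 < rho -> 0 < eps <= 1 ->
  exists R1, forall M x, R1 <= M -> rho < M /\
    vol (eball (x : V) (M + rho)) - vol (eball x (M - rho)) <= eps * vol (eball x M).
Proof.
move=> rho0 he; have /andP[e0 e1] := he.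
have [t /andP[t0 t1] tP] := shrink_exists d.+1 (ltac:(by rewrite ler01 lexx) : 0 <= 1 <= 1) he.
exists (rho / t) => M x; rewrite ler_pdivrMr// => rM.
have M0 : 0 < M by rewrite -(pmulr_lgt0 _ t0); exact: lt_le_trans rM.
have Mr : rho < M by apply: le_lt_trans rM _; rewrite gtr_pMr.
have Mp : 0 < M + rho by lra.
have Mm : 0 < M - rho by lra.
split => //; rewrite (vol_eball x Mp) (vol_eball x Mm) (vol_eball x M0).
rewrite mulrA -mulrBl; apply: ler_wpM2r; first exact: vol_ge0.
set n := d.+1 in tP *.
have q0 : 0 < (1 - t) ^+ n by rewrite exprn_gt0// subr_gt0.
have q1 : (1 - t) ^+ n <= 1 by rewrite exprn_ile1//; lra.
have p0 : 0 < (1 + t) ^+ n by rewrite exprn_gt0//; lra.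
have h1 : (M + rho) ^+ n <= M ^+ n * (1 + t) ^+ n.
  by rewrite -exprMn lerXn2r// ?nnegrE; nra.
have h2 : M ^+ n * (1 - t) ^+ n <= (M - rho) ^+ n.
  by rewrite -exprMn lerXn2r// ?nnegrE; nra.
have h3 : (1 + t) ^+ n - (1 - t) ^+ n <= eps.
  move: tP; move: ((1 + t) ^+ n) ((1 - t) ^+ n) p0 q0 q1 => a b a0 b0 b1 h.
  have : (1 - t) * b <= b by rewrite ler_piMl ?ltW//; lra.
  nra.
have : 0 < M ^+ n by rewrite exprn_gt0.
move: ((M + rho) ^+ n) ((M - rho) ^+ n) (M ^+ n) h1 h2 h3 => a b c h1 h2 h3 c0.
have : c * ((1 + t) ^+ n - (1 - t) ^+ n) <= c * eps by rewrite ler_pM2l.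
lra.
Qed.

(** Write [1_X = g + delta 1_B] in the inner average. The contribution of [g] is
    small by Young's inequality; that of [delta 1_B] is [delta] except near the
    boundary of [B]. *)
Lemma correlation_ge X x0 (M rho delta eps : R) (us : seq V) :
  let B := eball x0 M in
  lebesgue_measurable X -> X `<=` B -> 0 < vol B -> 0 <= delta <= 1 -> 0 < eps ->
  (0 < size us)%N -> (forall u, u \in us -> enorm u <= rho) ->
  vol (B `\` eball x0 (M - rho)) <= eps * vol B ->
  energy (autocorr (balanced delta X B) B) us <= eps ^+ 2 ->
  delta * vol X - 2 * eps * vol B <=
    integ (fun z => \1_X z * mean us (fun u => \1_X (z + u))).
Proof.
move=> B mX XB B0 hd e0 us0 usr Neps gus.
have /andP[d0 d1] := hd.
have mB : lebesgue_measurable B by exact: measurable_eball.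
have bB : bounded B by exact: bounded_eball.
have bX : bounded X by exact: sub_bounded bB.
set N := B `\` _ in Neps.
have mN : lebesgue_measurable N by apply: lebesgue_measurableD => //; exact: measurable_eball.
have bN : bounded N by apply: sub_bounded bB => x [].
have tX : testfun (\1_X : V -> R) by exact: testfun_indic.
have tN : testfun (\1_N : V -> R) by exact: testfun_indic.
set g := balanced delta X B in gus.
have tg : testfun g by exact: testfun_balanced.
pose G z := mean us (fun u => g (z + u)).
have tG : testfun G by exact: testfun_mean.
have JG : integ (fun z => G z * G z) <= eps ^+ 2 * vol B.
  rewrite (_ : (fun z => _) = fun z => G z ^+ 2); last first.
    by apply/funext => z; rewrite expr2.
  by move: gus; rewrite energy_autocorr// ler_pdivrMr.
(* Young's inequality [|G| <= eps / 2 + k G^2]. *)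
pose k := (2 * eps)^-1; have k0 : 0 < k by rewrite invr_gt0 mulr_gt0.
have ke : k * eps = 1 / 2 by rewrite /k; field; rewrite gt_eqF.
have tGG : testfun (fun z => G z * G z) by exact: (testfunM tG tG).
have t1 := testfunZ (delta - eps / 2) tX.
have t2 := testfunZ (- delta) tN.
have t3 := testfunZ (- k) tGG.
have t23 := testfunD t2 t3.
apply: (@le_trans _ _ (integ (fun z => (delta - eps / 2) * \1_X z +
    ((- delta) * \1_N z + (- k) * (G z * G z))))).
  rewrite (integD t1 t23) (integD t2 t3) (integZ _ tX) (integZ _ tN) (integZ _ tGG).
  rewrite (integ_indic mX) (integ_indic mN).
  have : k * integ (fun z => G z * G z) <= k * (eps ^+ 2 * vol B) by rewrite ler_pM2l.
  have -> : k * (eps ^+ 2 * vol B) = 1 / 2 * eps * vol B.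
    by rewrite expr2 -ke; ring.
  have : eps * vol X <= eps * vol B by rewrite ler_pM2l//; exact: le_vol.
  have : delta * vol N <= vol N by rewrite ler_piMl// vol_ge0.
  move: Neps; lra.
apply: (le_integ (testfunD t1 t23) (testfunM tX (testfun_mean us tX))) => z.
have -> : mean us (fun u => \1_X (z + u)) = G z + delta * mean us (fun u => \1_B (z + u)).
  by rewrite -meanZ -meanD; apply: eq_mean => u; rewrite /g /balanced subrK.
have y0 : 0 <= k * (eps + G z) ^+ 2 by rewrite mulr_ge0 ?sqr_ge0// ltW.
have y1 : k * (eps + G z) ^+ 2 = eps / 2 + G z + k * (G z * G z).
  rewrite sqrrD; transitivity (k * eps * eps + 2 * (k * eps) * G z + k * (G z * G z)).
    by ring.
  by rewrite ke; lra.
have y2 : 0 <= k * (G z * G z) by rewrite mulr_ge0 ?(ltW k0)// -expr2 sqr_ge0.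
rewrite [\1_X z]indicE; case: (boolP (z \in X)) => [/set_mem zX|_] /=; last first.
  have : 0 <= delta * \1_N z by rewrite mulr_ge0.
  by rewrite mul0r; lra.
rewrite mul1r.
suff h : 1 - \1_N z <= mean us (fun u => \1_B (z + u)) :> R.
  by move: (ler_wpM2l d0 h) y0 y1; lra.
have [zN|zN] := boolP (z \in N).
  by rewrite indicE zN subrr mean_ge0.
rewrite indicE (negPf zN) subr0 -(mean_cst 1 us0); apply: le_mean_in => u /usr ur.
rewrite indicE mem_set//=.
have zr : enorm (z - x0) <= M - rho.
  rewrite leNgt; apply: contra zN => h; apply/mem_set; split; first exact: XB.
  by rewrite /eball/=; apply/negP; rewrite -ltNge.
by rewrite /B /eball/= addrAC; apply: le_trans (enormD _ _) _; lra.
Qed.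

(** Pigeonhole: if for all [z] in [X] and all [Q] at least one of the
    conditions failed, the sum over [vs] of the correlations would be at most
    [((size vs)%:R - 1) * vol X]. *)
Lemma pattern_exists X (I : eqType) (T : eqType) (vs : seq I) (Qs : seq T)
    (phi : I -> T -> V) (c : R) :
  lebesgue_measurable X -> bounded X -> (0 < size vs)%N -> (0 < size Qs)%N ->
  (forall v, v \in vs ->
     c <= integ (fun z => \1_X z * mean [seq phi v Q | Q <- Qs] (fun u => \1_X (z + u)))) ->
  ((size vs)%:R - 1) * vol X < (size vs)%:R * c ->
  exists z Q, [/\ X z, Q \in Qs & forall v, v \in vs -> X (z + phi v Q)].
Proof.
move=> mX bX vs0 Qs0 Hc hlt; apply: contrapT => no.
have tX : testfun (\1_X : V -> R) by exact: testfun_indic.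
pose F v z := \1_X z * mean [seq phi v Q | Q <- Qs] (fun u => \1_X (z + u)) : R.
have tF v : testfun (F v) by exact: (testfunM tX (testfun_mean _ tX)).
move: hlt; apply/negP; rewrite -leNgt.
apply: (@le_trans _ _ (\sum_(v <- vs) integ (F v))).
  rewrite (_ : _ * c = \sum_(v <- vs) c); last first.
    by rewrite big_const_seq count_predT iter_addr_0 mulr_natl.
  by rewrite big_seq [leRHS]big_seq; apply: ler_sum => v; exact: Hc.
rewrite -integ_sum// -integ_indic// -integZ//; apply: le_integ.
- exact: testfun_sum.
- exact: testfunZ.
move=> z; rewrite /F -mulr_sumr [\1_X z]indicE.
case: (boolP (z \in X)) => [/set_mem zX|_] /=; last by rewrite mul0r mulr0.
rewrite mul1r mulr1.
under eq_bigr do rewrite mean_map.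
rewrite /mean -mulr_suml exchange_big/= mulrC.
rewrite -/(mean Qs (fun Q => \sum_(v <- vs) \1_X (z + phi v Q))).
rewrite mulrC -/(mean Qs (fun Q => \sum_(v <- vs) \1_X (z + phi v Q) : R)).
apply: le_trans (_ : mean Qs (fun=> (size vs)%:R - 1) <= _); last by rewrite mean_cst.
apply: le_mean_in => Q QQs.
have [v vvs vX] : exists2 v, v \in vs & z + phi v Q \notin X.
  apply: contrapT => h; apply: no; exists z, Q; split => // v vvs.
  apply/set_mem; apply: contrapT => /negP hv; apply: h; by exists v.
rewrite (big_rem v vvs)/= indicE (negPf vX) add0r.
apply: (@le_trans _ _ (\sum_(w <- rem v vs) 1)).
  by apply: ler_sum => w _; rewrite indicE; case: (_ \in _).
by rewrite big_const_seq count_predT iter_addr_0 size_rem// -subn1 natrB.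
Qed.

End Counting.

(** * Large dilates of finite sets *)

Theorem theorem1p4 (R : realType) (d n : nat) (hd : (2 <= d)%N)
  (hn : (2 <= n)%N) (E : set 'rV[R]_d) (mE : lebesgue_measurable E)
  (hE : (((n%:R - 2) / (n%:R - 1))%:E < upper_banach_density E)%E)
  (S D : R) (hS : 0 < S) (hSD : S <= D) :
  exists2 R0 : R, 0 < R0 &
    forall P : {fset 'rV[R]_d}, #|` P|%fset = n ->
      S <= sep P -> sep P <= diam P -> diam P <= D ->
      forall r : R, R0 <= r ->
        exists z : 'rV[R]_d, exists2 Q : 'M[R]_d, SO R d Q &
          [set r *: (x *m Q) + z | x in [set` P]] `<=` E.
Proof.
case: d hd E mE hE => [|[|d]]// _ E mE hE.
case: n hn hE => [|[|k]]// _ hE; pose m := k.+1; have m0 : 0 < m%:R :> R by rewrite ltr0n.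
have thetaE : (k.+2%:R - 2) / (k.+2%:R - 1) = (m%:R - 1) / m%:R :> R.
  by congr (_ / _); rewrite -natr1 -/m; lra.
rewrite {}thetaE in hE.
have theta0 : 0 <= (m%:R - 1) / m%:R :> R.
  by rewrite divr_ge0// ?(ltW m0)// subr_ge0 ler1n.
have [delta [/andP[td d1] w0 dsup dinf]] := density_facts theta0 hE.
have d0 : 0 < delta by exact: le_lt_trans td.
have hdelta : 0 <= delta <= 1 by rewrite ltW.
have D0 : 0 < D by exact: lt_le_trans hSD.
(* With [m] nonzero differences, the hypothesis on the density is [gamma > 0]. *)
pose gamma := m%:R * delta - (m%:R - 1).
have gamma0 : 0 < gamma by move: td; rewrite ltr_pdivrMr// /gamma; lra.
have m1 : 1 <= m%:R :> R by rewrite ler1n.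
have gamma1 : gamma <= 1 by rewrite /gamma; nra.
pose eps1 := gamma * delta / (4 * m%:R).
have m4 : 0 < 4 * m%:R :> R by rewrite mulr_gt0.
have e10 : 0 < eps1 by rewrite divr_gt0// mulr_gt0.
have e1m : 4 * m%:R * eps1 = gamma * delta by rewrite /eps1; field; rewrite gt_eqF.
have e11 : eps1 <= 1.
  by rewrite ler_pdivrMr// mul1r; nra.
have sq0 : 0 < eps1 ^+ 2 by rewrite exprn_gt0.
have [e4 [C [e40 C0 rotP]]] := rotations_decorrelate d hS D0 sq0.
pose eps2 := Num.min eps1 (e4 / 9).
have e20 : 0 < eps2 by rewrite lt_min e10 divr_gt0.
have e21 : eps2 <= eps1 by rewrite ge_min lexx.
have e24 : 9 * eps2 <= e4.
  have : eps2 <= e4 / 9 by rewrite ge_min lexx orbT.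
  lra.
have e2h : 0 < eps2 <= 1 by rewrite e20; exact: le_trans e11.
have [R0 R00 densP] := dsup _ e20.
exists (C * R0); first exact: mulr_gt0.
move=> P cP sepP _ diamP r rR.
have r0 : 0 < r by apply: lt_le_trans rR; exact: mulr_gt0.
have rD0 : 0 < r * D by exact: mulr_gt0.
have [x0 x0P] : exists x0, x0 \in P.
  by apply/fset0Pn; rewrite -cardfs_gt0 cP.
(* The pattern is anchored at one of its points. *)
pose vs := [seq x - x0 | x <- rem x0 (enum_fset P)].
have svs : size vs = m by rewrite size_map size_rem// -/(#|` P|%fset) cP.
have vsP v : v \in vs -> S <= enorm v <= D.
  move=> /mapP[x]; rewrite mem_rem_uniq ?fset_uniq// inE => /andP[xx0 xP] ->.
  by rewrite (le_trans sepP (ge_sep xP x0P xx0)) (le_trans (le_diam xP x0P xx0)).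
have [R1 R1P] := annulus_small d.+1 R00 e2h.
have e1h : 0 < eps1 <= 1 by rewrite e10.
have [R2 R2P] := annulus_small d.+1 rD0 e1h.
have [M [c [RM M0 XB]]] := dinf eps2 (Num.max R1 R2) e20.
move: RM; rewrite ge_max => /andP[/(R1P _ c)[R0M ann1] /(R2P _ c)[rDM ann2]].
pose B := eball c M; pose X := E `&` B.
have mB : lebesgue_measurable B by exact: measurable_eball.
have bB : bounded B by exact: bounded_eball.
have mX : lebesgue_measurable X by exact: lebesgue_measurableI.
have bX : bounded X by exact: bounded_capr.
have XsB : X `<=` B by move=> x [].
have B0 : 0 < vol B by rewrite /B vol_eball// mulr_gt0// exprn_gt0.
pose g := balanced delta X B.
have tg : testfun g by exact: testfun_balanced.
have gB z : `|g z| <= \1_B z by exact: balanced_le.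
have [Y [Y0 YR Yen]] := small_energy_exists mE w0 R00 R0M hdelta e2h densP XB ann1.
have tame_g om : 0 < om -> exists2 rho, 0 < rho & tame rho om (autocorr g B).
  move=> om0; have omB : 0 < om * vol B by exact: mulr_gt0.
  have [eta eta0 etaP] := balanced_translate hdelta mX mB bX bB omB.
  exists eta => //; exact: autocorr_continuous.
have [Qs [Qs0 QsSO Qen]] := rotP R0 R00 (autocorr g B)
  (autocorr_autocorrelation tg mB bB B0 gB) tame_g Y Y0 YR (le_trans Yen e24) r rR.
have shell : vol (B `\` eball c (M - r * D)) <= eps1 * vol B.
  apply: le_trans ann2.
  rewrite (vol_split (bounded_eball c (M + r * D)) (measurable_eball c (M - r * D))).
  rewrite (_ : _ `&` _ = eball c (M - r * D)); last first.
    by apply/setIidPr => x; rewrite /eball/= => /le_trans; apply; lra.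
  rewrite addrAC subrr add0r; apply: le_vol.
    by move=> x []; rewrite /B /eball/= => xM xN; split => //=; apply: le_trans xM _; lra.
  by apply: sub_bounded (bounded_eball c (M + r * D)) => x [].
have [z [Q [Xz QQs zQ]]] : exists z Q, [/\ X z, Q \in Qs &
    forall v, v \in vs -> X (z + r *: (v *m Q))].
  apply: (pattern_exists (phi := fun v Q => r *: (v *m Q))
    (c := delta * vol X - 2 * eps1 * vol B)) => //; first by rewrite svs.
    move=> v /vsP vSD; apply: (correlation_ge (rho := r * D)) => //.
    - by rewrite size_map.
    - move=> u /mapP[Q /QsSO QSO ->]; rewrite enormZ gtr0_norm// enorm_SO//.
      by rewrite ler_pM2l//; case/andP: vSD.
    - exact: Qen.
  rewrite svs -/m.
  have h : (delta - eps2) * vol B <= vol X by [].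
  have : gamma * ((delta - eps2) * vol B) <= gamma * vol X by rewrite ler_pM2l.
  have : gamma * (eps2 * vol B) <= 1 * (eps1 * vol B).
    by rewrite ler_pM// ?(ltW gamma0) ?mulr_ge0 ?ler_pM2r// ?ltW.
  have : 1 * (eps1 * vol B) <= m%:R * (eps1 * vol B) by rewrite ler_pM2r// mulr_gt0.
  have : 0 < m%:R * (eps1 * vol B) by rewrite mulr_gt0// mulr_gt0.
  have : 4 * m%:R * eps1 * vol B = gamma * delta * vol B by rewrite e1m.
  rewrite /gamma; lra.
exists (z - r *: (x0 *m Q)), Q; first exact: QsSO.
move=> _ [x xP <-].
have -> : r *: (x *m Q) + (z - r *: (x0 *m Q)) = z + r *: ((x - x0) *m Q).
  by rewrite mulmxBl scalerBr addrCA.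
have [->|xx0] := eqVneq x x0; first by rewrite subrr mul0mx scaler0 addr0; case: Xz.
have [] // := zQ (x - x0) _; apply/map_f; rewrite mem_rem_uniq ?fset_uniq// inE xx0.
exact: xP.
Qed.
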